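(* Let $\{B_t\}_{t\in\mathbb{R}}$ and $\{W_t\}_{t\in\mathbb{R}}$ be two independent standard Brownian motions on the real line, and let $\{B_H(t)\}_{t\in\mathbb{R},H\in(0,1)}$ and $\{W_H(t)\}_{t\in\mathbb{R},H\in(0,1)}$ be the dependent fractional Brownian fields generated by them, i.e. $$B_H(t)=\frac{1}{c_H}\int_{-\infty}^{\infty}\left((t-x)_+^{H-\frac12}-(-x)_+^{H-\frac12}\right)dB_x,\qquad W_H(t)=\frac{1}{c_H}\int_{-\infty}^{\infty}\left((t-x)_+^{H-\frac12}-(-x)_+^{H-\frac12}\right)dW_x .$$ For $t\ge 0$ let $B_H^e(t)=\frac{B_H(t)+B_H(-t)}{2}$ be the even part of $B$ and $W_H^o(t)=\frac{W_H(t)-W_H(-t)}{2}$ the odd part of $W$. Then the field $\{Z_H(t)\}_{t\in\mathbb{R},H\in(0,1)}$ defined by $$Z_H(t)=\begin{cases}B_H^e(t)+W_H^o(t)&\text{for }t\ge 0,\\ B_H^e(-t)-W_H^o(-t)&\text{for }t<0\end{cases}$$ has the covariance $$\mathbb{E}\,Z_H(t)Z_{H'}(s)=a_{H,H'}\,\frac{|t|^{H+H'}+|s|^{H+H'}-|t-s|^{H+H'}}{2}$$ for all $s,t\in\mathbb{R}$ and $H,H'\in(0,1)$.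
   Context: Notation: $x_+^\alpha=x^\alpha$ if $x>0$ and $x_+^\alpha=0$ if $x\le 0$; the stochastic integrals are Wiener integrals of deterministic $L^2(\mathbb{R})$ functions; $$c_H=\frac{\Gamma(H+\frac12)}{\sqrt{\Gamma(2H+1)\sin(\pi H)}}.$$ For $H+H'\neq 1$, $$a_{H,H'}=-\frac{2}{\pi}\sqrt{\Gamma(2H+1)\sin(\pi H)}\sqrt{\Gamma(2H'+1)\sin(\pi H')}\;\Gamma(-(H+H'))\cos\left((H'-H)\tfrac{\pi}{2}\right)\cos\left((H+H')\tfrac{\pi}{2}\right),$$ and for $H+H'=1$, $$a_{H,H'}=\sqrt{\Gamma(2H+1)\Gamma(3-2H)}\,\sin^2(\pi H).$$ *)

(* Defs.v *)
From HB Require Import structures.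
From mathcomp Require Import all_boot all_order all_algebra.
From mathcomp Require Import all_classical all_reals all_analysis.
Set Implicit Arguments.
Unset Strict Implicit.
Unset Printing Implicit Defensive.
Import Order.TTheory GRing.Theory Num.Theory.
Import numFieldNormedType.Exports.
Local Open Scope classical_set_scope.
Local Open Scope ring_scope.

(* Euler's integral; meaningful for 0 < z only. *)
Definition euler_integral (R : realType) (z : R) : R :=
  \int[lebesgue_measure]_(x in `]0, +oo[) (x `^ (z - 1) * expR (- x)).

(* Gamma function on the real line without 0, -1, -2, ..., extended from z > 0
   to z <= 0 by Gamma z = Gamma (z + n) / (z (z + 1) ... (z + n - 1)), where n
   is the least natural number such that z + n > 0. *)
Definition Gamma (R : realType) (z : R) : R :=
  let n := if 0 < z then 0%N else (Num.truncn (- z)).+1 in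
  euler_integral (z + n%:R) / \prod_(k < n) (z + k%:R).

(* x_+ ^ a. Unlike powR, its value at x = 0 is 0 even for a = 0. *)
Definition pospow (R : realType) (x a : R) : R :=
  if 0 < x then x `^ a else 0.

Definition cH (R : realType) (H : R) : R :=
  Gamma (H + 2^-1) / Num.sqrt (Gamma (2 * H + 1) * sin (pi * H)).

Definition aHH (R : realType) (H H' : R) : R :=
  if H + H' == 1 then
    Num.sqrt (Gamma (2 * H + 1) * Gamma (3 - 2 * H)) * sin (pi * H) ^+ 2
  else
    - (2 / pi) * Num.sqrt (Gamma (2 * H + 1) * sin (pi * H))
      * Num.sqrt (Gamma (2 * H' + 1) * sin (pi * H'))
      * Gamma (- (H + H'))
      * cos ((H' - H) * (pi / 2)) * cos ((H + H') * (pi / 2)).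

(* Taking some of the [A i] equal to [setT] gives the product rule for every
   subfamily. *)
Definition mutually_independent d (T : measurableType d) (R : realType)
    (P : probability T R) (I : finType) (X : I -> T -> R) : Prop :=
  forall A : I -> set R, (forall i, measurable (A i)) ->
    P (\bigcap_i (X i @^-1` A i)) = (\prod_(i : I) P (X i @^-1` A i))%E.

Definition process_sigma_algebra d (T : measurableType d) (R : realType)
    (X : R -> T -> R) : set (set T) :=
  <<s \bigcup_t preimage_set_system setT (X t) measurable >>.

Definition independent_processes d (T : measurableType d) (R : realType)
    (P : probability T R) (X Y : R -> T -> R) : Prop :=
  forall E F : set T, process_sigma_algebra X E -> process_sigma_algebra Y F ->
    P (E `&` F) = (P E * P F)%E.

(* Two-sided standard Brownian motion; the second parameter of [normal_prob]
   is the standard deviation. *)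
Definition standard_brownian_motion d (T : measurableType d) (R : realType)
    (P : probability T R) (B : R -> {RV P >-> R}) : Prop :=
  [/\ {ae P, forall w, B 0 w = 0},
      forall (n : nat) (t : nat -> R), (forall i, t i <= t i.+1) ->
        mutually_independent P
          (fun i : 'I_n => (B (t i.+1) \- B (t i) : T -> R)),
      forall s t : R, s < t -> forall A : set R, measurable A ->
        pushforward P (B t \- B s) A = normal_prob 0 (Num.sqrt (t - s)) A &
      {ae P, forall w, continuous (fun t : R => B t w)}].

(* A step function is coded by a list of triples ((a, b), c) with a <= b,
   which stands for the sum of the functions c * 1_]a, b]. *)
Definition step_code (R : realType) (s : seq (R * R * R)) : bool :=
  all (fun p => p.1.1 <= p.1.2) s.

Definition step_fun (R : realType) (s : seq (R * R * R)) (x : R) : R :=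
  \sum_(p <- s) p.2 * \1_(`]p.1.1, p.1.2]%classic) x.

Definition step_integral (T : Type) (R : realType) (B : R -> T -> R)
    (s : seq (R * R * R)) (w : T) : R :=
  \sum_(p <- s) p.2 * (B p.1.2 w - B p.1.1 w).

Definition L2_cvg d (T : measurableType d) (R : realType)
    (mu : {measure set T -> \bar R}) (u : nat -> T -> R) (f : T -> R) : Prop :=
  Lnorm mu 2%:E (EFin \o (u n \- f)) @[n --> \oo] --> (0%E : \bar R).

(* X is (a version of) the Wiener integral of f with respect to B: the limit in
   L^2(P) of the integrals of step functions converging to f in L^2(R). *)
Definition is_wiener_integral d (T : measurableType d) (R : realType)
    (P : probability T R) (B : R -> {RV P >-> R}) (f : R -> R)
    (X : {RV P >-> R}) : Prop :=
  f \in Lfun (@lebesgue_measure R) 2%:E /\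
  exists s : nat -> seq (R * R * R),
    [/\ forall n, step_code (s n),
        L2_cvg (@lebesgue_measure R) (fun n => step_fun (s n)) f &
        L2_cvg P (fun n => step_integral B (s n)) X].

Definition fbm_kernel (R : realType) (H t x : R) : R :=
  pospow (t - x) (H - 2^-1) - pospow (- x) (H - 2^-1).

(* The first index of BH is the Hurst parameter, the second one is time; only
   Hurst parameters in (0, 1) matter. *)
Definition fractional_brownian_field d (T : measurableType d) (R : realType)
    (P : probability T R) (B : R -> {RV P >-> R})
    (BH : R -> R -> {RV P >-> R}) : Prop :=
  forall H t : R, 0 < H < 1 ->
    exists2 I : {RV P >-> R}, is_wiener_integral B (fbm_kernel H t) I &
      {ae P, forall w, BH H t w = (cH H)^-1 * I w}.

Definition even_part (T : Type) (R : realType) (X : R -> R -> T -> R)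
    (H t : R) (w : T) : R := (X H t w + X H (- t) w) / 2.

Definition odd_part (T : Type) (R : realType) (X : R -> R -> T -> R)
    (H t : R) (w : T) : R := (X H t w - X H (- t) w) / 2.

Definition Z_field (T : Type) (R : realType) (BH WH : R -> R -> T -> R)
    (H t : R) (w : T) : R :=
  if 0 <= t then even_part BH H t w + odd_part WH H t w
  else even_part BH H (- t) w - odd_part WH H (- t) w.

(* Main.v *)
Require Import Defs.
From HB Require Import structures.
From mathcomp Require Import all_boot all_order all_algebra.
From mathcomp Require Import all_classical all_reals all_analysis measurable_realfun.
From mathcomp Require Import ring lra.
Set Implicit Arguments.
Unset Strict Implicit.
Unset Printing Implicit Defensive.
Import Order.TTheory GRing.Theory Num.Theory.
Import numFieldNormedType.Exports.
Local Open Scope classical_set_scope.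
Local Open Scope ring_scope.

(** Write k_H(t) for the kernel of B_H(t), G(t, s) for the scalar product of
k_H(t) and k_H'(s) in L^2(R), and a = H - 1/2, b = H' - 1/2.

Whatever the sign of t, Z_H(t) is half of B_H(t) + B_H(-t) + W_H(t) - W_H(-t).
By the isometry of Wiener integrals (wiener_isometry) and the independence of B
and W (wiener_cross), the terms in G(t, -s) and G(-t, s) cancel between the even
and the odd part, so that 2 c_H c_H' E Z_H(t) Z_H'(s) = G(t, s) + G(-t, -s). It
remains to compute this symmetrised scalar product.

Shape in t and s. Since k_H(t) - k_H(u) is a translate of k_H(t - u), the
function G is the covariance of two processes with jointly stationary
increments. This alone gives
G(t, s) + G(s, t) = D(t) + D(s) - D(t - s) with D(t) = G(t, t), and scaling gives
D(t) = |t|^(H + H') D(1). But G itself is not symmetric, and G(-t, -s) has to be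
compared with G(s, t). They are equal (stationary_reversal): for t and s in a
lattice this is combinatorics of stationary increments, and the general case
follows by continuity. So G(t, s) + G(-t, -s) has the announced shape.

The constant. It remains to see that D(1) = c_H c_H' a_{H,H'}
(norming_constant). Splitting the line at 0 gives
D(1) = 1 / (H + H') + int_0^oo P Q with P(x) = (1 + x)^a - x^a and
Q(x) = (1 + x)^b - x^b. For H + H' <> 1 an explicit function has as derivative
P Q plus two Beta integrands, up to constant factors (is_derive_pow_incr_primitive), so
that P Q integrates to Gamma factors. For H + H' = 1 the derivative of x P Q
leads instead to the integral of (exp(-(1 - a) t) - exp(-(1 + a) t)) /
(1 - exp(-t)), which is 1 / a - pi cot(pi a).

Both cases use the reflection formula Gamma(z) Gamma(1 - z) = pi / sin(pi z),
which is deduced here from the representation of pi cot(pi z) by the integral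
over t > 0 of (exp(-z t) - exp(-(1 - z) t)) / (1 - exp(-t)) (cot_intE). Both
sides satisfy the same duplication formula and have the same poles, with
Lipschitz remainders on ]0, 1[; applying the duplication formula n times to the
difference divides its Lipschitz constant by 2^n, hence the difference is
constant, and it vanishes at 1/2. *)

(** * Affine changes of variable and exhaustion *)

Section affine.
Context {R : realType}.
Notation mu := (@lebesgue_measure R).
Variables (c d : R).
Hypothesis c0 : c != 0.

Let phi : measurableTypeR R -> measurableTypeR R := fun x : R => c * x + d.

Let mphi : measurable_fun [set: measurableTypeR R] phi.
Proof. by apply: measurable_funD => //; exact: measurable_funM. Qed.

Let c_ge0 : 0 <= `|c|. Proof. by []. Qed.

Let nu : {measure set (measurableTypeR R) -> \bar R}.
Proof.
pose nu : {measure set (measurableTypeR R) -> \bar R} :=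
  mscale (NngNum c_ge0) (pushforward mu phi).
exact: (nu mphi).
Defined.

(** The right-hand side is a measure in A, and it has the right value on intervals. *)
Let lebesgue_affine (A : set R) : measurable A ->
  mu A = (`|c|%:E * mu (phi @^-1` A))%E.
Proof.
move=> mA.
rewrite -[RHS]/(nu A); apply: lebesgue_measure_unique => //.
move=> X [[a b] _ <-] /=.
rewrite /nu/= /mscale /pushforward /=.
have [cp|cn|/esym ce] := ltgtP 0 c; last by move: c0; rewrite ce eqxx.
- rewrite [X in (_ * lebesgue_measure X)%E](_ : _ = `](a - d) / c, (b - d) / c]%classic); last first.
    apply/seteqP; split => x /=; rewrite !in_itv/= /phi;
    by rewrite ltr_pdivrMr// ler_pdivlMr// (mulrC x) ltrBlDr lerBrDr.
  rewrite !lebesgue_measure_itv/= !lte_fin.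
  rewrite gtr0_norm// ltr_pM2r ?invr_gt0// ltrD2r.
  case: ifP => _; last by rewrite mule0.
  rewrite -!EFinD -EFinM; congr EFin; field; lra.
- rewrite [X in (_ * lebesgue_measure X)%E](_ : _ = `[(b - d) / c, (a - d) / c[%classic); last first.
    apply/seteqP; split => x /=; rewrite !in_itv/= /phi;
    by rewrite ltr_ndivlMr// ler_ndivrMr// (mulrC x) andbC ltrBlDr lerBrDr.
  rewrite !lebesgue_measure_itv/= !lte_fin.
  rewrite ltr0_norm// ltr_nM2r ?invr_lt0// ltrD2r.
  case: ifP => _; last by rewrite mule0.
  rewrite -!EFinD -EFinM; congr EFin; field; lra.
Qed.

Lemma ge0_integral_affine (f : R -> \bar R) : measurable_fun [set: R] f ->
  (forall x, 0 <= f x)%E ->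
  (\int[mu]_x f x = `|c|%:E * \int[mu]_x f (c * x + d)%R)%E.
Proof.
move=> mf f0.
transitivity (\int[nu]_x f x)%E.
  by apply: eq_measure_integral => A mA _; exact: (lebesgue_affine mA).
rewrite ge0_integral_mscale//; congr (_ * _)%E.
by rewrite ge0_integral_pushforward.
Qed.

Lemma integrable_affine (f : R -> R) : mu.-integrable setT (EFin \o f) ->
  mu.-integrable setT (EFin \o (fun x => f (c * x + d))).
Proof.
move=> /integrableP[/= mf fi]; apply/integrableP; split.
  exact: (measurableT_comp mf mphi).
have mf' : measurable_fun [set: R] f by exact/measurable_EFinP.
move: fi; rewrite ge0_integral_affine//; last first.
  by apply/measurable_EFinP; exact: measurableT_comp.
have c1 : (0 < `|c|%:E)%E by rewrite lte_fin normr_gt0.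
move=> h; rewrite ltey; apply/eqP => /= e.
by move: h; rewrite /= e gt0_muley// ltxx.
Qed.

Lemma Rintegral_affine (f : R -> R) : mu.-integrable setT (EFin \o f) ->
  \int[mu]_x f x = `|c| * \int[mu]_x f (c * x + d).
Proof.
move=> fi.
have mf : measurable_fun [set: R] (EFin \o f) by exact: measurable_int fi.
have fic := integrable_affine fi.
have := integrable_pos_fin_num measurableT fic.
have := integrable_neg_fin_num measurableT fic.
move=> fn fp; rewrite /Rintegral integralE [in RHS]integralE.
rewrite ge0_integral_affine//; last exact: measurable_funepos.
rewrite [X in (_ - X)%E]ge0_integral_affine//; last exact: measurable_funeneg.
have fineZB (r : R) (x y : \bar R) : x \is a fin_num -> y \is a fin_num ->
    fine (r%:E * x - r%:E * y)%E = r * fine (x - y)%E.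
  by case: x => [x| |]// ; case: y => [y| |]// _ _ /=; rewrite mulrBr.
have posE x : ((EFin \o f)^\+ (c * x + d)%R = (EFin \o (fun x => f (c * x + d)%R))^\+ x)%E.
  by rewrite !funeposE.
have negE x : ((EFin \o f)^\- (c * x + d)%R = (EFin \o (fun x => f (c * x + d)%R))^\- x)%E.
  by rewrite !funenegE.
rewrite -(fineZB _ _ _ fp fn).
by congr (fine (_ * _ - _ * _)%E); apply: eq_integral => x _; [exact: posE|exact: negE].
Qed.

End affine.

Section exhaustion.
Context d (T : measurableType d) (R : realType).
Variable mu : {measure set T -> \bar R}.

(** Dominated convergence, the dominating function being |f|. It is the source of all
improper integrals of signed functions below. *)
Lemma cvg_Rintegral_bigcup (E : (set T)^nat) (f : T -> R) :
  nondecreasing_seq E -> (forall n, measurable (E n)) ->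
  mu.-integrable (\bigcup_n E n) (EFin \o f) ->
  \int[mu]_(x in E n) f x @[n --> \oo] --> \int[mu]_(x in \bigcup_n E n) f x.
Proof.
move=> ndE mE fi.
have mU : measurable (\bigcup_n E n) by exact: bigcupT_measurable.
have mf := measurable_int _ fi.
have EU n : E n `<=` \bigcup_n E n by exact: bigcup_sup.
apply: fine_cvg; rewrite fineK; last exact: integrable_fin_num.
have -> : (fun n => (\int[mu]_(x in E n) (f x)%:E)%E) =
    (fun n => (\int[mu]_(x in \bigcup_n E n) ((EFin \o f) \_ (E n)) x)%E).
  by apply/funext => n; rewrite -integral_mkcondr setIidr.
apply: (@dominated_cvg _ _ _ mu _ mU _ _ (abse \o (EFin \o f))) => //.
- move=> n; apply/measurable_restrict => //.
  by apply: measurable_funS mf => //; exact: subIsetl.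
- move=> x [n _ Enx]; apply/cvg_ballP => e e0; near=> m.
  rewrite patchE mem_set; first exact: ballxx.
  have /ndE : (n <= m)%N by near: m; exact: nbhs_infty_ge.
  by rewrite subsetEset; apply.
- exact: integrable_abse.
- move=> n x Ux /=; rewrite patchE; case: ifPn => // _.
  by rewrite /= normr0 lee_fin.
Unshelve. all: by end_near. Qed.

End exhaustion.

(** * Improper integrals *)

Section improper.
Context (R : realType).
Notation mu := (@lebesgue_measure R).
Variables (al be : R^nat) (I : set R).
Hypothesis ab : forall n, al n < be n.
Hypothesis ndE : nondecreasing_seq (fun n => `[al n, be n]%classic).
Hypothesis IE : I = \bigcup_n `[al n, be n]%classic.

Let EI n x : x \in `[al n, be n] -> I x.
Proof. by move=> xn; rewrite IE; exists n. Qed.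

Let mI : measurable I.
Proof. by rewrite IE; apply: bigcupT_measurable. Qed.

Lemma improper_measurable (f : R -> R) :
  (forall x, I x -> {for x, continuous f}) -> measurable_fun I f.
Proof.
move=> cf; rewrite IE; apply/measurable_fun_bigcup => // n.
apply: subspace_continuous_measurable_fun => //.
apply/subspace_continuousP => x xE; apply: cvg_within_filter.
by apply: cf; exact: EI xE.
Qed.

Let FTCn (F f : R -> R) n :
  (forall x, I x -> is_derive x 1 F (f x)) ->
  (forall x, I x -> {for x, continuous f}) ->
  (\int[mu]_(x in `[al n, be n]) (f x)%:E = (F (be n) - F (al n))%:E)%E.
Proof.
move=> dF cf.
have cF x : I x -> {for x, continuous F}.
  move=> Ix; apply: differentiable_continuous.
  by apply/derivable1_diffP; have [] := dF _ Ix.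
rewrite EFinB; apply: continuous_FTC2 => //.
- apply/subspace_continuousP => x xE; apply: cvg_within_filter.
  by apply: cf; exact: EI xE.
- split.
  + move=> x xE; have [] // := dF x _.
    by apply: (@EI n); move: xE; rewrite !in_itv/= => /andP[/ltW-> /ltW->].
  + apply: cvg_at_right_filter; apply: cF; apply: (@EI n).
    by rewrite in_itv/= lexx ltW.
  + apply: cvg_at_left_filter; apply: cF; apply: (@EI n).
    by rewrite in_itv/= lexx ltW.
- move=> x xE; rewrite derive1E; apply: derive_val.
  apply: dF; apply: (@EI n).
  by move: xE; rewrite !in_itv/= => /andP[/ltW-> /ltW->].
Qed.

(** I is an interval, open or not, exhausted by the compact intervals [al n, be n].
Nonnegativity makes the integral over I the limit of those over [al n, be n], and
integrability comes out of the formula instead of being assumed. *)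
Lemma ge0_improper_FTC (F f : R -> R) (l0 l1 : R) :
  (forall x, I x -> is_derive x 1 F (f x)) ->
  (forall x, I x -> {for x, continuous f}) ->
  (forall x, I x -> 0 <= f x) ->
  F (al n) @[n --> \oo] --> l0 -> F (be n) @[n --> \oo] --> l1 ->
  (\int[mu]_(x in I) (f x)%:E = (l1 - l0)%:E)%E.
Proof.
move=> dF cf f0 Fl0 Fl1.
have mf n : measurable_fun `[al n, be n] f.
  apply: measurable_funS (improper_measurable cf) => //.
  exact: EI.
have mEf n : measurable_fun `[al n, be n] (EFin \o f).
  by apply/measurable_EFinP.
have cI : (\int[mu]_(x in `[al n, be n]) (f x)%:E)%E @[n --> \oo] -->
    (\int[mu]_(x in I) (f x)%:E)%E.
  rewrite IE; apply: (@ge0_nondecreasing_set_cvg_integral _ (measurableTypeR R) R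
    (fun n => `[al n, be n]%classic) (EFin \o f) mu ndE).
  - by move=> n; exact: measurable_itv.
  - exact: mEf.
  - by move=> n x xE; rewrite lee_fin f0//; exact: EI xE.
rewrite -(cvg_lim _ cI)//.
apply/cvg_lim => //=.
under eq_fun do rewrite (FTCn _ dF cf).
by apply: cvg_EFin; [exact: nearW|exact: cvgB].
Qed.

Lemma improper_FTC (F f : R -> R) (l0 l1 : R) :
  (forall x, I x -> is_derive x 1 F (f x)) ->
  (forall x, I x -> {for x, continuous f}) ->
  mu.-integrable I (EFin \o f) ->
  F (al n) @[n --> \oo] --> l0 -> F (be n) @[n --> \oo] --> l1 ->
  \int[mu]_(x in I) f x = l1 - l0.
Proof.
move=> dF cf; rewrite IE => fi Fl0 Fl1.
have := @cvg_Rintegral_bigcup _ (measurableTypeR R) R mu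
  (fun n => `[al n, be n]%classic) f ndE (fun n => measurable_itv _) fi.
move=> /(cvg_lim (@Rhausdorff R)) <-.
apply/cvg_lim => //=.
rewrite /Rintegral; under eq_fun do rewrite (FTCn _ dF cf)/=.
exact: cvgB.
Qed.

(** The substitution rule on each [al n, be n], passed to the limit on both sides. *)
Lemma ge0_improper_substitution (phi phi' G : R -> R) (J : set R) :
  J = \bigcup_n `[phi (al n), phi (be n)]%classic ->
  (forall x, I x -> is_derive x 1 phi (phi' x)) ->
  (forall x, I x -> {for x, continuous phi'}) ->
  (forall x, I x -> 0 <= phi' x) ->
  (forall x y, I x -> I y -> x < y -> phi x < phi y) ->
  (forall y, J y -> {for y, continuous G}) ->
  (forall y, J y -> 0 <= G y) ->
  (\int[mu]_(y in J) (G y)%:E = \int[mu]_(x in I) (G (phi x) * phi' x)%:E)%E.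
Proof.
move=> JE dphi cphi' phi'0 incr cG G0.
have Eal n : al n \in `[al n, be n] by rewrite in_itv/= lexx ltW.
have Ebe n : be n \in `[al n, be n] by rewrite in_itv/= lexx ltW.
have cphi x : I x -> {for x, continuous phi}.
  move=> Ix; apply: differentiable_continuous.
  by apply/derivable1_diffP; have [] := dphi _ Ix.
have nd x y : I x -> I y -> x <= y -> phi x <= phi y.
  by move=> Ix Iy; rewrite le_eqVlt => /predU1P[->//|/incr h]; rewrite ltW// h.
have IJ x : I x -> J (phi x).
  rewrite {1}IE => -[n _ xE]; rewrite JE; exists n => //=.
  move: xE; rewrite /= !in_itv/= => /andP[h1 h2].
  have Ix : I x by apply: (@EI n); rewrite in_itv/= h1 h2.
  by rewrite !nd//; [exact: EI (Ebe n)|exact: EI (Eal n)].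
have mE n : (\int[mu]_(y in `[phi (al n), phi (be n)]) (G y)%:E =
             \int[mu]_(x in `[al n, be n]) (G (phi x) * phi' x)%:E)%E.
  have dE x : I x -> derive1 phi x = phi' x.
    by move=> Ix; rewrite derive1E; apply: derive_val; exact: dphi.
  rewrite integration_by_substitution_increasing.
  - apply: eq_integral => x; rewrite inE => xE.
    by rewrite /= fctE/= dE//; exact: EI xE.
  - exact: ltW.
  - move=> x y xE yE xy; apply: incr => //; [exact: EI xE|exact: EI yE].
  - move=> x xE.
    have nE : \forall y \near x, phi' y = derive1 phi y.
      near=> y; apply/esym/dE; apply: (@EI n).
      apply: subset_itv_oo_cc.
      by near: y; apply: near_in_itvoo.
    rewrite /continuous_at/= dE; last by apply: (@EI n); exact: subset_itv_oo_cc.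
    apply: cvg_trans; first exact: (near_eq_cvg nE).
    by apply: cphi'; apply: (@EI n); exact: subset_itv_oo_cc.
  - apply/cvg_ex; exists (phi' (al n)).
    have nE : \forall y \near (al n)^'+, phi' y = derive1 phi y.
      near=> y; apply/esym/dE; apply: (@EI n); rewrite in_itv/=; apply/andP; split=> //.
      near: y; exact: nbhs_right_le.
    apply: cvg_trans; first exact: (near_eq_cvg nE).
    by apply: cvg_at_right_filter; apply: cphi'; exact: EI (Eal n).
  - apply/cvg_ex; exists (phi' (be n)).
    have nE : \forall y \near (be n)^'-, phi' y = derive1 phi y.
      near=> y; apply/esym/dE; apply: (@EI n); rewrite in_itv/=; apply/andP; split=> //.
      near: y; exact: nbhs_left_ge.
    apply: cvg_trans; first exact: (near_eq_cvg nE).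
    by apply: cvg_at_left_filter; apply: cphi'; exact: EI (Ebe n).
  - split.
    + move=> x xE; have [] // := dphi x _.
      by apply: (@EI n); exact: subset_itv_oo_cc.
    + by apply: cvg_at_right_filter; apply: cphi; exact: EI (Eal n).
    + by apply: cvg_at_left_filter; apply: cphi; exact: EI (Ebe n).
  - apply/subspace_continuousP => y yE; apply: cvg_within_filter.
    by apply: cG; rewrite JE; exists n.
have ndJ : nondecreasing_seq (fun n => `[phi (al n), phi (be n)]%classic).
  move=> n m nm; rewrite subsetEset => y /=; rewrite !in_itv/= => /andP[h1 h2].
  have := ndE nm; rewrite subsetEset => E.
  have := E _ (Eal n); have := E _ (Ebe n).
  rewrite /= !in_itv/= => /andP[b1 b2] /andP[a1 a2].
  rewrite (le_trans _ h1) ?(le_trans h2)// nd//;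
    by [exact: EI (Eal _)|exact: EI (Ebe _)].
have cGphi x : I x -> {for x, continuous (fun x => G (phi x) * phi' x)}.
  move=> Ix; apply: cvgM; last exact: cphi'.
  by apply: continuous_comp; [exact: cphi|exact: cG (IJ _ Ix)].
have mG n : measurable_fun `[phi (al n), phi (be n)] G.
  apply: subspace_continuous_measurable_fun => //.
  apply/subspace_continuousP => y yE; apply: cvg_within_filter.
  by apply: cG; rewrite JE; exists n.
have mEG n : measurable_fun `[phi (al n), phi (be n)] (EFin \o G).
  by apply/measurable_EFinP.
have mEGphi n : measurable_fun `[al n, be n] (EFin \o (fun x => G (phi x) * phi' x)).
  apply/measurable_EFinP.
  apply: measurable_funS (improper_measurable cGphi) => //.
  exact: EI.
have cJ : (\int[mu]_(y in `[phi (al n), phi (be n)]) (G y)%:E)%E @[n --> \oo] -->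
    (\int[mu]_(y in J) (G y)%:E)%E.
  rewrite JE; apply: (@ge0_nondecreasing_set_cvg_integral _ (measurableTypeR R) R
    (fun n => `[phi (al n), phi (be n)]%classic) (EFin \o G) mu ndJ).
  - by move=> n; exact: measurable_itv.
  - exact: mEG.
  - by move=> n x xE; rewrite lee_fin G0// JE; exists n.
have cI : (\int[mu]_(x in `[al n, be n]) (G (phi x) * phi' x)%:E)%E @[n --> \oo] -->
    (\int[mu]_(x in I) (G (phi x) * phi' x)%:E)%E.
  rewrite [in X in _ --> X]IE; apply: (@ge0_nondecreasing_set_cvg_integral _ (measurableTypeR R) R
    (fun n => `[al n, be n]%classic)
    (EFin \o (fun x => G (phi x) * phi' x)) mu ndE).
  - by move=> n; exact: measurable_itv.
  - exact: mEGphi.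
  - move=> n x xE; have Ix := EI xE.
    by rewrite lee_fin mulr_ge0 ?phi'0// G0//; exact: IJ.
rewrite -(cvg_lim _ cJ)// -(cvg_lim _ cI)//.
by congr (limn _); apply/funext => n; exact: mE.
Unshelve. all: by end_near. Qed.

End improper.

(** * Calculus on the positive half-line *)

Section powers.
Context (R : realType).
Implicit Types (x a : R).

Lemma is_derive_powR1D a x : 0 < 1 + x ->
  is_derive x 1 (fun y => (1 + y) `^ a) (a * (1 + x) `^ (a - 1)).
Proof.
move=> x0.
have d1 : is_derive x 1 (fun y : R => 1 + y) 1 by apply: is_derive_eq; rewrite add0r mulr1.
have := @is_derive1_comp R (fun y => y `^ a) (fun y => 1 + y) x _ _
  (is_derive1_powR a x0) d1.
by rewrite mulr1.
Qed.

Lemma continuous_powR a x : 0 < x -> {for x, continuous (fun y : R => y `^ a)}.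
Proof.
move=> x0; apply: differentiable_continuous; apply/derivable1_diffP.
by apply: derivable_powR; rewrite in_itv/= x0.
Qed.

Lemma continuous_powR1D a x : 0 < 1 + x -> {for x, continuous (fun y : R => (1 + y) `^ a)}.
Proof.
move=> x0; apply: differentiable_continuous; apply/derivable1_diffP.
by have [] := is_derive_powR1D a x0.
Qed.

Lemma powR_cvgy0 a : a < 0 -> x `^ a @[x --> +oo] --> (0 : R).
Proof.
move=> a0; apply/cvgr0Pnorm_lt => e e0.
near=> x.
have x0 : 0 < x by near: x; exact: nbhs_pinfty_gt.
rewrite ger0_norm ?powR_ge0//.
have ex : e `^ a^-1 < x by near: x; exact: nbhs_pinfty_gt.
have : x^-1 < (e `^ a^-1)^-1 by rewrite ltf_pV2// posrE powR_gt0.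
move/(@gt0_ltr_powR R (- a)).
rewrite !nnegrE !invr_ge0 ltW//= powR_ge0 => /(_ _ erefl erefl).
have powV (y : R) : 0 < y -> y^-1 `^ (- a) = y `^ a.
  by move=> y0; rewrite -powR_inv1 ?ltW// -powRrM mulN1r opprK.
rewrite oppr_gt0 !powV ?powR_gt0// -powRrM mulVf ?lt_eqF// powRr1 ?ltW//.
exact.
Unshelve. all: by end_near. Qed.

Lemma powR_mulV a x : 0 < x -> x `^ (a - 1) = x `^ a / x.
Proof. by move=> x0; rewrite powRB ?powRr1 ?ltW//; apply/implyP => _; rewrite gt_eqF. Qed.

End powers.

Section halfline.
Context (R : realType).
Notation mu := (@lebesgue_measure R).

Let al (n : nat) : R := n.+1%:R^-1.
Let be (n : nat) : R := n.+2%:R.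

(** The half-line is exhausted by the intervals [1 / (n + 1), n + 2]; the bounds are
shifted so that they are never degenerate. *)
Lemma halfline_itv_lt n : al n < be n.
Proof.
rewrite /al /be (@le_lt_trans _ _ 1)// ?ltr1n//.
by rewrite invf_le1 ?ler1n// ltr0n.
Qed.

Lemma halfline_itv_nondecreasing : nondecreasing_seq (fun n => `[al n, be n]%classic).
Proof.
move=> n m nm; rewrite subsetEset => x /=; rewrite !in_itv/= => /andP[h1 h2].
rewrite (le_trans _ h1)/= ?(le_trans h2)//.
- by rewrite /be ler_nat.
- by rewrite /al lef_pV2 ?posrE ?ltr0n// ler_nat.
Qed.

Lemma halfline_bigcup : `]0%R, +oo[%classic = \bigcup_n `[al n, be n]%classic.
Proof.
apply/seteqP; split => x /=.
  rewrite in_itv/= andbT => x0.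
  exists (maxn (Num.truncn x^-1) (Num.truncn x)) => //=.
  rewrite in_itv/= /al /be; apply/andP; split.
    rewrite -[leRHS]invrK lef_pV2 ?posrE ?invr_gt0 ?ltr0n//.
    apply/ltW; apply: (lt_le_trans (truncnS_gt _)).
    by rewrite ler_nat ltnS leq_maxl.
  apply/ltW; apply: (lt_le_trans (truncnS_gt _)).
  by rewrite ler_nat ltnS ltnW// ltnS leq_maxr.
move=> [n _] /=; rewrite !in_itv/= andbT => /andP[h _].
by apply: lt_le_trans h; rewrite invr_gt0 ltr0n.
Qed.

Let al0 : al n @[n --> \oo] --> (0 : R).
Proof.
exact: cvg_harmonic.
Qed.

Let bey : be n @[n --> \oo] --> +oo.
Proof.
apply/cvgryPge => A; near=> n; rewrite /be.
apply: (@le_trans _ _ (n%:R : R)); last by rewrite ler_nat -addn2 leq_addr.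
by near: n; exact: nbhs_infty_ger.
Unshelve. all: by end_near. Qed.

Let cvg_al (F : R -> R) (l : R) : F x @[x --> 0^'+] --> l -> F (al n) @[n --> \oo] --> l.
Proof.
move/cvg_at_rightP; apply; split; last exact: al0.
by move=> n; rewrite invr_gt0 ltr0n.
Qed.

Let cvg_be (F : R -> R) (l : R) : F x @[x --> +oo] --> l -> F (be n) @[n --> \oo] --> l.
Proof. by move/cvg_pinftyP; apply. Qed.

Lemma halfline_measurable (f : R -> R) :
  (forall x : R, 0 < x -> {for x, continuous f}) -> measurable_fun (`]0%R, +oo[ : set R) f.
Proof.
move=> cf; apply: (improper_measurable halfline_bigcup) => x.
by rewrite /= in_itv/= andbT; exact: cf.
Qed.

Lemma ge0_halfline_FTC (F f : R -> R) (l0 l1 : R) :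
  (forall x : R, 0 < x -> is_derive x 1 F (f x)) ->
  (forall x : R, 0 < x -> {for x, continuous f}) ->
  (forall x : R, 0 < x -> 0 <= f x) ->
  F x @[x --> 0^'+] --> l0 -> F x @[x --> +oo] --> l1 ->
  (\int[mu]_(x in `]0%R, +oo[) (f x)%:E = (l1 - l0)%:E)%E.
Proof.
move=> dF cf f0 Fl0 Fl1.
by apply: (ge0_improper_FTC halfline_itv_lt halfline_itv_nondecreasing halfline_bigcup (F := F)) => [x|x|x||];
  rewrite /= ?in_itv/= ?andbT; auto.
Qed.

Lemma halfline_FTC (F f : R -> R) (l0 l1 : R) :
  (forall x : R, 0 < x -> is_derive x 1 F (f x)) ->
  (forall x : R, 0 < x -> {for x, continuous f}) ->
  mu.-integrable (`]0%R, +oo[ : set R) (EFin \o f) ->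
  F x @[x --> 0^'+] --> l0 -> F x @[x --> +oo] --> l1 ->
  \int[mu]_(x in `]0%R, +oo[) f x = l1 - l0.
Proof.
move=> dF cf fi Fl0 Fl1.
by apply: (improper_FTC halfline_itv_lt halfline_itv_nondecreasing halfline_bigcup (F := F)) => [x|x|||];
  rewrite /= ?in_itv/= ?andbT; auto.
Qed.

Lemma halfline_integrable (f g : R -> R) :
  (forall x : R, 0 < x -> {for x, continuous f}) ->
  mu.-integrable (`]0%R, +oo[ : set R) (EFin \o g) ->
  (forall x : R, 0 < x -> `|f x| <= g x) ->
  mu.-integrable (`]0%R, +oo[ : set R) (EFin \o f).
Proof.
move=> cf gi fg; apply: le_integrable gi => //.
  by apply/measurable_EFinP; exact: halfline_measurable.
move=> x /=; rewrite in_itv/= andbT => x0.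
by rewrite lee_fin (le_trans (fg _ x0))// ler_norm.
Qed.

Lemma ge0_halfline_integrable (f : R -> R) (l : R) :
  (forall x : R, 0 < x -> {for x, continuous f}) ->
  (forall x : R, 0 < x -> 0 <= f x) ->
  (\int[mu]_(x in `]0%R, +oo[) (f x)%:E = l%:E)%E ->
  mu.-integrable (`]0%R, +oo[ : set R) (EFin \o f).
Proof.
move=> cf f0 fl; apply/integrableP; split.
  by apply/measurable_EFinP; exact: halfline_measurable.
under eq_integral => x xI.
  rewrite gee0_abs; last first.
    by move: xI; rewrite inE/= in_itv/= andbT => /f0; rewrite lee_fin.
  over.
by rewrite fl ltry.
Qed.

Lemma halfline_affine (f : R -> \bar R) (c : R) : 0 < c ->
  measurable_fun (`]0%R, +oo[ : set R) f -> (forall x : R, (0 < x)%R -> 0 <= f x)%E ->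
  (\int[mu]_(x in `]0%R, +oo[) f x =
   \int[mu]_(x in `]0%R, +oo[) (c%:E * f (c * x)%R))%E.
Proof.
move=> c0 mf f0.
have mf' : measurable_fun setT (f \_ (`]0%R, +oo[ : set R)) by apply/(measurable_restrictT f).
have f'0 x : (0 <= (f \_ (`]0%R, +oo[ : set R)) x)%E.
  by rewrite patchE; case: ifPn => //; rewrite inE/= in_itv/= andbT; exact: f0.
rewrite integral_mkcond (@ge0_integral_affine _ c 0) ?gt_eqF//.
rewrite [RHS]integral_mkcond -ge0_integralZl//.
- apply: eq_integral => x _; rewrite addr0 !patchE gtr0_norm//.
  have -> : (c * x \in `]0%R, +oo[%classic) = (x \in `]0%R, +oo[%classic) :> bool.
    by apply/idP/idP; rewrite !inE/= !in_itv/= !andbT pmulr_rgt0.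
  by case: ifPn => //; rewrite mule0.
- under eq_fun do rewrite addr0.
  apply: measurableT_comp mf' _.
  exact: measurable_funM.
Qed.

End halfline.

Section halfline_signed.
Context (R : realType).
Notation mu := (@lebesgue_measure R).

Lemma halfline_Raffine (f : R -> R) (c : R) : 0 < c ->
  mu.-integrable (`]0%R, +oo[ : set R) (EFin \o f) ->
  \int[mu]_(x in `]0%R, +oo[) f x = \int[mu]_(x in `]0%R, +oo[) (c * f (c * x)).
Proof.
move=> c0 fi.
have fi' : mu.-integrable setT (EFin \o (f \_ (`]0%R, +oo[ : set R))).
  rewrite -restrict_EFin.
  have := @integrable_mkcond _ _ _ mu (`]0%R, +oo[ : set R) (EFin \o f).
  by move=> /(_ (measurable_itv _))[h _]; exact: h.
rewrite Rintegral_mkcond (Rintegral_affine 0 (lt0r_neq0 c0) fi').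
rewrite gtr0_norm// [RHS]Rintegral_mkcond -RintegralZl//; last first.
  exact: (integrable_affine 0 (lt0r_neq0 c0) fi').
apply: eq_Rintegral => x _; rewrite addr0 !patchE.
have -> : (c * x \in (`]0%R, +oo[%classic : set R)) = (x \in (`]0%R, +oo[%classic : set R)).
  by apply/idP/idP; rewrite !inE/= !in_itv/= !andbT pmulr_rgt0.
by case: ifPn => //; rewrite mulr0.
Qed.

End halfline_signed.

Section derive_rules.
Context (R : realType).
Implicit Types (f g : R -> R) (x a b : R).

Lemma is_derive_add f g x a b : is_derive x 1 f a -> is_derive x 1 g b ->
  is_derive x 1 (fun y => f y + g y) (a + b).
Proof. exact: is_deriveD. Qed.

Lemma is_derive_opp f x a : is_derive x 1 f a ->
  is_derive x 1 (fun y => - f y) (- a).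
Proof. exact: is_deriveN. Qed.

Lemma is_derive_mul f g x a b : is_derive x 1 f a -> is_derive x 1 g b ->
  is_derive x 1 (fun y => f y * g y) (a * g x + f x * b).
Proof.
move=> df dg; apply: (@is_derive_eq _ _ _ _ _ _ _ _ (is_deriveM df dg)).
by rewrite /GRing.scale/= addrC (mulrC (g x)).
Qed.

Lemma is_derive_inv f x a : f x != 0 -> is_derive x 1 f a ->
  is_derive x 1 (fun y => (f y)^-1) (- a / f x ^+ 2).
Proof.
move=> fx0 df; apply: (is_derive_eq (is_deriveV fx0 df)).
by rewrite /GRing.scale/= mulrC mulrN mulNr.
Qed.

Lemma is_derive_comp f g x a b : is_derive x 1 g a -> is_derive (g x) 1 f b ->
  is_derive x 1 (fun y => f (g y)) (b * a).
Proof. by move=> dg df; exact: (@is_derive1_comp R f g x _ _ df dg). Qed.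

Lemma is_derive_continuous f x a : is_derive x 1 f a -> {for x, continuous f}.
Proof. by move=> [df _]; exact/differentiable_continuous/derivable1_diffP. Qed.

Lemma is_derive_expRM c x : is_derive x 1 (fun y => expR (c * y)) (c * expR (c * x)).
Proof.
have dl : is_derive x 1 (fun y : R => c * y) c.
  have := is_derive_mul (is_derive_cst c x 1) (is_derive_id x (1 : R)).
  by rewrite mul0r add0r mulr1.
rewrite mulrC; exact: is_derive_comp dl (is_derive_expR _).
Qed.

Lemma is_derive_expRN x : is_derive x 1 (fun y => expR (- y)) (- expR (- x)).
Proof.
have := is_derive_comp (is_derive_opp (is_derive_id x (1 : R))) (is_derive_expR _).
by rewrite mulrN1.
Qed.

End derive_rules.

(** * The Gamma and Beta integrals *)

Section gamma.
Context (R : realType).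
Notation mu := (@lebesgue_measure R).
Implicit Types (z p q x : R).

(** Put y = x / p in ln y <= y - 1. *)
Lemma powR_le_expR p x : 0 < p -> 0 < x -> x `^ p <= p `^ p * expR x.
Proof.
move=> p0 x0.
have h : ln (x / p) <= x / p - 1.
  have := expR_ge1Dx (ln (x / p)); rewrite lnK ?posrE ?divr_gt0//; lra.
rewrite /powR !gt_eqF// -expRD ler_expR.
rewrite ln_div ?posrE// in h.
have : p * (ln x - ln p) <= p * (x / p - 1) by rewrite ler_pM2l.
rewrite mulrBr mulrBr mulrCA divff ?gt_eqF// !mulr1; lra.
Qed.

Let core z x : R := z * (x `^ (z - 1) * (1 + x) `^ (- z - 1)).

(** core z is the derivative of (x / (1 + x))^z. It behaves like x^(z - 1) at 0 and is
integrable at infinity, so it dominates the Gamma integrand. *)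
Let core_integrable z : 0 < z ->
  mu.-integrable (`]0%R, +oo[ : set R) (EFin \o core z).
Proof.
move=> z0.
have ccore x : 0 < x -> {for x, continuous (core z)}.
  move=> x0; apply: cvgM; first exact: cvg_cst.
  by apply: cvgM; [exact: continuous_powR|apply: continuous_powR1D; lra].
apply: (ge0_halfline_integrable (l := 1 - 0)) => //.
- by move=> x x0; rewrite !mulr_ge0 ?powR_ge0// ltW.
apply: (ge0_halfline_FTC (F := fun x => x `^ z * (1 + x) `^ (- z))) => //.
- move=> x x0; have x1 : 0 < 1 + x by lra.
  apply: (is_derive_eq (is_derive_mul (is_derive1_powR z x0) (is_derive_powR1D (- z) x1))).
  rewrite /core !powR_mulV//; field; lra.
- by move=> x x0; rewrite !mulr_ge0 ?powR_ge0// ltW.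
- apply: (@squeeze_cvgr _ _ _ _ (cst 0) (fun x => x `^ z)); last 2 first.
  + exact: cvg_cst.
  + exact: powR_cvg0.
  near=> x; have x0 : 0 < x by near: x; exact: nbhs_right_gt.
  rewrite mulr_ge0 ?powR_ge0//= ler_piMr ?powR_ge0//.
  rewrite powRN invf_le1 ?powR_gt0//; last lra.
  have := @ge0_ler_powR R z (ltW z0) 1 (1 + x).
  by rewrite powR1; apply; rewrite ?nnegrE; lra.
- have cvg1 : (fun x : R => 1 - (1 + x)^-1) @ +oo --> (1 - 0 : R).
    apply: cvgB; first exact: cvg_cst.
    apply/(@gtr0_cvgV0 _ _ _ _ (fun x : R => 1 + x)).
      near=> x; have : -1 < x by near: x; exact: nbhs_pinfty_gt.
      by lra.
    apply/cvgryPge => A; near=> x; have : A - 1 <= x by near: x; apply: nbhs_pinfty_ge; rewrite num_real.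
    by lra.
  rewrite subr0 in cvg1.
  have cp : y `^ z @[y --> (1 : R)] --> (1 : R).
    have e : 1 `^ z = 1 :> R by rewrite powR1.
    by rewrite -[X in _ --> X]e; exact: (@continuous_powR R z 1 ltr01).
  apply: cvg_trans (cvg_comp _ _ cvg1 cp).
  apply: near_eq_cvg; near=> x => /=.
  have x0 : 0 < x by near: x; exact: nbhs_pinfty_gt.
  have x1 : 0 < 1 + x by lra.
  have -> : 1 - (1 + x)^-1 = x * (1 + x)^-1 by field; lra.
  rewrite powRM ?invr_ge0 ?ltW// -powR_inv1 ?ltW// -powRrM mulN1r.
  by [].
Unshelve. all: by end_near. Qed.

Definition gamma_fun z x : R := x `^ (z - 1) * expR (- x).

Lemma continuous_gamma_fun z x : 0 < x -> {for x, continuous (gamma_fun z)}.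
Proof.
move=> x0; apply: cvgM; first exact: continuous_powR.
exact: is_derive_continuous (is_derive_expRN x).
Qed.

Lemma gamma_fun_ge0 z x : 0 <= gamma_fun z x.
Proof. by rewrite mulr_ge0 ?powR_ge0 ?expR_ge0. Qed.

(** The factor exp(-x) beats (1 + x)^(z + 1), which compares gamma_fun z with core z. *)
Lemma gamma_fun_integrable z : 0 < z ->
  mu.-integrable (`]0%R, +oo[ : set R) (EFin \o gamma_fun z).
Proof.
move=> z0; (* from powR_le_expR with exponent z + 1 at the point 1 + x *)
pose C := (z + 1) `^ (z + 1) * expR 1 / z.
apply: (@halfline_integrable _ _ (fun x => C * core z x)).
- exact: continuous_gamma_fun.
- have := @integrableZl _ _ R mu _ (measurable_itv _) C _ (core_integrable z0).
  exact.
- move=> x x0; rewrite ger0_norm ?gamma_fun_ge0//.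
  have x1 : 0 < 1 + x by lra.
  have zp : 0 < z + 1 by lra.
  have := powR_le_expR zp x1; rewrite expRD => h.
  rewrite /gamma_fun /core.
  have -> : C * (z * (x `^ (z - 1) * (1 + x) `^ (- z - 1))) =
     x `^ (z - 1) * (((z + 1) `^ (z + 1) * (expR 1 * expR x)) * (1 + x) `^ (- (z + 1)) * expR (- x)).
    rewrite opprD /C expRN; field; rewrite expR_eq0/=; lra.
  rewrite ler_wpM2l ?powR_ge0// ler_peMl ?expR_ge0//.
  by rewrite powRN ler_pdivlMr ?powR_gt0// mul1r.
Qed.

Lemma euler_integralE z :
  euler_integral z = \int[mu]_(x in `]0%R, +oo[) gamma_fun z x.
Proof. by []. Qed.

Lemma EFin_euler z : 0 < z ->
  ((euler_integral z)%:E = \int[mu]_(x in `]0%R, +oo[) (gamma_fun z x)%:E)%E.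
Proof.
move=> z0; rewrite /euler_integral /Rintegral fineK//.
by apply: integrable_fin_num => //; exact: gamma_fun_integrable.
Qed.

Lemma Gamma_euler z : 0 < z -> Gamma z = euler_integral z.
Proof. by move=> z0; rewrite /Gamma z0 addr0 big_ord0 divr1. Qed.

End gamma.

Section euler_functional_equation.
Context (R : realType).
Notation mu := (@lebesgue_measure R).
Implicit Types (z p q x : R).

Lemma euler_integral1 : euler_integral (1 : R) = 1.
Proof.
rewrite euler_integralE.
transitivity (0 - - 1 : R); last by rewrite opprK add0r.
apply: (halfline_FTC (F := fun x => - expR (- x))).
- move=> x x0; apply: (is_derive_eq (is_derive_opp (is_derive_expRN x))).
  by rewrite /gamma_fun subrr powRr0 mul1r opprK.
- exact: continuous_gamma_fun.
- exact: gamma_fun_integrable.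
- apply: cvgN; apply: cvg_at_right_filter.
  have e : expR (- 0) = 1 :> R by rewrite oppr0 expR0.
  by rewrite -[X in _ --> X]e; exact: is_derive_continuous (is_derive_expRN (0 : R)).
- have e : - 0 = 0 :> R by rewrite oppr0.
  by rewrite -[X in _ --> X]e; apply: cvgN; exact: cvgr_expR.
Qed.

Lemma euler_integralS z : 0 < z -> euler_integral (z + 1) = z * euler_integral z.
Proof.
move=> z0; have z1 : 0 < z + 1 by lra.
apply/eqP; rewrite eq_sym -subr_eq0 !euler_integralE; apply/eqP.
have i1 := gamma_fun_integrable z0; have i2 := gamma_fun_integrable z1.
rewrite -RintegralZl// -RintegralB//; last exact: (integrableZl _ _ i1).
transitivity (0 - 0 : R); last by rewrite subrr.
apply: (halfline_FTC (F := fun x => x `^ z * expR (- x))).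
- move=> x x0.
  apply: (is_derive_eq (is_derive_mul (is_derive1_powR z x0) (is_derive_expRN x))).
  by rewrite /gamma_fun /= addrK; ring.
- move=> x x0; apply: cvgB; last exact: continuous_gamma_fun.
  by apply: cvgM; [exact: cvg_cst|exact: continuous_gamma_fun].
- exact: (integrableB _ (integrableZl _ _ i1) i2).
- apply: (@squeeze_cvgr _ _ _ _ (cst 0) (fun x => x `^ z)); last 2 first.
  + exact: cvg_cst.
  + exact: powR_cvg0.
  near=> x; have x0 : 0 < x by near: x; exact: nbhs_right_gt.
  rewrite mulr_ge0 ?powR_ge0 ?expR_ge0//= ler_piMr ?powR_ge0// expR_le1; lra.
- apply: (@squeeze_cvgr _ _ _ _ (cst 0)
      (fun x => (z + 1) `^ (z + 1) * x `^ (-1))); last 2 first.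
  + exact: cvg_cst.
  + rewrite -[X in _ --> X](mulr0 ((z + 1) `^ (z + 1))).
    by apply: cvgM; [exact: cvg_cst|apply: powR_cvgy0; lra].
  near=> x; have x0 : 0 < x by near: x; exact: nbhs_pinfty_gt.
  apply/andP; split; first by rewrite mulr_ge0 ?powR_ge0 ?expR_ge0.
  rewrite powR_inv1; last exact: ltW.
  rewrite expRN ler_pdivrMr ?expR_gt0// mulrAC ler_pdivlMr//.
  have := powR_le_expR z1 x0; rewrite powRD; last by rewrite (gt_eqF x0) implybT.
  by rewrite powRr1// ltW.
Unshelve. all: by end_near. Qed.

Let euler_integral_ge1 z : 1 <= z -> 0 < euler_integral z.
Proof.
move=> z1; have z0 : 0 < z by lra.
rewrite -lte_fin EFin_euler//.
have mE : measurable_fun (`]0%R, +oo[ : set R) (EFin \o gamma_fun z).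
  exact: measurable_int (gamma_fun_integrable z0).
apply: (@lt_le_trans _ _ (\int[mu]_(x in `[1%R, 2%R]) (gamma_fun z x)%:E)%E); last first.
  apply: ge0_subset_integral => //.
    by move=> x _; rewrite lee_fin gamma_fun_ge0.
  by move=> x /=; rewrite !in_itv/= andbT => /andP[x1 _]; lra.
apply: (@lt_le_trans _ _ (\int[mu]_(x in `[1%R, 2%R]) (expR (- 2))%:E)%E); last first.
  apply: ge0_le_integral => //.
  - apply: measurable_funS mE => // x /=; rewrite !in_itv/= andbT => /andP[x1 _]; lra.
  - move=> x /=; rewrite in_itv/= => /andP[x1 x2]; rewrite lee_fin /gamma_fun.
    have h : 1 <= x `^ (z - 1).
      have := @ge0_ler_powR R (z - 1) _ 1 x.
      by rewrite powR1 !nnegrE; apply; lra.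
    have : expR (- 2) <= expR (- x) by rewrite ler_expR; lra.
    move/le_trans; apply; rewrite ler_peMl ?expR_ge0//.
rewrite integral_cst//= lebesgue_measure_itv/= lte_fin ltr1n -EFinB -EFinM lte_fin.
by rewrite mulr_gt0 ?expR_gt0//; lra.
Qed.

Lemma euler_integral_gt0 z : 0 < z -> 0 < euler_integral z.
Proof.
move=> z0; have := @euler_integral_ge1 (z + 1).
rewrite euler_integralS// pmulr_rgt0//; apply; lra.
Qed.

Lemma is_derive_expRNM c x :
  is_derive x 1 (fun y => expR (- (c * y))) (- c * expR (- (c * x))).
Proof.
have := is_derive_expRM (- c) x; rewrite [in expR _]mulNr.
by have -> : (fun y : R => expR (- c * y)) = (fun y : R => expR (- (c * y)));
  [apply/funext => y; rewrite mulNr|].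
Qed.

Lemma gamma_scale c z : 0 < c -> 0 < z ->
  (\int[mu]_(x in `]0%R, +oo[) (x `^ (z - 1) * expR (- (c * x)))%:E =
   (euler_integral z / c `^ z)%:E)%E.
Proof.
move=> c0 z0.
rewrite EFinM EFin_euler// [in RHS](halfline_affine c0); last 2 first.
- exact: measurable_int (gamma_fun_integrable z0).
- by move=> x _; rewrite lee_fin gamma_fun_ge0.
under [X in (_ = X * _)%E]eq_integral => x xI.
  have x0 : 0 < x by move: xI; rewrite inE/= in_itv/= andbT.
  rewrite /gamma_fun -EFinM powRM ?ltW//.
  have -> : c * (c `^ (z - 1) * x `^ (z - 1) * expR (- (c * x))) =
     c `^ z * (x `^ (z - 1) * expR (- (c * x))).
    by rewrite !mulrA mulr_powRB1// ltW.
  rewrite EFinM.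
  over.
rewrite ge0_integralZl//; last 3 first.
- apply/measurable_EFinP; apply: halfline_measurable => x x0.
  by apply: cvgM; [exact: continuous_powR|exact: is_derive_continuous (is_derive_expRNM c x)].
- by move=> x _; rewrite lee_fin mulr_ge0 ?powR_ge0 ?expR_ge0.
- by rewrite lee_fin powR_ge0.
by rewrite muleAC -EFinM divff ?mul1e// gt_eqF ?powR_gt0.
Qed.

(** By Tonelli, integrate u^(p - 1) x^(p + q - 1) exp(-(1 + u) x) over u and x in both
orders; each inner integral is a scaled Gamma integral. *)
Lemma beta_integral p q : 0 < p -> 0 < q ->
  (\int[mu]_(u in `]0%R, +oo[) (u `^ (p - 1) * (1 + u) `^ (- (p + q)))%:E =
   (euler_integral p * euler_integral q / euler_integral (p + q))%:E)%E.
Proof.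
move=> p0 q0; have pq0 : 0 < p + q by lra.
(* the powers are cut off at 0, so that Tonelli applies on the whole plane *)
pose a r u : R := \1_(`]0%R, +oo[ : set R) u * u `^ (r - 1).
have ma r : measurable_fun setT (a r).
  by apply: measurable_funM => //; exact: measurable_indic.
have a0 r u : 0 <= a r u by rewrite mulr_ge0 ?powR_ge0// indicE.
pose h (v : R * R) : \bar R := (a p v.1 * a (p + q) v.2 * expR (- ((1 + v.1) * v.2)))%:E.
have mh : measurable_fun setT h.
  apply/measurable_EFinP; apply: measurable_funM.
    by apply: measurable_funM; apply: measurableT_comp.
  apply: measurableT_comp => //; apply: measurableT_comp => //.
  by apply: measurable_funM => //; apply: measurable_funD.
have h0 v : (0 <= h v)%E by rewrite lee_fin; apply: mulr_ge0; [apply: mulr_ge0; exact: a0|exact: expR_ge0].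
have mexp c : measurable_fun setT (fun y : R => expR (- (c * y))).
  apply: continuous_measurable_fun => y.
  exact: is_derive_continuous (is_derive_expRNM c y).
have aE r c : 0 < c -> 0 < r ->
    (\int[mu]_x (a r x * expR (- (c * x)))%:E = (euler_integral r / c `^ r)%:E)%E.
  move=> c0 r0; rewrite -gamma_scale// [RHS]integral_mkcond.
  apply: eq_integral => x _; rewrite patchE /a indicE.
  by case: ifPn => _; rewrite ?mul1r// !mul0r.
have in1 u : (\int[mu]_y (a p u * a (p + q) y * expR (- ((1 + u) * y)))%:E)%E =
      ((euler_integral (p + q))%:E *
       ((fun u => (u `^ (p - 1) * (1 + u) `^ (- (p + q)))%:E) \_ `]0%R, +oo[) u)%E.
    under eq_integral do rewrite -mulrA EFinM.
    rewrite ge0_integralZl//; last 3 first.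
    - apply/measurable_EFinP; apply: measurable_funM => //; [exact: ma|exact: (mexp (1 + u))].
    - by move=> x _; rewrite lee_fin mulr_ge0 ?expR_ge0.
    - by rewrite lee_fin.
    rewrite patchE /a indicE; case: ifPn => [|_]; last by rewrite mul0r mul0e mule0.
    rewrite inE/= in_itv/= andbT => u0.
    rewrite aE//; last by lra.
    by rewrite mul1r -!EFinM powRN; congr EFin; ring.
have in2 x : (\int[mu]_u (a p u * a (p + q) x * expR (- ((1 + u) * x)))%:E)%E =
      ((euler_integral p)%:E * ((EFin \o gamma_fun q) \_ `]0%R, +oo[) x)%E.
    under eq_integral => u _.
      have -> : a p u * a (p + q) x * expR (- ((1 + u) * x)) =
        a (p + q) x * expR (- x) * (a p u * expR (- (x * u))).
        by rewrite mulrDl mul1r opprD expRD (mulrC u x); ring.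
      rewrite EFinM.
      over.
    rewrite ge0_integralZl//; last 3 first.
    - apply/measurable_EFinP; apply: measurable_funM => //; [exact: ma|exact: (mexp x)].
    - by move=> u _; rewrite lee_fin mulr_ge0 ?expR_ge0.
    - by rewrite lee_fin mulr_ge0 ?expR_ge0.
    rewrite patchE /a indicE; case: ifPn => [|_]; last by rewrite !mul0r mul0e mule0.
    rewrite inE/= in_itv/= andbT => x0.
    rewrite aE// /gamma_fun mul1r -!EFinM.
    have -> : p + q - 1 = p + (q - 1) by ring.
    rewrite powRD; last by rewrite (gt_eqF x0) implybT.
    by congr EFin; field; rewrite gt_eqF ?powR_gt0.
have := @fubini_tonelli _ _ _ _ R mu mu h mh h0; rewrite /h/=.
under eq_integral do rewrite in1.
under [X in _ = X -> _]eq_integral do rewrite in2.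
rewrite ge0_integralZl//; last 3 first.
- apply/(measurable_restrictT (fun u => (u `^ (p - 1) * (1 + u) `^ (- (p + q)))%:E)) => //.
  apply/measurable_EFinP; apply: halfline_measurable => u u0.
  by apply: cvgM; [exact: continuous_powR|apply: continuous_powR1D; lra].
- by move=> u _; rewrite patchE; case: ifPn => // _; rewrite lee_fin mulr_ge0 ?powR_ge0.
- by rewrite lee_fin ltW// euler_integral_gt0.
rewrite -integral_mkcond.
rewrite ge0_integralZl//; last 3 first.
- apply/(measurable_restrictT (EFin \o gamma_fun q)) => //.
  exact: measurable_int (gamma_fun_integrable q0).
- by move=> u _; rewrite patchE; case: ifPn => // _; rewrite lee_fin gamma_fun_ge0.
- by rewrite lee_fin ltW// euler_integral_gt0.
rewrite -integral_mkcond -EFin_euler//.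
set I := (\int[mu]_(u in _) _)%E => E.
have e0 := euler_integral_gt0 pq0.
transitivity ((euler_integral (p + q))^-1%:E * ((euler_integral (p + q))%:E * I))%E.
  by rewrite muleA -EFinM mulVf ?mul1e// gt_eqF.
by rewrite E -!EFinM; congr EFin; rewrite mulrC.
Qed.

End euler_functional_equation.

(** * Moments of normal variables *)

Section normal_moments.
Context (R : realType).
Notation mu := (@lebesgue_measure R).
Variable s : R.
Hypothesis s0 : s != 0.

Let n (x : R) : R := normal_pdf 0 s x.

Let nE x : n x = normal_peak s * expR (- (x ^+ 2 / (s ^+ 2 *+ 2))).
Proof. by rewrite /n normal_pdfE// /normal_fun subr0 mulNr. Qed.

Let n_ge0 x : 0 <= n x.
Proof. exact: normal_pdf_ge0. Qed.

Let n_integrable : mu.-integrable [set: R] (EFin \o n).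
Proof. exact: integrable_normal_pdf. Qed.

Let cn : continuous n.
Proof. exact: continuous_normal_pdf. Qed.

Let ss : 0 < s ^+ 2.
Proof. by rewrite exprn_even_gt0. Qed.

Let dn (x : R) : is_derive x 1 n (- (x / s ^+ 2) * n x).
Proof.
have -> : n = (fun x => normal_peak s * expR (- (x ^+ 2 / (s ^+ 2 *+ 2)))).
  by apply/funext => y; rewrite nE.
have d2 := is_derive_mul (is_derive_mul (is_derive_id x (1 : R)) (is_derive_id x (1 : R)))
   (is_derive_cst ((s ^+ 2 *+ 2)^-1) x (1 : R)).
have := is_derive_mul (is_derive_cst (normal_peak s) x (1 : R))
  (is_derive_comp (is_derive_opp d2) (is_derive_expR _)).
move=> h; apply: is_derive_eq h _.
rewrite /cst/= -!expr2; field; exact: s0.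
Qed.

Let sqn_integrable : mu.-integrable [set: R] (EFin \o (fun x => x ^+ 2 * n x)).
Proof.
have q0 : s * Num.sqrt 2 != 0 by rewrite mulf_neq0 ?sqrtr_eq0// -ltNge.
have h := integrable_normal_pdf 0 (s * Num.sqrt 2).
(* the density of twice the variance dominates: y exp(- 2 y) <= exp(- y) *)
pose C := 4 * s ^+ 2 * (normal_peak s / normal_peak (s * Num.sqrt 2)).
have hC := integrableZl measurableT C h.
apply: le_integrable hC => //.
  apply/measurable_EFinP; apply: measurable_funM => //.
  exact: measurable_normal_pdf.
move=> x _ /=; rewrite lee_fin ger0_norm; last by apply: mulr_ge0; [exact: sqr_ge0|exact: n_ge0].
apply: le_trans (ler_norm _); rewrite nE normal_pdfE// /normal_fun subr0 mulNr.
have pk := normal_peak_gt0 q0; have pk' := normal_peak_gt0 s0.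
rewrite exprMn sqr_sqrtr//.
set y := x ^+ 2 / (4 * s ^+ 2).
have -> : x ^+ 2 / (s ^+ 2 *+ 2) = y + y by rewrite /y; field; exact: s0.
have -> : x ^+ 2 / (s ^+ 2 * 2 *+ 2) = y by rewrite /y; field; exact: s0.
have -> : x ^+ 2 = 4 * s ^+ 2 * y by rewrite /y; field; exact: s0.
have -> : C * (normal_peak (s * Num.sqrt 2) * expR (- y)) =
  4 * s ^+ 2 * (normal_peak s * expR (- y)) by rewrite /C; field; lra.
have k : y * expR (- (y + y)) <= expR (- y).
  rewrite opprD expRD mulrA ler_piMl ?expR_ge0//.
  rewrite expRN ler_pdivrMr ?expR_gt0// mul1r.
  by have := expR_ge1Dx y; lra.
have -> : 4 * s ^+ 2 * y * (normal_peak s * expR (- (y + y))) =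
  (4 * s ^+ 2 * normal_peak s) * (y * expR (- (y + y))) by ring.
have -> : 4 * s ^+ 2 * (normal_peak s * expR (- y)) =
  (4 * s ^+ 2 * normal_peak s) * expR (- y) by ring.
have cc : 0 <= 4 * s ^+ 2 * normal_peak s.
  by apply: mulr_ge0; [apply: mulr_ge0; [lra|exact: ltW]|exact: ltW].
exact: ler_wpM2l cc _ _ k.
Qed.

(** x n(x) has derivative n(x) - (x / s)^2 n(x), and it vanishes at infinity. *)
Lemma normal_second_moment : (\int[mu]_x (x ^+ 2 * n x)%:E = (s ^+ 2)%:E)%E.
Proof.
pose F x := - (s ^+ 2) * (x * n x).
pose f x := x ^+ 2 * n x - s ^+ 2 * n x.
have snI : mu.-integrable [set: R] (EFin \o (fun x => s ^+ 2 * n x)).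
  exact: integrableZl n_integrable.
have fI : mu.-integrable [set: R] (EFin \o f) by exact: (integrableB measurableT sqn_integrable snI).
have Fx (x : R) : 0 < x -> `|x * n x| <= normal_peak s * (s ^+ 2 *+ 2) / x.
  move=> x0; rewrite ger0_norm; last by apply: mulr_ge0; [exact: ltW|exact: n_ge0].
  rewrite nE ler_pdivlMr//.
  set y := x ^+ 2 / (s ^+ 2 *+ 2).
  have := normal_peak_gt0 s0.
  have -> : x * (normal_peak s * expR (- y)) * x = normal_peak s * (s ^+ 2 *+ 2) * (y / expR y).
    by rewrite expRN /y; field; rewrite expR_eq0 s0.
  move=> pk; rewrite ger_pMr; last by apply: mulr_gt0 => //; rewrite mulr2n; exact: addr_gt0.
  by rewrite ler_pdivrMr ?expR_gt0// mul1r; have := expR_ge1Dx y; lra.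
have nN x : n (- x) = n x by rewrite !nE sqrrN.
have harm : normal_peak s * (s ^+ 2 *+ 2) / k.+1%:R @[k --> \oo] --> (0 : R).
  rewrite -[X in _ --> X](mulr0 (normal_peak s * (s ^+ 2 *+ 2))).
  by apply: cvgM; [exact: cvg_cst|exact: cvg_harmonic].
have FI (eps : R) : `|eps| = 1 -> F (eps * k.+1%:R) @[k --> \oo] --> (0 : R).
  move=> e1; rewrite -[X in _ --> X](mulr0 (- (s ^+ 2))).
  apply: cvgM; first exact: cvg_cst.
  apply/norm_cvg0P; apply: (squeeze_cvgr _ (cvg_cst 0) harm).
  near=> k; rewrite normr_ge0/=.
  have -> : `|eps * k.+1%:R * n (eps * k.+1%:R)| = `|k.+1%:R * n k.+1%:R|.
    have [e|e] : eps = 1 \/ eps = -1.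
      by have [h|h] := ger0P eps; rewrite ?(ger0_norm h) ?(ltr0_norm h) in e1; [left|right]; lra.
    by rewrite e !mul1r.
    by rewrite e !mulN1r nN mulNr normrN.
  by apply: Fx; rewrite ltr0n.
have : \int[mu]_x f x = 0 - 0.
  have E : setT = \bigcup_k `[(-1) * k.+1%:R, 1 * k.+1%:R]%classic :> set R.
    apply/seteqP; split => x //= _; exists (Num.truncn `|x|) => //=.
    rewrite in_itv/= mulN1r mul1r -ler_norml ltW//; exact: truncnS_gt.
  have ab k : (-1) * k.+1%:R < 1 * k.+1%:R :> R.
    by rewrite mulN1r mul1r; have : (0 : R) < k.+1%:R by [rewrite ltr0n|]; lra.
  have nd : nondecreasing_seq (fun k => `[(-1) * k.+1%:R, 1 * k.+1%:R]%classic : set R).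
    move=> k m km; rewrite subsetEset => x /=; rewrite !in_itv/= !mulN1r !mul1r.
    have : (k.+1%:R : R) <= m.+1%:R by rewrite ler_nat.
    by move=> h /andP[h1 h2]; apply/andP; split; lra.
  apply: (@improper_FTC R _ _ setT ab nd E F f).
  - move=> x _.
    have := is_derive_mul (is_derive_cst (- (s ^+ 2)) x (1 : R))
      (is_derive_mul (is_derive_id x (1 : R)) (dn x)).
    move=> h; apply: is_derive_eq h _.
    by rewrite /f /cst/=; field; exact: s0.
  - move=> x _; apply: cvgB; apply: cvgM; try exact: cn; last exact: cvg_cst.
    exact: exprn_continuous.
  - exact: fI.
  - by apply: FI; rewrite normrN1.
  - by apply: FI; rewrite normr1.
rewrite RintegralB// subrr RintegralZl//.
have -> : \int[mu]_x n x = 1 by rewrite /Rintegral integral_normal_pdf.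
rewrite mulr1 => /eqP; rewrite subr_eq0 => /eqP <-.
by rewrite /Rintegral fineK//; apply: integrable_fin_num.
Unshelve. all: by end_near. Qed.

(** The integration formula for normal_prob goes through its Radon-Nikodym derivative,
which is the density only almost everywhere. *)
Let ae_density : ae_eq mu setT
  (Radon_Nikodym_SigmaFinite.f (normal_prob 0 s) mu) (EFin \o n).
Proof.
have dom := normal_prob_dominates 0 s.
apply: integral_ae_eq => //.
- exact: Radon_Nikodym_SigmaFinite.f_integrable.
- exact: measurable_int n_integrable.
- by move=> E _ mE; rewrite -Radon_Nikodym_SigmaFinite.f_integral.
Qed.

Lemma ge0_integral_normal (f : R -> \bar R) : measurable_fun setT f ->
  (forall x, 0 <= f x)%E ->
  (\int[normal_prob 0 s]_x f x = \int[mu]_x (f x * (n x)%:E))%E.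
Proof.
move=> mf f0; have dom := normal_prob_dominates 0 s.
rewrite -(Radon_Nikodym_SigmaFinite.change_of_variables dom)//.
apply: ae_eq_integral => //.
- apply: emeasurable_funM => //.
  exact: measurable_int (Radon_Nikodym_SigmaFinite.f_integrable dom).
- by apply: emeasurable_funM => //; exact: measurable_int n_integrable.
- by apply: ae_eqe_mul2l.
Qed.

End normal_moments.

Section normal_variable.
Context d (T : measurableType d) (R : realType) (P : probability T R).
Notation mu := (@lebesgue_measure R).
Variables (X : T -> R) (s : R).
Hypothesis mX : measurable_fun setT X.
Hypothesis s0 : s != 0.
Hypothesis lawX : forall A : set R, measurable A ->
  pushforward P X A = normal_prob 0 s A.

Let ge0_integral_law (f : R -> \bar R) : measurable_fun setT f ->
  (forall x, 0 <= f x)%E ->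
  (\int[P]_w f (X w) = \int[mu]_x (f x * (normal_pdf 0 s x)%:E))%E.
Proof.
move=> mf f0; rewrite -ge0_integral_normal//.
pose Y : T -> measurableTypeR R := X.
have mY : measurable_fun [set: T] Y by exact: mX.
have -> : (\int[P]_w f (X w) = \int[pushforward P Y]_x f x)%E.
  by rewrite (ge0_integral_pushforward mY).
pose nu : {measure set (measurableTypeR R) -> \bar R} := pushforward P Y.
by apply: (@eq_measure_integral _ _ _ _ _ (nu mY)) => A mA _; exact: lawX.
Qed.

Lemma normal_variable_sqr : (\int[P]_w (X w ^+ 2)%:E = (s ^+ 2)%:E)%E.
Proof.
rewrite (ge0_integral_law (f := fun x => (x ^+ 2)%:E)).
- by under eq_integral do rewrite -EFinM; exact: normal_second_moment.
- by apply/measurable_EFinP; exact: measurable_funX.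
- by move=> x; rewrite lee_fin sqr_ge0.
Qed.

Lemma normal_variable_Lfun : (X : T -> R) \in Lfun P 2%:E.
Proof.
rewrite inE; apply/andP; split; rewrite inE/=; first exact: mX.
rewrite /finite_norm unlock/= poweR_lty//.
under eq_integral do rewrite /= powR_mulrn// real_normK ?num_real//.
by rewrite normal_variable_sqr ltry.
Qed.

(** The density is even, so the positive and the negative part have the same integral. *)
Lemma normal_variable_mean : \int[P]_w X w = 0.
Proof.
have posneg : (\int[P]_w (maxe (X w)%:E 0) = \int[P]_w (maxe (- X w)%:E 0))%E.
  rewrite (ge0_integral_law (f := fun x => maxe x%:E 0)); last 2 first.
  - exact: measurable_maxe.
  - by move=> x; rewrite le_max lexx orbT.
  rewrite (ge0_integral_law (f := fun x => maxe (- x)%:E 0)); last 2 first.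
  - by apply: measurable_maxe => //; apply/measurable_EFinP.
  - by move=> x; rewrite le_max lexx orbT.
  rewrite (@ge0_integral_affine _ (-1) 0)//.
  - rewrite normrN1 mul1e; apply: eq_integral => x _; rewrite addr0 mulN1r.
    by rewrite !normal_pdfE// /normal_fun !subr0 sqrrN.
  - apply: emeasurable_funM; first by apply: measurable_maxe.
    by apply/measurable_EFinP; exact: measurable_normal_pdf.
  - by move=> x; rewrite mule_ge0 ?lee_fin ?normal_pdf_ge0// le_max lexx orbT.
rewrite /Rintegral integralE.
under eq_integral do rewrite funeposE.
under [X in (_ - X)%E]eq_integral do rewrite funenegE.
rewrite /= posneg subee//.
rewrite -posneg.
have iX : P.-integrable setT (EFin \o X).
  apply/Lfun1_integrable.
  apply: Lfun_subset12 normal_variable_Lfun.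
  exact: fin_num_measure.
have := integrable_pos_fin_num measurableT iX.
by under eq_integral do rewrite funeposE.
Qed.

End normal_variable.

(** * Square-integrable functions *)

Section L2.
Context d (T : measurableType d) (R : realType).
Variable mu : {measure set T -> \bar R}.
Implicit Types (f g h : T -> R) (a : R).

Definition ip f g : R := \int[mu]_x (f x * g x).

Local Notation L2 f := ((f : T -> R) \in Lfun mu 2%:E).
Local Notation N f := (fine (Lnorm mu 2%:E (EFin \o f))).

Let p2 : (1 <= 2%:E :> \bar R)%E. Proof. by rewrite lee_fin ler1n. Qed.

Lemma L2D f g : L2 f -> L2 g -> L2 (f \+ g).
Proof. by have [_ h] := Lfun_addr_closed mu p2; exact: h. Qed.

Lemma L2N f : L2 f -> L2 (\- f).
Proof. exact: Lfun_oppr_closed. Qed.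

Lemma L2B f g : L2 f -> L2 g -> L2 (f \- g).
Proof. by move=> Lf Lg; apply: L2D => //; exact: L2N. Qed.

Lemma L2Z a f : L2 f -> L2 (fun x => a * f x).
Proof.
move=> Lf; have := @Lfun_scale _ _ R mu f a 2 _ Lf.
have -> : a \o* f = (fun x => a * f x) by apply/funext => x /=; rewrite mulrC.
by apply; rewrite ler1n.
Qed.

Lemma L20 : L2 (fun=> 0).
Proof. by have [h _] := Lfun_addr_closed mu p2; exact: h. Qed.

Lemma L2_measurable f : L2 f -> measurable_fun setT f.
Proof. by rewrite inE => /andP[]; rewrite inE. Qed.

Lemma L2_fin f : L2 f -> (Lnorm mu 2%:E (EFin \o f) \is a fin_num)%E.
Proof.
by rewrite inE => /andP[_]; rewrite inE/= /finite_norm ge0_fin_numE// Lnorm_ge0.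
Qed.

Lemma L2_mul_integrable f g : L2 f -> L2 g ->
  mu.-integrable setT (EFin \o (fun x => f x * g x)).
Proof. by move=> Lf Lg; apply/Lfun1_integrable; exact: Lfun2_mul_Lfun1. Qed.

Lemma L2_sqr_integrable f : measurable_fun setT f ->
  mu.-integrable setT (EFin \o (fun x => f x ^+ 2)) -> L2 f.
Proof.
move=> mf fi; rewrite inE; apply/andP; split; rewrite inE//=.
rewrite /finite_norm unlock/= poweR_lty//.
under eq_integral do rewrite /= powR_mulrn// real_normK ?num_real//.
exact: (integrable_lty measurableT fi).
Qed.

Lemma ipC f g : ip f g = ip g f.
Proof. by apply: eq_Rintegral => x _; rewrite mulrC. Qed.

Lemma ipDl f g h : L2 f -> L2 g -> L2 h -> ip (f \+ g) h = ip f h + ip g h.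
Proof.
move=> Lf Lg Lh; rewrite /ip -RintegralD//; [|exact: L2_mul_integrable..].
by apply: eq_Rintegral => x _; rewrite -mulrDl.
Qed.

Lemma ipZl a f g : L2 f -> L2 g -> ip (fun x => a * f x) g = a * ip f g.
Proof.
move=> Lf Lg; rewrite /ip -RintegralZl//; last exact: L2_mul_integrable.
by apply: eq_Rintegral => x _; rewrite mulrA.
Qed.

Lemma ipNl f g : L2 f -> L2 g -> ip (\- f) g = - ip f g.
Proof.
move=> Lf Lg; rewrite -mulN1r -ipZl//.
by apply: eq_Rintegral => x _; rewrite mulN1r.
Qed.

Lemma ipBl f g h : L2 f -> L2 g -> L2 h -> ip (f \- g) h = ip f h - ip g h.
Proof. by move=> Lf Lg Lh; rewrite -ipNl// -ipDl//; exact: L2N. Qed.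

Lemma ipDr f g h : L2 f -> L2 g -> L2 h -> ip h (f \+ g) = ip h f + ip h g.
Proof. by move=> *; rewrite ipC ipDl// !(ipC h). Qed.

Lemma ipZr a f g : L2 f -> L2 g -> ip f (fun x => a * g x) = a * ip f g.
Proof. by move=> *; rewrite ipC ipZl// ipC. Qed.

Lemma ipBr f g h : L2 f -> L2 g -> L2 h -> ip h (f \- g) = ip h f - ip h g.
Proof. by move=> *; rewrite ipC ipBl// !(ipC h). Qed.

(** For three consecutive sides f, g, -h of a broken line, the scalar product of the first
and the last is determined by squared distances. Applied to Brownian
increments, it reduces every covariance to variances. *)
Lemma ip_four_point f g h : L2 f -> L2 g -> L2 h ->
  ip f h = (ip (f \+ g) (f \+ g) + ip (g \- h) (g \- h)
    - ip (f \+ (g \- h)) (f \+ (g \- h)) - ip g g) / 2.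
Proof.
move=> Lf Lg Lh; have Lgh := L2B Lg Lh.
rewrite (ipDl Lf Lg (L2D Lf Lg)) (ipDr Lf Lg Lf) (ipDr Lf Lg Lg).
rewrite (ipDl Lf Lgh (L2D Lf Lgh)) (ipDr Lf Lgh Lf) (ipDr Lf Lgh Lgh).
rewrite (ipC (g \- h) f) (ipBr Lg Lh Lf) (ipC g f).
by field.
Qed.

Lemma cauchy_schwarz f g : L2 f -> L2 g -> `|ip f g| <= N f * N g.
Proof.
move=> Lf Lg; have fgi := L2_mul_integrable Lf Lg.
apply: le_trans (le_normr_Rintegral _ _) _ => //.
have ni : (\int[mu]_t (`|f t * g t|)%:E \is a fin_num)%E.
  by apply: integrable_fin_num => //; exact: (integrable_norm fgi).
rewrite -lee_fin EFinM (fineK (L2_fin Lf)) (fineK (L2_fin Lg)) /Rintegral (fineK ni).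
have := @hoelder _ _ R mu f g 2 2 (L2_measurable Lf) (L2_measurable Lg).
rewrite Lnorm1/=; apply => //.
by rewrite -div1r -splitr.
Qed.

Lemma ip_cvg (u v : nat -> T -> R) f g :
  (forall n, L2 (u n)) -> (forall n, L2 (v n)) -> L2 f -> L2 g ->
  L2_cvg mu u f -> L2_cvg mu v g -> ip (u n) (v n) @[n --> \oo] --> ip f g.
Proof.
move=> Lu Lv Lf Lg uf vg.
have Nu : N (u n \- f) @[n --> \oo] --> 0 by apply: fine_cvg; exact: uf.
have Nv : N (v n \- g) @[n --> \oo] --> 0 by apply: fine_cvg; exact: vg.
have E n : ip (u n) (v n) = ip (u n \- f) (v n \- g) + ip (u n \- f) g +
    ip f (v n \- g) + ip f g.
  by rewrite !ipBl ?ipBr ?L2B//; ring.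
rewrite (_ : (fun n => ip (u n) (v n)) = (fun n => ip (u n \- f) (v n \- g) +
    ip (u n \- f) g + ip f (v n \- g) + ip f g)); last exact/funext.
rewrite -[X in _ --> X](add0r (ip f g)); apply: cvgD; last exact: cvg_cst.
have bound (w : nat -> R) (b : nat -> R) :
    (forall n, `|w n| <= b n) -> b @ \oo --> 0 -> w @ \oo --> 0.
  move=> wb b0; apply/norm_cvg0P; apply: (squeeze_cvgr _ (cvg_cst 0) b0).
  by apply: nearW => n; rewrite normr_ge0/= wb.
rewrite -[X in _ --> X](add0r (0 : R)); apply: cvgD;
  [rewrite -[X in _ --> X](add0r (0 : R)); apply: cvgD|].
- apply: (bound _ (fun n => N (u n \- f) * N (v n \- g))).
    by move=> n; apply: cauchy_schwarz; exact: L2B.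
  by rewrite -[X in _ --> X](mulr0 (0 : R)); exact: cvgM.
- apply: (bound _ (fun n => N (u n \- f) * N g)).
    by move=> n; apply: cauchy_schwarz => //; exact: L2B.
  by rewrite -[X in _ --> X](mul0r (N g)); apply: cvgM => //; exact: cvg_cst.
- apply: (bound _ (fun n => N f * N (v n \- g))).
    by move=> n; apply: cauchy_schwarz => //; exact: L2B.
  by rewrite -[X in _ --> X](mulr0 (N f)); apply: cvgM => //; exact: cvg_cst.
Qed.

Lemma L2_cvg_L2 (u : nat -> T -> R) f :
  (forall n, L2 (u n)) -> measurable_fun setT f -> L2_cvg mu u f -> L2 f.
Proof.
move=> Lu mf uf.
have [n fin] : exists n, (Lnorm mu 2%:E (EFin \o (u n \- f)%R) < +oo)%E.
  have : \forall n \near \oo, (Lnorm mu 2%:E (EFin \o (u n \- f)%R) < +oo)%E.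
    have /fine_cvgP[+ _] := uf.
    by apply: filterS => n fn; rewrite ltey_eq fn.
  by move=> [n _ h]; exists n; apply: h => /=.
have Luf : L2 (u n \- f).
  rewrite inE; apply/andP; split; rewrite inE//=.
  by apply: measurable_funB => //; exact: L2_measurable.
have -> : f = u n \- (u n \- f) by apply/funext => x /=; ring.
exact: L2B.
Qed.

Lemma ae_eq_ip f g f' g' : measurable_fun setT f -> measurable_fun setT g ->
  measurable_fun setT f' -> measurable_fun setT g' ->
  {ae mu, forall x, f x = f' x} -> {ae mu, forall x, g x = g' x} ->
  ip f g = ip f' g'.
Proof.
move=> mf mg mf' mg' ff' gg'; rewrite /ip /Rintegral; congr fine.
apply: ae_eq_integral => //.
- by apply/measurable_EFinP; exact: measurable_funM.
- by apply/measurable_EFinP; exact: measurable_funM.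
by move: ff' gg'; apply: filterS2 => x -> -> _.
Qed.

End L2.

(** * Wiener integrals *)

Section independence.
Context d (T : measurableType d) (R : realType) (P : probability T R).
Variables (X Y : {mfun T >-> R}).
Hypothesis LX : (X : T -> R) \in Lfun P 2%:E.
Hypothesis LY : (Y : T -> R) \in Lfun P 2%:E.
Hypothesis indXY : forall A C : set R, measurable A -> measurable C ->
  P ((X @^-1` A) `&` (Y @^-1` C)) = (P (X @^-1` A) * P (Y @^-1` C))%E.

(** Independence says that the law of (X, Y) is a product measure; then use Fubini. *)
Lemma independent_ip0 : \int[P]_w Y w = 0 -> ip P X Y = 0.
Proof.
move=> Y0.
have L1 Z : Z \in Lfun P 2%:E -> P.-integrable setT (EFin \o Z).
  move=> LZ; apply/Lfun1_integrable; apply: Lfun_subset12 LZ.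
  exact: fin_num_measure.
pose V w : R * R := (X w, Y w).
have mV : measurable_fun setT V by apply/measurable_fun_pairP; split; exact: measurable_funPT.
pose nu : {measure set (R * R) -> \bar R} := pushforward P V.
have nuE A : measurable A -> nu mV A = (distribution P X \x distribution P Y)%E A.
  move=> mA; apply/esym.
  apply: (@product_measure_unique _ _ _ _ _ (distribution P X) (distribution P Y)
    (nu mV) _ A mA) => B C mB mC.
  exact: (indXY mB mC).
have mxy : measurable_fun setT (fun v : R * R => (v.1 * v.2)%:E).
  by apply/measurable_EFinP; apply: measurable_funM.
have fi : P.-integrable setT ((fun v : R * R => (v.1 * v.2)%:E) \o V).
  exact: (L2_mul_integrable LX LY).
rewrite /ip /Rintegral.
have -> : (\int[P]_x (X x * Y x)%:E = \int[nu mV]_v (v.1 * v.2)%:E)%E.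
  by rewrite integral_pushforward.
have fi' : (nu mV).-integrable setT (fun v : R * R => (v.1 * v.2)%:E).
  exact: integrable_pushforward.
have -> : (\int[nu mV]_v (v.1 * v.2)%:E =
    \int[distribution P X \x distribution P Y]_v (v.1 * v.2)%:E)%E.
  by apply: eq_measure_integral => A mA _; exact: nuE.
have fi2 : (distribution P X \x distribution P Y)%E.-integrable setT
   (fun v : R * R => (v.1 * v.2)%:E).
  apply/integrableP; split => //.
  move/integrableP : fi' => [_]; congr (_ < _)%E.
  by apply: eq_measure_integral => A mA _; exact: nuE.
rewrite -integral12_prod_meas1// /fubini_F/=.
have iY : (distribution P Y).-integrable setT (EFin : R -> \bar R).
  by apply: integrable_pushforward => //; exact: L1.
have inner x : (\int[distribution P Y]_y (x * y)%:E = 0)%E.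
  under eq_integral do rewrite EFinM.
  rewrite integralZl//.
  have -> : (\int[distribution P Y]_y y%:E = \int[P]_w (Y w)%:E)%E.
    by rewrite integral_distribution//; exact: L1.
  have : (\int[P]_w (Y w)%:E \is a fin_num)%E by apply: integrable_fin_num => //; exact: L1.
  by move=> h; rewrite -(fineK h) -[fine _]/(\int[P]_w Y w) Y0 mule0.
by under eq_integral do rewrite inner; rewrite integral0.
Qed.

End independence.

Section brownian.
Context d (T : measurableType d) (R : realType) (P : probability T R).
Variable B : R -> {RV P >-> R}.
Hypothesis hB : standard_brownian_motion B.
Notation mu := (@lebesgue_measure R).

Let lt_incr x y : y < x -> [/\ (B x \- B y : T -> R) \in Lfun P 2%:E,
  ip P (B x \- B y) (B x \- B y) = x - y & \int[P]_w (B x \- B y) w = 0].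
Proof.
move=> yx; have [_ _ law _] := hB.
have mI : measurable_fun setT (B x \- B y : T -> R) by exact: measurable_funB.
have s0 : Num.sqrt (x - y) != 0 by rewrite sqrtr_eq0 -ltNge subr_gt0.
split.
- exact: (normal_variable_Lfun mI s0 (law _ _ yx)).
- rewrite /ip /Rintegral; under eq_integral do rewrite -expr2.
  rewrite (normal_variable_sqr mI s0 (law _ _ yx)) /= sqr_sqrtr// subr_ge0; exact: ltW.
- exact: (normal_variable_mean mI s0 (law _ _ yx)).
Qed.

Lemma brownian_incr x y : [/\ (B x \- B y : T -> R) \in Lfun P 2%:E,
  ip P (B x \- B y) (B x \- B y) = `|x - y| & \int[P]_w (B x \- B y) w = 0].
Proof.
have [xy|yx|->] := ltgtP x y.
- have [L2I ipI mI] := lt_incr xy.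
  have e : (B x \- B y : T -> R) = \- (B y \- B x) by apply/funext => w /=; ring.
  rewrite e; split; first exact: L2N.
  + rewrite ipNl// 1?ipC 1?ipNl ?opprK// ?ipI; [|exact: L2N].
    by rewrite ltr0_norm ?opprB// subr_lt0.
  + rewrite -[RHS]oppr0 -mI -mulN1r -RintegralZl//.
      by apply: eq_Rintegral => w _ /=; rewrite mulN1r.
    apply/Lfun1_integrable; apply: Lfun_subset12 L2I; exact: fin_num_measure.
- have [L2I ipI mI] := lt_incr yx.
  by split => //; rewrite ipI gtr0_norm// subr_gt0.
- have -> : (B y \- B y : T -> R) = (fun=> 0) by apply/funext => w /=; rewrite subrr.
  split; first exact: L20.
  + by rewrite subrr normr0 /ip; under eq_Rintegral do rewrite mul0r; rewrite Rintegral_cst ?mul0r.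
  + by rewrite Rintegral_cst ?mul0r.
Qed.

Lemma brownian_incr_L2 x y : (B x \- B y : T -> R) \in Lfun P 2%:E.
Proof. by have [] := brownian_incr x y. Qed.

(** The right-hand side is the length of the overlap of the two intervals when they are
positively oriented, see ip_indic_itv. *)
Lemma ip_brownian_incr a b c d' :
  ip P (B b \- B a) (B d' \- B c) =
  (`|b - c| + `|a - d'| - `|b - d'| - `|a - c|) / 2.
Proof.
have sq x y : ip P (B x \- B y) (B x \- B y) = `|x - y| by have [] := brownian_incr x y.
have L := brownian_incr_L2.
rewrite -!sq.
have e1 : (B b \- B c : T -> R) = (B b \- B a) \+ (B a \- B c) by apply/funext => w /=; ring.
have e2 : (B a \- B d' : T -> R) = (B a \- B c) \- (B d' \- B c) by apply/funext => w /=; ring.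
have e3 : (B b \- B d' : T -> R) = (B b \- B a) \+ ((B a \- B c) \- (B d' \- B c)).
  by apply/funext => w /=; ring.
by rewrite e1 e2 e3 -ip_four_point.
Qed.

Lemma indic_itv_L2 (a b : R) : (\1_(`]a, b]%classic : set R) : R -> R) \in Lfun mu 2%:E.
Proof.
apply: L2_sqr_integrable; first exact: measurable_indic.
have -> : (fun x : R => (\1_(`]a, b]%classic : set R) x : R) ^+ 2) = \1_(`]a, b]%classic : set R).
  by apply/funext => x; rewrite indicE; case: (_ \in _); rewrite ?expr1n ?expr0n.
exact: integrable_indic_itv.
Qed.

Lemma ip_indic_itv (a b c d' : R) : a <= b -> c <= d' ->
  ip mu (\1_(`]a, b]%classic : set R)) (\1_(`]c, d']%classic : set R)) =
  (`|b - c| + `|a - d'| - `|b - d'| - `|a - c|) / 2.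
Proof.
move=> ab cd; rewrite /ip.
have -> : (fun x : R => (\1_(`]a, b]%classic : set R) x : R) * \1_(`]c, d']%classic : set R) x) =
    \1_(`](Num.max a c), (Num.min b d')]%classic : set R).
  apply/funext => x; rewrite !indicE.
  have mem (p q : R) : (x \in (`]p, q]%classic : set R)) = (p < x <= q).
    by apply/idP/idP; rewrite inE/= in_itv.
  by rewrite !mem gt_max le_min -natrM mulnb andbACA.
rewrite /Rintegral integral_indic// setIT/= lebesgue_measure_itv/= lte_fin.
have [h|h] := ltP (Num.max a c) (Num.min b d').
  rewrite -EFinB/=; move: h; rewrite gt_max !lt_min => /andP[/andP[h1 h2] /andP[h3 h4]].
  rewrite (@ger0_norm _ (b - c)) ?subr_ge0 ?ltW// (@ler0_norm _ (a - d')) ?subr_le0 ?ltW//.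
  have [h5|h5] := leP a c; have [h6|h6] := leP b d'.
  - by rewrite (@ler0_norm _ (b - d')) ?subr_le0// (@ler0_norm _ (a - c)) ?subr_le0//; field.
  - by rewrite (@gtr0_norm _ (b - d')) ?subr_gt0// (@ler0_norm _ (a - c)) ?subr_le0//; field.
  - by rewrite (@ler0_norm _ (b - d')) ?subr_le0// (@gtr0_norm _ (a - c)) ?subr_gt0//; field.
  - by rewrite (@gtr0_norm _ (b - d')) ?subr_gt0// (@gtr0_norm _ (a - c)) ?subr_gt0//; field.
move: h; rewrite le_max !ge_min => h /=.
move: h => /orP[/orP[ba|da]|/orP[bc|dc]].
- by have -> : a = b by [lra|]; ring.
- rewrite (@ger0_norm _ (b - c)) ?subr_ge0//; last lra.
  rewrite (@ger0_norm _ (a - d')) ?subr_ge0//.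
  rewrite (@ger0_norm _ (b - d')) ?subr_ge0//; last lra.
  rewrite (@ger0_norm _ (a - c)) ?subr_ge0//; lra.
- rewrite (@ler0_norm _ (b - c)) ?subr_le0// (@ler0_norm _ (a - d')) ?subr_le0//; last lra.
  rewrite (@ler0_norm _ (b - d')) ?subr_le0//; last lra.
  rewrite (@ler0_norm _ (a - c)) ?subr_le0//; lra.
- by have -> : c = d' by [lra|]; ring.
Qed.

Lemma step_fun_L2 (s : seq (R * R * R)) : (step_fun s : R -> R) \in Lfun mu 2%:E.
Proof.
elim: s => [|p s ih].
  have -> : step_fun [::] = (fun=> 0 : R) by apply/funext => x; rewrite /step_fun big_nil.
  exact: L20.
have -> : step_fun (p :: s) =
   (fun x => p.2 * \1_(`]p.1.1, p.1.2]%classic : set R) x) \+ step_fun s.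
  by apply/funext => x; rewrite /step_fun big_cons.
by apply: L2D => //; apply: L2Z; exact: indic_itv_L2.
Qed.

Lemma step_integral_L2 (s : seq (R * R * R)) : (step_integral B s : T -> R) \in Lfun P 2%:E.
Proof.
elim: s => [|p s ih].
  have -> : step_integral B [::] = (fun=> 0 : R).
    by apply/funext => x; rewrite /step_integral big_nil.
  exact: L20.
have -> : step_integral B (p :: s) =
   (fun w => p.2 * (B p.1.2 \- B p.1.1) w) \+ step_integral B s.
  by apply/funext => x; rewrite /step_integral big_cons.
by apply: L2D => //; apply: L2Z; exact: brownian_incr_L2.
Qed.

Lemma step_isometry (s s' : seq (R * R * R)) : step_code s -> step_code s' ->
  ip P (step_integral B s) (step_integral B s') = ip mu (step_fun s) (step_fun s').
Proof.
have fcons p (r : seq (R * R * R)) : step_fun (p :: r) =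
   (fun x => p.2 * \1_(`]p.1.1, p.1.2]%classic : set R) x) \+ step_fun r.
  by apply/funext => x; rewrite /step_fun big_cons.
have icons p (r : seq (R * R * R)) : step_integral B (p :: r) =
   (fun w => p.2 * (B p.1.2 \- B p.1.1) w) \+ step_integral B r.
  by apply/funext => x; rewrite /step_integral big_cons.
have fnil : step_fun [::] = (fun=> 0 : R) by apply/funext => x; rewrite /step_fun big_nil.
have inil : step_integral B [::] = (fun=> 0 : R).
  by apply/funext => x; rewrite /step_integral big_nil.
have ip0 d1 (T1 : measurableType d1) (m : {measure set T1 -> \bar R}) f : ip m (fun=> 0) f = 0.
  by rewrite /ip; under eq_Rintegral do rewrite mul0r; rewrite /Rintegral integral0.
have L1 := indic_itv_L2; have L2' := brownian_incr_L2.
have L3 := step_fun_L2; have L4 := step_integral_L2.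
elim: s => [|p s ih] /=; first by rewrite fnil inil !ip0.
move=> /andP[p1 cs] cs'.
rewrite fcons icons !ipDl// ?ipZl ?L2Z//; congr (_ * _ + _); last exact: ih.
clear ih; elim: s' cs' => [|q s' ih'] /=; first by rewrite fnil inil ipC ip0 ipC ip0.
move=> /andP[q1 cs']; rewrite fcons icons !ipDr// ?ipZr ?L2Z//.
congr (_ * _ + _); last exact: ih'.
by rewrite ip_brownian_incr ip_indic_itv.
Qed.

(** The isometry holds for step functions, where it compares ip_brownian_incr with
ip_indic_itv, and both sides are continuous in L^2. *)
Lemma wiener_isometry f g (X Y : {RV P >-> R}) :
  is_wiener_integral B f X -> is_wiener_integral B g Y ->
  [/\ (X : T -> R) \in Lfun P 2%:E, (Y : T -> R) \in Lfun P 2%:E & ip P X Y = ip mu f g].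
Proof.
move=> [Lf [s [cs sf sX]]] [Lg [s' [cs' sg sY]]].
have LX : (X : T -> R) \in Lfun P 2%:E.
  by apply: L2_cvg_L2 sX => // n; exact: step_integral_L2.
have LY : (Y : T -> R) \in Lfun P 2%:E.
  by apply: L2_cvg_L2 sY => // n; exact: step_integral_L2.
split => //.
have h1 := ip_cvg (fun n => step_integral_L2 (s n)) (fun n => step_integral_L2 (s' n)) LX LY sX sY.
have h2 := ip_cvg (fun n => step_fun_L2 (s n)) (fun n => step_fun_L2 (s' n)) Lf Lg sf sg.
have e : (fun n => ip P (step_integral B (s n)) (step_integral B (s' n))) =
   (fun n => ip mu (step_fun (s n)) (step_fun (s' n))).
  by apply/funext => n; exact: step_isometry.
rewrite e in h1.
exact: (cvg_unique (@Rhausdorff R) h1 h2).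
Qed.

End brownian.

Section cross.
Context d (T : measurableType d) (R : realType) (P : probability T R).
Variables B W : R -> {RV P >-> R}.
Hypothesis hB : standard_brownian_motion B.
Hypothesis hW : standard_brownian_motion W.
Hypothesis hBW : independent_processes P B W.

(** The increments of a process are measurable for the sigma-algebra it generates,
which is where independence of the processes is available. *)
Let sigma_incr (Y : R -> {RV P >-> R}) a b (A : set R) : measurable A ->
  process_sigma_algebra Y ((Y b \- Y a : T -> R) @^-1` A).
Proof.
move=> mA; pose G := \bigcup_t preimage_set_system setT (Y t : T -> R) measurable.
have mY t : @measurable_fun _ _ (g_sigma_algebraType G) R setT (Y t).
  move=> _ C mC; apply: sub_sigma_algebra; exists t => //.
  by exists C.
have := @measurable_funB _ (g_sigma_algebraType G) R setT _ _ (mY b) (mY a).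
by move=> /(_ measurableT _ mA); rewrite setTI.
Qed.

Lemma ip_cross_incr a b c d' : ip P (B b \- B a) (W d' \- W c) = 0.
Proof.
pose X : {mfun T >-> R} := (B b - B a)%R.
pose Y : {mfun T >-> R} := (W d' - W c)%R.
apply: (@independent_ip0 _ _ _ P X Y).
- exact: (brownian_incr_L2 hB).
- exact: (brownian_incr_L2 hW).
- by move=> A C mA mC; apply: hBW; exact: sigma_incr.
- by have [] := brownian_incr hW d' c.
Qed.

Lemma wiener_cross f g (X Y : {RV P >-> R}) :
  is_wiener_integral B f X -> is_wiener_integral W g Y -> ip P X Y = 0.
Proof.
move=> wX wY.
have [LX _ _] := wiener_isometry hB wX wX; have [LY _ _] := wiener_isometry hW wY wY.
move: wX wY => [Lf [s [cs sf sX]]] [Lg [s' [cs' sg sY]]].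
have L1 := step_integral_L2 hB; have L2' := step_integral_L2 hW.
have h1 := ip_cvg (fun n => L1 (s n)) (fun n => L2' (s' n)) LX LY sX sY.
have ip0 f0 : ip P (fun=> 0) f0 = 0.
  by rewrite /ip; under eq_Rintegral do rewrite mul0r; rewrite /Rintegral integral0.
have icons (Z : R -> {RV P >-> R}) p (r : seq (R * R * R)) : step_integral Z (p :: r) =
   (fun w => p.2 * (Z p.1.2 \- Z p.1.1) w) \+ step_integral Z r.
  by apply/funext => x; rewrite /step_integral big_cons.
have inil (Z : R -> {RV P >-> R}) : step_integral Z [::] = (fun=> 0 : R).
  by apply/funext => x; rewrite /step_integral big_nil.
have LB := brownian_incr_L2 hB; have LW := brownian_incr_L2 hW.
have z (r r' : seq (R * R * R)) : ip P (step_integral B r) (step_integral W r') = 0.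
  elim: r => [|p r ih]; first by rewrite inil ip0.
  rewrite icons ipDl// ?ipZl ?L2Z// ih addr0.
  elim: r' {ih} => [|q r' ih']; first by rewrite inil ipC ip0 mulr0.
  by rewrite icons ipDr// ?ipZr ?L2Z// ip_cross_incr mulr0 add0r.
rewrite (_ : (fun n => _) = (fun=> 0)) in h1; last by apply/funext => n; rewrite z.
by apply: (cvg_unique (@Rhausdorff R) h1); exact: cvg_cst.
Qed.

End cross.

Section inner_product_bound.
Context d (T : measurableType d) (R : realType).
Variable mu : {measure set T -> \bar R}.

Lemma ipBB (f f' g g' : T -> R) :
  f \in Lfun mu 2%:E -> f' \in Lfun mu 2%:E ->
  g \in Lfun mu 2%:E -> g' \in Lfun mu 2%:E ->
  ip mu (f \- f') (g \- g') = ip mu f g - ip mu f g' - ip mu f' g + ip mu f' g'.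
Proof.
move=> Lf Lf' Lg Lg'; rewrite (ipBl Lf Lf' (L2B Lg Lg')) !(ipBr Lg Lg')//.
by rewrite opprB addrA addrAC.
Qed.

(** Form of the Cauchy-Schwarz inequality in terms of scalar products only: the
quadratic polynomial l |-> ip (f - l g) (f - l g) is nonnegative. *)
Lemma ip_sqr_le (f g : T -> R) : f \in Lfun mu 2%:E -> g \in Lfun mu 2%:E ->
  ip mu f g ^+ 2 <= ip mu f f * ip mu g g.
Proof.
move=> Lf Lg.
have pos (h : T -> R) : 0 <= ip mu h h.
  by apply: Rintegral_ge0 => x _; rewrite -expr2 sqr_ge0.
have quad (l : R) : 0 <= ip mu f f - 2 * l * ip mu f g + l ^+ 2 * ip mu g g.
  have Llg := L2Z l Lg.
  have := pos (f \- (fun x => l * g x)).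
  rewrite ipBl ?L2B// !ipBr// !ipZl// !ipZr// (ipC mu g f) => h.
  apply: le_trans h _; rewrite le_eqVlt; apply/orP; left; apply/eqP.
  move: (ip mu f f) (ip mu f g) (ip mu g g) => A B C; ring.
have := pos g; move: quad (pos f).
move: (ip mu f f) (ip mu f g) (ip mu g g) => A B C quad A0.
rewrite le_eqVlt => /predU1P[C0|C0].
  have [->|B0] := eqVneq B 0; first by rewrite expr0n/= -C0 mulr0.
  have := quad ((A + 1) / (2 * B)); rewrite -C0 mulr0 addr0.
  have -> : 2 * ((A + 1) / (2 * B)) * B = A + 1 by field.
  lra.
have := quad (B / C).
have -> : A - 2 * (B / C) * B + (B / C) ^+ 2 * C = A - B ^+ 2 / C by field; rewrite gt_eqF.
by rewrite subr_ge0 ler_pdivrMr.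
Qed.

End inner_product_bound.

(** * The cotangent function *)

Section trig.
Context (R : realType).
Implicit Types x z w : R.

Lemma sin_le x : 0 <= x -> sin x <= x.
Proof.
rewrite le_eqVlt => /predU1P[<-|x0]; first by rewrite sin0.
have [c _] := @MVT R (fun y => sin y) cos 0 x x0 (fun y _ => is_derive_sin y)
  (continuous_subspaceT (@continuous_sin R)).
rewrite sin0 !subr0 => ->.
by rewrite ler_piMl ?cos_le1// ltW.
Qed.

Lemma one_sub_cos_le x : 0 <= x -> 1 - cos x <= x ^+ 2 / 2.
Proof.
move=> x0.
have e : x = (x / 2) *+ 2 by rewrite mulr2n; lra.
have -> : cos x = 1 - 2 * sin (x / 2) ^+ 2.
  by rewrite {1}e cos_mulr2n cos2sin2 mulr2n; ring.
have : sin (x / 2) ^+ 2 <= (x / 2) ^+ 2.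
  rewrite -(real_normK (num_real (sin _))) ler_sqr ?nnegrE//; last lra.
  have [h|h] := ger0P (sin (x / 2)); first by apply: sin_le; lra.
  have [h2|h2] := lerP (x / 2) 1.
    have : 0 <= sin (x / 2); last by lra.
    have [->|h3] := eqVneq x 0; first by rewrite mul0r sin0.
    apply/ltW/sin2_gt0; lra.
  by apply: (@le_trans _ _ 1); [have := sin_geN1 (x / 2); lra|exact: ltW].
rewrite expr_div_n; lra.
Qed.

Lemma sub_sin_le x : 0 <= x -> x - sin x <= x ^+ 3.
Proof.
rewrite le_eqVlt => /predU1P[<-|x0]; first by rewrite sin0 subrr expr0n.
have d (y : R) : is_derive y 1 (fun y : R => y - sin y) (1 - cos y).
  exact: (is_derive_add (is_derive_id y 1) (is_derive_opp (is_derive_sin y))).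
have [c] := @MVT R (fun y => y - sin y) (fun y => 1 - cos y) 0 x x0 (fun y _ => d y)
  (continuous_subspaceT (fun y => is_derive_continuous (d y))).
rewrite in_itv/= => /andP[c0 cx]; rewrite sin0 !subr0 => ->.
have h := one_sub_cos_le (ltW c0).
have : c ^+ 2 <= x ^+ 2 by rewrite ler_sqr ?nnegrE ltW.
move=> h2; rewrite exprSr; apply: ler_wpM2r; first exact: ltW.
by have := sqr_ge0 x; lra.
Qed.

Lemma pi_half_le2 : pi / 2 <= 2 :> R.
Proof. by have [/andP[_]] := @pihalf_02_cos_pihalf R. Qed.

(** The slope 3 / 16 is crude: on [0, 1/2] the Taylor bound gives slope 3/4, and beyond 1/2
monotonicity gives sin x >= 3/8 while x <= 2. *)
Lemma sin_ge x : 0 <= x <= pi / 2 -> 3 / 16 * x <= sin x.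
Proof.
move=> /andP[x0 x2]; have p2 := pi_half_le2.
have lower (y : R) : 0 <= y <= 1 / 2 -> 3 / 4 * y <= sin y.
  move=> /andP[y0 y1]; have := sub_sin_le y0.
  have : y ^+ 3 <= 1 / 4 * y.
    by rewrite exprSr; apply: ler_wpM2r => //; nra.
  lra.
have [h|h] := lerP x (1 / 2); first by have := lower x; lra.
apply: (@le_trans _ _ (3 / 8)); first lra.
have h1 := lower (1 / 2).
apply: (@le_trans _ _ (sin (1 / 2))); first by lra.
have /= := @ltr_sin R (1 / 2) x.
rewrite !in_itv/= => hs; apply/ltW; rewrite hs//; apply/andP; split; lra.
Qed.

(** The numerator x^2 - sin^2 x is at most 2 x^4 and the denominator is at least
(3 / 16)^2 x^4, and 2 (16 / 3)^2 < 57. *)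
Lemma inv_sqr_sin_bound x : 0 < x <= pi / 2 ->
  `|(sin x ^+ 2)^-1 - (x ^+ 2)^-1| <= 57.
Proof.
move=> /andP[x0 x2].
have h1 := sub_sin_le (ltW x0); have h2 := sin_le (ltW x0).
have h3 : 3 / 16 * x <= sin x by apply: sin_ge; rewrite ltW.
have s0 : 0 < sin x by lra.
have -> : (sin x ^+ 2)^-1 - (x ^+ 2)^-1 =
  (x - sin x) * (x + sin x) / (x ^+ 2 * sin x ^+ 2) by field; lra.
rewrite ger0_norm; last first.
  by rewrite divr_ge0// ?mulr_ge0 ?sqr_ge0//; lra.
rewrite ler_pdivrMr; last by rewrite mulr_gt0// exprn_gt0.
apply: (@le_trans _ _ (x ^+ 3 * (2 * x))).
  by apply: ler_pM => //; lra.
have h4 : (3 / 16 * x) ^+ 2 <= sin x ^+ 2 by rewrite ler_sqr ?nnegrE; lra.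
apply: (@le_trans _ _ (57 * (x ^+ 2 * (3 / 16 * x) ^+ 2))); last first.
  by rewrite ler_wpM2l// ler_wpM2l// sqr_ge0.
have -> : 57 * (x ^+ 2 * (3 / 16 * x) ^+ 2) = (57 * (9 / 256)) * x ^+ 4 by field.
have -> : x ^+ 3 * (2 * x) = 2 * x ^+ 4 by ring.
apply: ler_wpM2r; [by rewrite exprn_ge0// ltW|lra].
Qed.

Definition cot_pi z := pi * cos (pi * z) / sin (pi * z).

(** pi cot(pi z) without its poles at 0 and 1. *)
Definition cot_reg z := cot_pi z - z^-1 + (1 - z)^-1.

Lemma sin_pi_gt0 z : 0 < z < 1 -> 0 < sin (pi * z).
Proof.
move=> /andP[z0 z1]; apply: sin_gt0_pi; have := pi_gt0 R.
by move=> p0; rewrite mulr_gt0//= gtr_pMr.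
Qed.

Let dcot_reg z : 0 < z < 1 ->
  is_derive z 1 cot_reg (- pi ^+ 2 / sin (pi * z) ^+ 2 + (z ^+ 2)^-1 + ((1 - z) ^+ 2)^-1).
Proof.
move=> z01; have s0 := sin_pi_gt0 z01; move/andP: z01 => [z0 z1].
have dl : is_derive z 1 (fun y : R => pi * y) pi.
  have := is_derive_mul (is_derive_cst pi z 1) (is_derive_id z (1 : R)).
  by rewrite mul0r add0r mulr1.
have dc := is_derive_mul (is_derive_cst pi z 1) (is_derive_comp dl (is_derive_cos (pi * z))).
have ds := is_derive_comp dl (is_derive_sin (pi * z)).
have dis := is_derive_inv (lt0r_neq0 s0) ds.
have d1 := is_derive_inv (lt0r_neq0 z0) (is_derive_id z (1 : R)).
have d2 : is_derive z 1 (fun y : R => 1 - y) (- 1).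
  have := is_derive_add (is_derive_cst (1 : R) z (1 : R)) (is_derive_opp (is_derive_id z (1 : R))).
  by rewrite add0r.
have z1' : 1 - z != 0 by lra.
have d3 := @is_derive_inv R (fun y => 1 - y) z _ z1' d2.
have := is_derive_add (is_derive_add (is_derive_mul dc dis) (is_derive_opp d1)) d3.
move=> h; apply: is_derive_eq h _.
rewrite /cst/=; have := cos2sin2 (pi * z).
set c := cos _; set s := sin _ => e.
have s0' : s != 0 by rewrite gt_eqF.
have -> : - pi ^+ 2 / s ^+ 2 = - pi ^+ 2 * (c ^+ 2 + s ^+ 2) / s ^+ 2.
  by rewrite e; field.
by field; rewrite s0' z1' gt_eqF.
Qed.

(** The derivative is bounded: near 0 by inv_sqr_sin_bound, and the symmetry z |-> 1 - z
exchanges the two halves of ]0, 1[. *)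
Lemma cot_reg_lipschitz : exists2 L, 0 <= L & forall z w, 0 < z < 1 -> 0 < w < 1 ->
  `|cot_reg z - cot_reg w| <= L * `|z - w|.
Proof.
(* 57 pi^2 bounds the derivative of the regularisation at one pole, 4 that of the other pole at distance at least 1/2 *)
pose L : R := 57 * pi ^+ 2 + 4.
have L0 : 0 <= L by have := sqr_ge0 (pi : R); rewrite /L; lra.
exists L => //.
have p0 := pi_gt0 R.
have half (z : R) : 0 < z <= 1 / 2 ->
  `|- pi ^+ 2 / sin (pi * z) ^+ 2 + (z ^+ 2)^-1 + ((1 - z) ^+ 2)^-1| <= L.
  move=> /andP[z0 z1].
  have s0 : 0 < sin (pi * z) by apply: sin_pi_gt0; rewrite z0; lra.
  have -> : - pi ^+ 2 / sin (pi * z) ^+ 2 + (z ^+ 2)^-1 =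
     - (pi ^+ 2 * ((sin (pi * z) ^+ 2)^-1 - ((pi * z) ^+ 2)^-1)).
    move: (sin (pi * z)) s0 => sn s0; move: (pi : R) p0 => p p0.
    by field; rewrite (gt_eqF z0) (gt_eqF s0) (gt_eqF p0).
  apply: (le_trans (ler_normD _ _)); rewrite normrN normrM (@ger0_norm _ (pi ^+ 2)) ?sqr_ge0//.
  rewrite /L lerD//.
    rewrite mulrC ler_wpM2r ?sqr_ge0//; apply: inv_sqr_sin_bound.
    by rewrite mulr_gt0//=; apply: ler_wpM2l; [exact: ltW|lra].
  rewrite ger0_norm ?invr_ge0 ?sqr_ge0//.
  rewrite -[leRHS]invrK lef_pV2 ?posrE ?invr_gt0 ?exprn_gt0//; [|lra].
  have : (1 / 2) ^+ 2 <= (1 - z) ^+ 2 by rewrite ler_sqr ?nnegrE; lra.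
  by lra.
have full (z : R) : 0 < z < 1 ->
  `|- pi ^+ 2 / sin (pi * z) ^+ 2 + (z ^+ 2)^-1 + ((1 - z) ^+ 2)^-1| <= L.
  move=> /andP[z0 z1]; have [h|h] := lerP z (1 / 2); first by apply: half; rewrite z0.
  have := half (1 - z); have -> : sin (pi * (1 - z)) = sin (pi * z).
    by rewrite mulrBr mulr1 sinB sinpi cospi; ring.
  have -> : 1 - (1 - z) = z by ring.
  by rewrite addrAC; apply; lra.
have lt (z w : R) : 0 < z < 1 -> 0 < w < 1 -> z < w ->
    `|cot_reg w - cot_reg z| <= L * `|w - z|.
  move=> z01 w01 zw.
  have sub (y : R) : y \in `[z, w] -> 0 < y < 1 by rewrite in_itv/=; lra.
  have cw : {within `[z, w], continuous cot_reg}.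
    apply: derivable_within_continuous => y /sub/dcot_reg[] //.
  have dd (y : R) : y \in `]z, w[ -> is_derive y 1 cot_reg
      (- pi ^+ 2 / sin (pi * y) ^+ 2 + (y ^+ 2)^-1 + ((1 - y) ^+ 2)^-1).
    by move=> yI; apply: dcot_reg; apply: sub; exact: subset_itv_oo_cc.
  have [y yI ->] := MVT zw dd cw.
  by rewrite normrM ler_wpM2r//; apply: full; apply: sub; exact: subset_itv_oo_cc.
move=> z w z01 w01; have [zw|wz|->] := ltgtP z w.
- by rewrite distrC (distrC z); exact: lt.
- exact: lt.
- by rewrite !subrr normr0 mulr0.
Qed.

Lemma cot_pi_duplication z : 0 < z < 1 ->
  cot_pi (z / 2) + cot_pi ((z + 1) / 2) = 2 * cot_pi z.
Proof.
move=> z01; have s0 := sin_pi_gt0 z01.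
rewrite /cot_pi.
have -> : pi * ((z + 1) / 2) = pi * (z / 2) + pi / 2 by field.
have e : pi * z = (pi * (z / 2)) *+ 2 by rewrite mulr2n; field.
rewrite cosDpihalf sinDpihalf; move: s0; rewrite e sin_mulr2n cos_mulr2n.
rewrite pmulrn_lgt0// => s0.
have := cos2Dsin2 (pi * (z / 2)).
set c := cos _; set s := sin _ => h.
have c0 : c != 0 by apply/eqP => c0; move: s0; rewrite -/c -/s c0 mul0r ltxx.
have sn0 : s != 0 by apply/eqP => c0'; move: s0; rewrite -/c -/s c0' mulr0 ltxx.
have -> : c ^+ 2 *+ 2 - 1 = c ^+ 2 - s ^+ 2 by rewrite mulr2n; lra.
by field; rewrite c0 sn0.
Qed.

Lemma cot_pi_reflection z : 0 < z < 1 ->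
  cot_pi (z / 2) - cot_pi ((z + 1) / 2) = 2 * (pi / sin (pi * z)).
Proof.
move=> z01; have s0 := sin_pi_gt0 z01.
rewrite /cot_pi.
have -> : pi * ((z + 1) / 2) = pi * (z / 2) + pi / 2 by field.
have e : pi * z = (pi * (z / 2)) *+ 2 by rewrite mulr2n; field.
rewrite cosDpihalf sinDpihalf; move: s0; rewrite e sin_mulr2n.
rewrite pmulrn_lgt0// => s0.
have := cos2Dsin2 (pi * (z / 2)).
set c := cos _; set s := sin _ => h.
have c0 : c != 0 by apply/eqP => c0; move: s0; rewrite -/c -/s c0 mul0r ltxx.
have sn0 : s != 0 by apply/eqP => c0'; move: s0; rewrite -/c -/s c0' mulr0 ltxx.
have -> : pi / ((c * s) *+ 2) = pi * (c ^+ 2 + s ^+ 2) / ((c * s) *+ 2) by rewrite h mulr1.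
by field; rewrite c0 sn0.
Qed.

End trig.

(** * The cotangent as an integral *)

Section cotangent_integral.
Context (R : realType).
Notation mu := (@lebesgue_measure R).
Notation Rp := (`]0%R, +oo[%classic : set R).
Implicit Types (t z w a b : R).

Let half_diff (A B C D X Y : R) : A + B = 2 * X -> C + D = 2 * Y ->
  X - Y = ((A - C) + (B - D)) / 2.
Proof. lra. Qed.

Lemma Rp_integrableD (f g : R -> R) : mu.-integrable Rp (EFin \o f) ->
  mu.-integrable Rp (EFin \o g) -> mu.-integrable Rp (EFin \o (fun t => f t + g t)).
Proof. exact: (@integrableD _ _ R mu _ (measurable_itv _)). Qed.

Lemma Rp_integrableB (f g : R -> R) : mu.-integrable Rp (EFin \o f) ->
  mu.-integrable Rp (EFin \o g) -> mu.-integrable Rp (EFin \o (fun t => f t - g t)).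
Proof. exact: (@integrableB _ _ R mu _ (measurable_itv _)). Qed.

Lemma Rp_integrableZ k (f : R -> R) : mu.-integrable Rp (EFin \o f) ->
  mu.-integrable Rp (EFin \o (fun t => k * f t)).
Proof. exact: (@integrableZl _ _ R mu _ (measurable_itv _) k). Qed.

Lemma gamma_fun1 t : gamma_fun 1 t = expR (- t).
Proof. by rewrite /gamma_fun subrr powRr0 mul1r. Qed.

Lemma exp_integrable a : 0 < a ->
  mu.-integrable Rp (EFin \o (fun t => expR (- (a * t)))) /\
  \int[mu]_(t in `]0%R, +oo[) expR (- (a * t)) = a^-1.
Proof.
move=> a0; have E := gamma_scale a0 (@ltr01 R).
have E' : (\int[mu]_(t in `]0%R, +oo[) (expR (- (a * t)))%:E = a^-1%:E)%E.
  have <- : (euler_integral 1 / a `^ 1)%:E = a^-1%:E :> \bar R.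
    by rewrite euler_integral1 div1r powRr1// ltW.
  by rewrite -E; apply: eq_integral => t _; rewrite subrr powRr0 mul1r.
split; last by rewrite /Rintegral E'.
apply: (ge0_halfline_integrable (l := a^-1)) => // t _.
exact: is_derive_continuous (is_derive_expRNM a t).
Qed.

Let den_gt0 t : 0 < t -> 0 < 1 - expR (- t).
Proof. by move=> t0; rewrite subr_gt0 expR_lt1; lra. Qed.

Let den_ge t : 0 < t -> t / (1 + t) <= 1 - expR (- t).
Proof.
move=> t0; have t1 : 0 < 1 + t by lra.
have : expR (- t) <= (1 + t)^-1.
  by rewrite expRN lef_pV2 ?posrE ?expR_gt0// expR_ge1Dx.
have -> : t / (1 + t) = 1 - (1 + t)^-1 by field; lra.
lra.
Qed.

Let diff_le t a b : 0 < t -> 1 <= a -> 1 <= b ->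
  `|expR (- (a * t)) - expR (- (b * t))| <= `|a - b| * (t * expR (- t)).
Proof.
move=> t0; wlog ab : a b / a <= b => [hw a1 b1|a1 b1].
  have /orP[h|h] := le_total a b; first exact: hw.
  by rewrite distrC (distrC a); exact: hw.
rewrite ger0_norm; last by rewrite subr_ge0 ler_expR lerN2 ler_wpM2r// ltW.
rewrite ler0_norm ?subr_le0// opprB.
have -> : expR (- (b * t)) = expR (- (a * t)) * expR (- ((b - a) * t)).
  by rewrite -expRD; congr expR; ring.
have h1 := expR_ge1Dx (- ((b - a) * t)).
have h2 : expR (- (a * t)) <= expR (- t).
  by rewrite ler_expR lerN2 ler_peMl// ltW.
have h0 := expR_ge0 (- (a * t)).
have h3 : 0 <= (b - a) * t by rewrite mulr_ge0 ?subr_ge0// ltW.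
apply: (@le_trans _ _ (expR (- (a * t)) * ((b - a) * t))).
  by rewrite -[X in X - _]mulr1 -mulrBr ler_wpM2l//; lra.
apply: (@le_trans _ _ (expR (- t) * ((b - a) * t))); first by rewrite ler_wpM2r.
by rewrite [leRHS]mulrA mulrC.
Qed.

(** The integrand of the digamma difference psi(b) - psi(a). *)
Let psi a b t := (expR (- (a * t)) - expR (- (b * t))) / (1 - expR (- t)).

Let cpsi a b t : 0 < t -> {for t, continuous (psi a b)}.
Proof.
move=> t0; have h := den_gt0 t0.
apply: cvgM.
  apply: cvgB; [exact: is_derive_continuous (is_derive_expRNM a t)
               |exact: is_derive_continuous (is_derive_expRNM b t)].
apply: cvgV; first by rewrite gt_eqF.
by apply: cvgB; [exact: cvg_cst|exact: is_derive_continuous (is_derive_expRN t)].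
Qed.

Let M t : R := gamma_fun 1 t + gamma_fun 2 t.

Let ME t : 0 < t -> M t = (1 + t) * expR (- t).
Proof.
move=> t0; rewrite /M gamma_fun1 /gamma_fun.
have -> : 2 - 1 = 1 :> R by ring.
by rewrite powRr1 ?ltW// mulrDl mul1r.
Qed.

Let M_integrable : mu.-integrable Rp (EFin \o M).
Proof.
exact: (Rp_integrableD (gamma_fun_integrable (@ltr01 R))
  (gamma_fun_integrable (ltr0Sn R 1))).
Qed.

(** Only valid for a, b >= 1: then the numerator is at most |a - b| t exp(-t), which
compensates the zero of the denominator at t = 0. *)
Let psi_bound t a b : 0 < t -> 1 <= a -> 1 <= b -> `|psi a b t| <= `|a - b| * M t.
Proof.
move=> t0 a1 b1; have h := den_gt0 t0; have h' := den_ge t0.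
rewrite /psi normrM (@ger0_norm _ (_^-1)); last by rewrite invr_ge0 ltW.
rewrite ler_pdivrMr//; apply: le_trans (diff_le t0 a1 b1) _.
rewrite -mulrA ler_wpM2l// ME// mulrAC ler_wpM2r ?expR_ge0//.
by rewrite mulrC -ler_pdivrMr; lra.
Qed.

Let psi_integrable a b : 1 <= a -> 1 <= b -> mu.-integrable Rp (EFin \o psi a b).
Proof.
move=> a1 b1; apply: (@halfline_integrable _ _ (fun t => `|a - b| * M t)).
- exact: cpsi.
- exact: (Rp_integrableZ `|a - b| M_integrable).
- by move=> t t0; exact: psi_bound.
Qed.

Let shift_psi a b t : 0 < t ->
  psi a b t = psi (a + 1) (b + 1) t + (expR (- (a * t)) - expR (- (b * t))).
Proof.
move=> t0; rewrite /psi !mulrDl !mul1r !opprD !expRD.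
by field; rewrite gt_eqF ?den_gt0.
Qed.

(** Shifting a and b by 1 removes the two terms that are not covered by psi_bound; they
are the poles 1 / a and 1 / b. *)
Lemma psi_integrable0 a b : 0 < a -> 0 < b ->
  mu.-integrable Rp (EFin \o psi a b) /\
  \int[mu]_(t in `]0%R, +oo[) psi a b t =
  \int[mu]_(t in `]0%R, +oo[) psi (a + 1) (b + 1) t + a^-1 - b^-1.
Proof.
move=> a0 b0; have [ia ea] := exp_integrable a0; have [ib eb] := exp_integrable b0.
have ip : mu.-integrable Rp (EFin \o psi (a + 1) (b + 1)).
  by apply: psi_integrable; rewrite lerDr ltW.
have iab := Rp_integrableB ia ib.
have E t : t \in Rp -> psi a b t = psi (a + 1) (b + 1) t +
    (expR (- (a * t)) - expR (- (b * t))).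
  by rewrite inE/= in_itv/= andbT => t0; exact: shift_psi.
split.
  apply: (@eq_integrable _ _ R mu _ (measurable_itv _) (fun t => (psi (a + 1) (b + 1) t +
    (expR (- (a * t)) - expR (- (b * t))))%:E)).
    by move=> t tI; rewrite /= (E t tI).
  exact: (Rp_integrableD ip iab).
transitivity (\int[mu]_(t in `]0%R, +oo[) (psi (a + 1) (b + 1) t +
    (expR (- (a * t)) - expR (- (b * t))))); first exact: eq_Rintegral.
by rewrite RintegralD// RintegralB// ea eb addrA.
Qed.

(** Equals pi cot(pi z), see cot_intE. The proof needs only that it has the same poles and
satisfies the same duplication formula as the cotangent. *)
Definition cot_int z : R :=
  \int[mu]_(t in `]0%R, +oo[)
    ((expR (- (z * t)) - expR (- ((1 - z) * t))) / (1 - expR (- t))).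

Lemma cot_int_reg_lipschitz : exists2 L, 0 <= L & forall z w, 0 < z < 1 -> 0 < w < 1 ->
  `|(cot_int z - z^-1 + (1 - z)^-1) - (cot_int w - w^-1 + (1 - w)^-1)| <= L * `|z - w|.
Proof.
pose I := \int[mu]_(t in `]0%R, +oo[) M t.
have M0 t : 0 <= M t by rewrite addr_ge0 ?gamma_fun_ge0.
have I0 : 0 <= I by apply: Rintegral_ge0.
exists (2 * I); first by rewrite mulr_ge0.
move=> z w z01 w01.
have red (y : R) : 0 < y < 1 -> cot_int y - y^-1 + (1 - y)^-1 =
    \int[mu]_(t in `]0%R, +oo[) psi (y + 1) (1 - y + 1) t.
  move=> /andP[y0 y1]; have y1' : 0 < 1 - y by rewrite subr_gt0.
  have [_ e] := psi_integrable0 y0 y1'.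
  by rewrite [cot_int y]e; move: (\int[mu]_(t in _) _) => A; ring.
have iz (y : R) : 0 < y < 1 -> mu.-integrable Rp (EFin \o psi (y + 1) (1 - y + 1)).
  by move=> /andP[y0 y1]; apply: psi_integrable; rewrite lerDr ?subr_ge0 ltW.
rewrite !red// -RintegralB//; [|exact: iz..].
have iB := Rp_integrableB (iz _ z01) (iz _ w01).
apply: le_trans (le_normr_Rintegral _ iB) _ => //.
rewrite mulrAC -RintegralZl//.
apply: le_Rintegral => //.
- exact: integrable_norm iB.
- exact: (Rp_integrableZ _ M_integrable).
move=> t /=; rewrite in_itv/= andbT => t0.
have -> : psi (z + 1) (1 - z + 1) t - psi (w + 1) (1 - w + 1) t =
  psi (z + 1) (w + 1) t + psi (1 - w + 1) (1 - z + 1) t by rewrite /psi; ring.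
apply: le_trans (ler_normD _ _) _.
have h1 := @psi_bound t (z + 1) (w + 1) t0.
have h2 := @psi_bound t (1 - w + 1) (1 - z + 1) t0.
have e1 : z + 1 - (w + 1) = z - w by ring.
have e2 : 1 - w + 1 - (1 - z + 1) = z - w by ring.
rewrite e1 in h1; rewrite e2 in h2.
have [? ? ? ?] : [/\ 1 <= z + 1, 1 <= w + 1, 1 <= 1 - z + 1 & 1 <= 1 - w + 1].
  by case/andP: z01 => ? ?; case/andP: w01 => ? ?; split; rewrite lerDr ?subr_ge0 ltW.
rewrite -mulrA mulr_natl mulr2n.
by apply: lerD; [exact: h1|exact: h2].
Qed.

Let Rp_integrable_scale (c : R) (f : R -> R) : 0 < c -> mu.-integrable Rp (EFin \o f) ->
  mu.-integrable Rp (EFin \o (fun t => f (c * t))).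
Proof.
move=> c0 fi.
have fi' : mu.-integrable setT (EFin \o (f \_ Rp)).
  rewrite -restrict_EFin.
  have := @integrable_mkcond _ _ _ mu Rp (EFin \o f).
  by move=> /(_ (measurable_itv _))[h _]; exact: h.
have := integrable_affine 0 (lt0r_neq0 c0) fi'.
move=> h; have := @integrable_mkcond _ _ _ mu Rp (EFin \o (fun t => f (c * t))).
move=> /(_ (measurable_itv _))[_]; apply; rewrite restrict_EFin.
apply: eq_integrable h => // t _; rewrite /= addr0 !patchE.
have -> : (c * t \in Rp) = (t \in Rp).
  by apply/idP/idP; rewrite !inE/= !in_itv/= !andbT pmulr_rgt0.
by [].
Qed.

Lemma cot_int_scale z : 0 < z < 1 ->
  mu.-integrable Rp (EFin \o (fun t => 2 * psi z (1 - z) (2 * t))) /\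
  cot_int z = \int[mu]_(t in `]0%R, +oo[) (2 * psi z (1 - z) (2 * t)).
Proof.
move=> z01; have [i _] := @psi_integrable0 z (1 - z) ltac:(lra) ltac:(lra).
split; last by rewrite /cot_int -halfline_Raffine.
exact: (Rp_integrableZ 2 (Rp_integrable_scale (ltr0Sn R 1) i)).
Qed.

(** In terms of E = exp(-t) and A = exp(-z t), after the substitution t := 2 t. *)
Let half_psi z t : 0 < t ->
  let E := expR (- t) in let A := expR (- (z * t)) in
  2 * psi (z / 2) (1 - z / 2) (2 * t) = 2 * (A - E ^+ 2 / A) / (1 - E ^+ 2) /\
  2 * psi ((z + 1) / 2) (1 - (z + 1) / 2) (2 * t) =
    2 * (A * E - E / A) / (1 - E ^+ 2) /\
  expR (- ((1 - z) * t)) = E / A /\ [/\ 0 < A, 0 < E & 0 < 1 - E].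
Proof.
move=> t0 E A; rewrite /psi.
have -> : expR (- (2 * t)) = E ^+ 2 by rewrite expr2 -expRD; congr expR; ring.
have -> : expR (- (z / 2 * (2 * t))) = A by congr expR; field.
have -> : expR (- ((1 - z / 2) * (2 * t))) = E ^+ 2 / A.
  by rewrite expr2 -expRN -!expRD; congr expR; field.
have -> : expR (- ((z + 1) / 2 * (2 * t))) = A * E.
  by rewrite -!expRD; congr expR; field.
have -> : expR (- ((1 - (z + 1) / 2) * (2 * t))) = E / A.
  by rewrite -expRN -!expRD; congr expR; field.
split; first by rewrite mulrA.
split; first by rewrite mulrA.
split; first by rewrite -expRN -!expRD; congr expR; ring.
by split; [exact: expR_gt0|exact: expR_gt0|exact: den_gt0].
Qed.

Let half_range z : 0 < z < 1 -> (0 < z / 2 < 1) /\ (0 < (z + 1) / 2 < 1).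
Proof. by move=> z01; split; lra. Qed.

(** After t := 2 t the two integrands have the common denominator
1 - exp(-2 t) = (1 - exp(-t)) (1 + exp(-t)), and their sum is divisible by
1 + exp(-t). *)
Lemma cot_int_duplication z : 0 < z < 1 ->
  cot_int (z / 2) + cot_int ((z + 1) / 2) = 2 * cot_int z.
Proof.
move=> z01; have [h1 h2] := half_range z01.
have [i1 ->] := cot_int_scale h1.
have [i2 ->] := cot_int_scale h2.
have [z0 z1] : 0 < z /\ 0 < 1 - z by case/andP: z01 => ? ?; split; rewrite ?subr_gt0.
have [i _] := psi_integrable0 z0 z1.
rewrite -RintegralD// /cot_int -RintegralZl//.
apply: eq_Rintegral => t; rewrite inE/= in_itv/= andbT => t0.
have [-> [-> [-> []]]] := half_psi z t0.
move: (expR (- (z * t))) (expR (- t)) => A E A0 E0 E1.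
have h : 1 - E ^+ 2 != 0 by rewrite gt_eqF// subr_gt0 expr_lt1// ?(ltW E0)// -subr_gt0.
by field; rewrite h !gt_eqF.
Qed.

(** As for the duplication formula, but now the difference of the two integrands is
divisible by 1 - exp(-t). The result is the integrand that the substitution
u = exp(t) produces from the Beta integral, see euler_reflection. *)
Lemma cot_int_reflection z : 0 < z < 1 ->
  cot_int (z / 2) - cot_int ((z + 1) / 2) =
  2 * \int[mu]_(t in `]0%R, +oo[)
    ((expR (- (z * t)) + expR (- ((1 - z) * t))) / (1 + expR (- t))).
Proof.
move=> z01; have [h1 h2] := half_range z01.
have [i1 ->] := cot_int_scale h1.
have [i2 ->] := cot_int_scale h2.
have [z0 z1] : 0 < z /\ 0 < 1 - z by case/andP: z01 => ? ?; split; rewrite ?subr_gt0.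
have [iz _] := exp_integrable z0; have [iz' _] := exp_integrable z1.
rewrite -RintegralB// -RintegralZl//; last first.
  apply: (@halfline_integrable _ _ (fun t => expR (- (z * t)) + expR (- ((1 - z) * t)))).
  - move=> t _; apply: cvgM.
      apply: cvgD; [exact: is_derive_continuous (is_derive_expRNM z t)
                   |exact: is_derive_continuous (is_derive_expRNM (1 - z) t)].
    apply: cvgV; first by rewrite gt_eqF// ltr_pwDr// expR_ge0.
    by apply: cvgD; [exact: cvg_cst|exact: is_derive_continuous (is_derive_expRN t)].
  - exact: Rp_integrableD iz iz'.
  - move=> t _; have e0 := expR_gt0 (- t).
    have p1 : 0 < 1 + expR (- t) by rewrite addr_gt0.
    rewrite ger0_norm; last by rewrite divr_ge0 ?addr_ge0 ?expR_ge0.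
    by rewrite ler_pdivrMr// ler_peMr ?addr_ge0 ?expR_ge0// lerDl expR_ge0.
apply: eq_Rintegral => t; rewrite inE/= in_itv/= andbT => t0.
have [-> [-> [-> []]]] := half_psi z t0.
move: (expR (- (z * t))) (expR (- t)) => A E A0 E0 E1.
have h : 1 - E ^+ 2 != 0 by rewrite gt_eqF// subr_gt0 expr_lt1// ?(ltW E0)// -subr_gt0.
have h' : 1 + E != 0 by rewrite gt_eqF// addr_gt0.
by field; rewrite h h' !gt_eqF.
Qed.

(** The difference r of the two sides is Lipschitz on ]0, 1[ and satisfies
r(z / 2) + r((z + 1) / 2) = 2 r(z), so r(z) is the mean of r at two points, and the
distance between the corresponding points for z and w is halved. Iterating, r has
arbitrarily small Lipschitz constants, so it is constant; and r(1 / 2) = 0. *)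
Lemma cot_intE z : 0 < z < 1 -> cot_int z = cot_pi z.
Proof.
move: z; have [L1 L10 lip1] := @cot_reg_lipschitz R.
have [L2 L20 lip2] := cot_int_reg_lipschitz.
pose r y := cot_pi y - cot_int y.
have lip (z w : R) : 0 < z < 1 -> 0 < w < 1 -> `|r z - r w| <= (L1 + L2) * `|z - w|.
  move=> z01 w01.
  have -> : r z - r w = (cot_reg z - cot_reg w) -
    ((cot_int z - z^-1 + (1 - z)^-1) - (cot_int w - w^-1 + (1 - w)^-1)).
    rewrite /r /cot_reg; move: (cot_pi z) (cot_int z) (cot_pi w) (cot_int w).
    by move=> ? ? ? ?; ring.
  by rewrite (le_trans (ler_normB _ _))// mulrDl lerD ?lip1 ?lip2.
have dup (y : R) : 0 < y < 1 -> r (y / 2) + r ((y + 1) / 2) = 2 * r y.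
  by move=> y01; have := cot_pi_duplication y01; have := cot_int_duplication y01; rewrite /r;
    move: (cot_pi (y / 2)) (cot_pi ((y + 1) / 2)) (cot_pi y)
      (cot_int (y / 2)) (cot_int ((y + 1) / 2)) (cot_int y) => p1 p2 p3 q1 q2 q3 e1 e2;
    rewrite addrACA -opprD e1 e2 -mulrBr.
have lipn n (z w : R) : 0 < z < 1 -> 0 < w < 1 ->
    `|r z - r w| <= (L1 + L2) / 2 ^+ n * `|z - w|.
  elim: n z w => [|n ih] z w z01 w01; first by rewrite expr0 divr1; exact: lip.
  have [z1 z2] := half_range z01; have [w1 w2] := half_range w01.
  have h1 := ih _ _ z1 w1; have h2 := ih _ _ z2 w2.
  have e1 : z / 2 - w / 2 = (z - w) / 2 by rewrite mulrBl.
  have e2 : (z + 1) / 2 - (w + 1) / 2 = (z - w) / 2 by rewrite -mulrBl opprD addrACA subrr addr0.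
  rewrite e1 in h1; rewrite e2 in h2.
  rewrite normrM (@ger0_norm _ 2^-1) ?invr_ge0// in h1.
  rewrite normrM (@ger0_norm _ 2^-1) ?invr_ge0// in h2.
  rewrite (half_diff (dup z z01) (dup w w01)).
  rewrite normrM (@ger0_norm _ 2^-1) ?invr_ge0//.
  have h3 := ler_normD (r (z / 2) - r (w / 2)) (r ((z + 1) / 2) - r ((w + 1) / 2)).
  rewrite exprS invfM mulrA.
  set c := _ / 2 ^+ n in h1 h2 *.
  have -> : (L1 + L2) / 2 / 2 ^+ n = c / 2 by rewrite mulrAC.
  rewrite mulrAC ler_pM2r ?invr_gt0//; apply: le_trans h3 _.
  have -> : c * `|z - w| = c * (`|z - w| / 2) + c * (`|z - w| / 2).
    by rewrite -mulrDr -splitr.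
  exact: lerD h1 h2.
have const (z w : R) : 0 < z < 1 -> 0 < w < 1 -> r z = r w.
  move=> z01 w01; apply/eqP; rewrite -subr_eq0 -normr_le0.
  have lim : (L1 + L2) / 2 ^+ n * `|z - w| @[n --> \oo] --> (0 : R).
    rewrite (_ : (fun n => _) = (fun n => ((L1 + L2) * `|z - w|) * (2^-1) ^+ n)); last first.
      by apply/funext => n; rewrite exprVn mulrAC.
    rewrite -[X in _ --> X](mulr0 ((L1 + L2) * `|z - w|)).
    apply: cvgM; first exact: cvg_cst.
    apply: cvg_expr; rewrite ger0_norm ?invr_ge0// invf_lt1// ltr1n//.
  by apply: (cvgr_to_ge lim); apply: nearW => n; exact: lipn.
move=> z z01.
have r0 : r (1 / 2) = 0.
  rewrite /r /cot_pi /cot_int.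
  rewrite mulrA mulr1.
  rewrite cos_pihalf mulr0 mul0r.
  under eq_Rintegral => t _.
    have -> : 1 - 1 / 2 = 1 / 2 :> R by rewrite [X in X - _](splitr 1) addrK.
    rewrite subrr mul0r.
    over.
  by rewrite /Rintegral integral0 subrr.
have h12 : 0 < (1 / 2 : R) < 1 by rewrite divr_gt0//= ltr_pdivrMr// mul1r ltr1n.
by have /eqP := const z (1 / 2) z01 h12; rewrite r0 subr_eq0 => /eqP.
Qed.

End cotangent_integral.

(** * The reflection formula *)

Section reflection.
Context (R : realType).
Notation mu := (@lebesgue_measure R).
Notation Rp := (`]0%R, +oo[%classic : set R).
Implicit Types (t z w a b : R).

Lemma ge0_integral_halflines (f : R -> \bar R) : measurable_fun [set: R] f ->
  (forall x, 0 <= f x)%E ->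
  (\int[mu]_x f x = \int[mu]_(x in `]0%R, +oo[) f x + \int[mu]_(x in `]0%R, +oo[) f (- x)%R)%E.
Proof.
move=> mf f0.
have -> : [set: R] = `]-oo, 0]%classic `|` Rp.
  apply/seteqP; split => // x _ /=; rewrite !in_itv/= andbT.
  by apply/orP; rewrite leNgt orNb.
rewrite ge0_integral_setU//=; last 2 first.
- exact: measurable_funTS.
- apply/disj_setPS => x [] /=; rewrite !in_itv/= andbT => h1 h2.
  by move: h1; rewrite leNgt h2.
rewrite addeC; congr (_ + _)%E.
have m1 : measurable_fun setT (f \_ (`]-oo, 0]%classic : set R)).
  by apply/(measurable_restrictT f) => //; exact: measurable_funTS.
rewrite [LHS]integral_mkcond (@ge0_integral_affine _ (-1) 0)//; last first.
  by move=> x; rewrite patchE; case: ifP.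
rewrite normrN1 mul1e.
rewrite [RHS]integral_mkcond [RHS](_ : _ = \int[mu]_x ((f \o -%R) \_ (`[0%R, +oo[ : set R)) x)%E.
  apply: eq_integral => x _; rewrite !patchE addr0 mulN1r.
  have -> // : (- x \in (`]-oo, 0]%classic : set R)) = (x \in (`[0, +oo[%classic : set R)).
  by apply/idP/idP; rewrite !inE/= !in_itv/= andbT oppr_le0.
rewrite -integral_mkcond -[RHS]integral_mkcond.
apply: integral_itv_obnd_cbnd; apply: measurable_funTS.
exact: measurableT_comp mf (@oppr_measurable R setT).
Qed.

Lemma bigcup_expR : Rp = \bigcup_n `[expR (- n.+1%:R), expR n.+1%:R]%classic.
Proof.
apply/seteqP; split => x /=; rewrite ?in_itv/= ?andbT; last first.
  by move=> [n _]/=; rewrite in_itv/= => /andP[+ _]; apply: lt_le_trans; exact: expR_gt0.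
move=> x0; exists (Num.truncn `|ln x|) => //=.
have := truncnS_gt `|ln x|; rewrite in_itv/= => /ltW; rewrite ler_norml => /andP[h1 h2].
by have := h1; have := h2; rewrite -(ler_expR (ln x)) -(ler_expR _ (ln x)) lnK ?posrE// => -> ->.
Qed.

Lemma bigcup_sym_itv : [set: R] = \bigcup_n `[- n.+1%:R, n.+1%:R]%classic.
Proof.
apply/seteqP; split => x //= _.
exists (Num.truncn `|x|) => //=.
by have := truncnS_gt `|x|; rewrite in_itv/= => /ltW; rewrite ler_norml.
Qed.

(** Substituting u = exp(t) in the Beta integral with p = z, q = 1 - z gives an integral
over the line; folding it at 0 gives the integral of cot_int_reflection, hence
(pi / 2) (cot(pi z / 2) - cot(pi (z + 1) / 2)) = pi / sin(pi z). *)
Lemma euler_reflection z : 0 < z < 1 ->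
  euler_integral z * euler_integral (1 - z) = pi / sin (pi * z).
Proof.
move=> z01; have [z0 z1] : 0 < z /\ 0 < 1 - z by lra.
have ab n : - n.+1%:R < n.+1%:R :> R by rewrite (@lt_trans _ _ 0)// ?oppr_lt0 ltr0n.
have nd : nondecreasing_seq (fun n => `[- n.+1%:R, n.+1%:R]%classic : set R).
  move=> n m nm; rewrite subsetEset => x /=; rewrite !in_itv/= -!ler_norml => h.
  by rewrite (le_trans h)// ler_nat.
have cexp (x : R) : {for x, continuous expR} by exact: continuous_expR.
(* the exponent is left unsimplified to match beta_integral *)
pose G u : R := u `^ (z - 1) * (1 + u) `^ (- (z + (1 - z))).
have := beta_integral z0 z1; rewrite -/(G _).
rewrite (@ge0_improper_substitution R _ _ _ ab nd bigcup_sym_itv expR expR G _ bigcup_expR)//;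
  last 3 first.
- by move=> x y _ _ xy; rewrite ltr_expR.
- move=> x; rewrite /= in_itv/= andbT => x0; apply: cvgM; first exact: continuous_powR.
  by apply: continuous_powR1D; rewrite addr_gt0.
- by move=> x _; rewrite mulr_ge0 ?powR_ge0.
have d0 t : 0 < 1 + expR t by rewrite addr_gt0 ?expR_gt0.
have GE s : G (expR s) * expR s = expR (z * s) / (1 + expR s).
  rewrite /G addrCA subrr addr0 powR_inv1 ?(ltW (d0 _))// mulrAC.
  by rewrite -expRM -expRD; congr (expR _ / _); ring.
rewrite addrCA subrr addr0 euler_integral1 divr1.
under eq_integral do rewrite GE.
have g0 x : (0 <= (expR (z * x) / (1 + expR x))%:E)%E.
  by rewrite lee_fin divr_ge0 ?expR_ge0// ltW.
have cg x : {for x, continuous (fun x : R => expR (z * x) / (1 + expR x))}.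
  apply: cvgM; first exact: is_derive_continuous (is_derive_expRM z x).
  by apply: cvgV; [rewrite gt_eqF|apply: cvgD; [exact: cvg_cst|exact: cexp]].
have mg : measurable_fun setT (fun x : R => (expR (z * x) / (1 + expR x))%:E).
  by apply/measurable_EFinP; exact: continuous_measurable_fun.
rewrite ge0_integral_halflines// -ge0_integralD//; last 2 first.
- exact: measurable_funTS.
- by apply: measurable_funTS; exact: measurableT_comp mg (@oppr_measurable R setT).
under eq_integral => x _.
  rewrite -EFinD [X in X + _](_ : _ = expR (- ((1 - z) * x)) / (1 + expR (- x))); last first.
    rewrite expRN; have := expR_gt0 x; have := d0 x.
    have -> : expR (- ((1 - z) * x)) = expR (z * x) / expR x.
      by rewrite -expRN -expRD; congr expR; ring.
    by move: (expR x) (expR (z * x)) => E A h1 h2; field;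
      rewrite ?(addrC E) !gt_eqF.
  rewrite mulrN -mulrDl [X in X / _]addrC.
  over.
move=> e; apply: (@mulfI _ 2) => //.
rewrite -cot_pi_reflection// -!cot_intE; [|lra..].
by rewrite cot_int_reflection// /Rintegral e.
Qed.

(** Form of the reflection formula that is valid on the whole of ]-1, 1[. *)
Lemma euler_reflection_sin a : `|a| < 1 ->
  euler_integral (1 + a) * euler_integral (1 - a) * sin (pi * a) = pi * a.
Proof.
have pos (c : R) : 0 < c < 1 ->
    euler_integral (1 + c) * euler_integral (1 - c) * sin (pi * c) = pi * c.
  move=> c01; have := euler_reflection c01; have /andP[c0 _] := c01.
  rewrite (addrC 1 c) euler_integralS// -(mulrA c) => ->.
  by rewrite -mulrA divfK ?gt_eqF ?sin_pi_gt0// mulrC.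
rewrite ltr_norml => /andP[h1 h2]; have [a0|a0|->] := ltgtP a 0.
- have := pos (- a) ltac:(lra); rewrite opprK !mulrN sinN mulrN => /oppr_inj.
  by rewrite [X in X * sin _]mulrC.
- by apply: pos; rewrite a0 h2.
- by rewrite !mulr0 sin0 mulr0.
Qed.

End reflection.

(** * Increments of powers *)

Section increments.
Context (R : realType).
Notation mu := (@lebesgue_measure R).
Notation Rp := (`]0%R, +oo[%classic : set R).
Implicit Types (x y c e : R).

Lemma powR_addn1 x c : 0 < x -> x `^ (c + 1) = x * x `^ c.
Proof. by move=> x0; rewrite powRD ?(gt_eqF x0) ?implybT// powRr1 ?ltW// mulrC. Qed.

Lemma powR_antitone e x y : e <= 0 -> 0 < x -> x <= y -> y `^ e <= x `^ e.
Proof.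
move=> e0 x0 xy; have y0 := lt_le_trans x0 xy.
rewrite -(opprK e) !(powRN _ (- e)) lef_pV2 ?posrE ?powR_gt0//.
by apply: ge0_ler_powR; rewrite ?oppr_ge0 ?nnegrE// ltW.
Qed.

(** Holds for exponents of both signs, which avoids case distinctions on the exponents
in the estimates at infinity. *)
Lemma powR_le_endpoints e x y s : 0 < x -> x <= s -> s <= y ->
  s `^ e <= x `^ e + y `^ e.
Proof.
move=> x0 xs sy; have s0 := lt_le_trans x0 xs; have y0 := lt_le_trans s0 sy.
have [e0|e0] := leP e 0.
  by rewrite (le_trans (powR_antitone e0 x0 xs))// lerDl powR_ge0.
apply: (@le_trans _ _ (y `^ e)); last by rewrite lerDr powR_ge0.
by apply: ge0_ler_powR; rewrite ?nnegrE// ltW.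
Qed.

Definition pow_incr c x := (1 + x) `^ c - x `^ c.

Lemma pow_incr_bound c x : 0 < x ->
  `|pow_incr c x| <= `|c| * (x `^ (c - 1) + (1 + x) `^ (c - 1)).
Proof.
move=> x0; rewrite /pow_incr.
have x1 : x < 1 + x by lra.
have [||s] := @MVT R (fun y => y `^ c) (fun y => c * y `^ (c - 1)) x (1 + x) x1.
- by move=> y; rewrite in_itv/= => /andP[h _]; apply: is_derive1_powR; lra.
- apply: continuous_in_subspaceT => y; rewrite inE/= in_itv/= => /andP[h _].
  by apply: continuous_powR; lra.
rewrite in_itv/= => /andP[h1 h2] ->.
rewrite addrK mulr1 normrM (ger0_norm (powR_ge0 _ _)) ler_wpM2l//.
by apply: powR_le_endpoints => //; exact: ltW.
Qed.

Lemma cvgy0_powR_bound (f : R -> R) k e : e < 0 ->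
  (forall x, 0 < x -> `|f x| <= k * x `^ e) -> f x @[x --> +oo] --> (0 : R).
Proof.
move=> e0 fk; apply: norm_cvg0.
apply: (@squeeze_cvgr _ _ _ _ (cst 0) (fun x => k * x `^ e)); last 2 first.
- exact: cvg_cst.
- rewrite -[X in _ --> X](mulr0 k); apply: cvgM; first exact: cvg_cst.
  exact: powR_cvgy0.
by near=> x; rewrite normr_ge0/= fk//; near: x; exact: nbhs_pinfty_gt.
Unshelve. all: by end_near. Qed.

Lemma cvg0_powR1D c : (1 + x) `^ c @[x --> 0^'+] --> (1 : R).
Proof.
apply: cvg_at_right_filter.
have := @continuous_powR1D R c 0 ltac:(by rewrite addr0 ltr01).
by rewrite /prop_for /continuous_at/= addr0 powR1.
Qed.

End increments.

Section increments_limit.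
Context (R : realType).
Implicit Types (x y c e a b : R).

(** By pow_incr_bound the product is O(x^(a + b - 1)), and a + b < 1. *)
Lemma pow_incr_mul_cvgy0 a b : `|a| < 1 / 2 -> `|b| < 1 / 2 ->
  x * (pow_incr a x * pow_incr b x) @[x --> +oo] --> (0 : R).
Proof.
rewrite !ltr_norml => ha hb.
apply: (@cvgy0_powR_bound _ _ (4 * `|a| * `|b|) (a + b - 1)); first lra.
move=> x x0; have hx := @pow_incr_bound R a x x0; have hy := @pow_incr_bound R b x x0.
have x1 : x <= 1 + x by lra.
have h1 : (1 + x) `^ (a - 1) <= x `^ (a - 1) by apply: powR_antitone => //; lra.
have h2 : (1 + x) `^ (b - 1) <= x `^ (b - 1) by apply: powR_antitone => //; lra.
rewrite !normrM (gtr0_norm x0).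
apply: (@le_trans _ _ (x * ((`|a| * (x `^ (a - 1) + x `^ (a - 1))) *
    (`|b| * (x `^ (b - 1) + x `^ (b - 1)))))).
  apply: ler_wpM2l; first exact: ltW.
  by apply: ler_pM => //; [apply: (le_trans hx)|apply: (le_trans hy)];
    apply: ler_wpM2l => //; rewrite lerD2l.
have -> : a + b - 1 = (a - 1) + (b - 1) + 1 by ring.
rewrite powR_addn1// (@powRD _ x (a - 1) (b - 1)) ?(gt_eqF x0) ?implybT//.
move: (x `^ (a - 1)) (x `^ (b - 1)) => A B.
by rewrite le_eqVlt; apply/orP; left; apply/eqP; ring.
Qed.

Lemma pow_incr_cross_cvgy0 a b : `|a| < 1 / 2 -> `|b| < 1 / 2 ->
  (1 + x) `^ (a - 1) * pow_incr (b + 1) x @[x --> +oo] --> (0 : R).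
Proof.
rewrite !ltr_norml => ha hb.
apply: (@cvgy0_powR_bound _ _ (2 * `|b + 1|) (a + b - 1)); first lra.
move=> x x0; have hy := @pow_incr_bound R (b + 1) x x0.
rewrite addrK in hy.
have x1 : x <= 1 + x by lra.
have x10 : 0 < 1 + x by lra.
have h1 : (1 + x) `^ (a - 1) <= x `^ (a - 1) by apply: powR_antitone => //; lra.
have h2 : (1 + x) `^ (a - 1 + b) <= x `^ (a - 1 + b) by apply: powR_antitone => //; lra.
rewrite normrM (ger0_norm (powR_ge0 _ _)).
apply: (@le_trans _ _ ((1 + x) `^ (a - 1) * (`|b + 1| * (x `^ b + (1 + x) `^ b)))).
  by apply: ler_wpM2l; rewrite ?powR_ge0.
rewrite mulrCA mulrDr -powRD ?(gt_eqF x10) ?implybT//.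
rewrite [2 * _]mulrC -mulrA; apply: ler_wpM2l => //.
rewrite mulrDl mul1r [a + b - 1]addrAC; apply: lerD => //.
rewrite (@powRD _ x (a - 1) b) ?(gt_eqF x0) ?implybT//.
by apply: ler_wpM2r; rewrite ?powR_ge0.
Qed.

(** Its derivative contains the product of pow_incr a and pow_incr b, and otherwise only
Beta integrands (is_derive_pow_incr_primitive). It is
(1 - a - b - 1) x P Q + a (1 + x)^(a - 1) (x^(b + 1) - (1 + x)^(b + 1)) + (a <-> b)
with P Q expanded, a form whose limit at 0 can be read off; pow_incr_primitiveE gives the
unexpanded form, which is the useful one at infinity. *)
Definition pow_incr_primitive a b x : R :=
  (1 - (a + b + 1)) * (x * ((1 + x) `^ a * (1 + x) `^ b) - x `^ (b + 1) * (1 + x) `^ a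
    - x `^ (a + 1) * (1 + x) `^ b + x `^ (a + b + 1))
  + a * ((1 + x) `^ (a - 1) * (x `^ (b + 1) - (1 + x) `^ (b + 1)))
  + b * ((1 + x) `^ (b - 1) * (x `^ (a + 1) - (1 + x) `^ (a + 1))).

Lemma pow_incr_primitiveE a b x : 0 < x -> pow_incr_primitive a b x =
  (1 - (a + b + 1)) * (x * (pow_incr a x * pow_incr b x))
  - a * ((1 + x) `^ (a - 1) * pow_incr (b + 1) x)
  - b * ((1 + x) `^ (b - 1) * pow_incr (a + 1) x).
Proof.
move=> x0; have x1 : 0 < 1 + x by lra.
rewrite /pow_incr_primitive /pow_incr !powR_addn1// (@powRD _ x a b) ?(gt_eqF x0) ?implybT//.
ring.
Qed.

Lemma is_derive_pow_incr_primitive a b x : 0 < x ->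
  is_derive x 1 (pow_incr_primitive a b)
    ((a + b + 1) * (1 - (a + b + 1)) * (pow_incr a x * pow_incr b x)
     + a * (1 - a) * (x `^ b * (1 + x) `^ (a - 2))
     + b * (1 - b) * (x `^ a * (1 + x) `^ (b - 2))).
Proof.
move=> x0; have x1 : 0 < 1 + x by lra.
have c k : is_derive x 1 (fun=> k : R) (0 : R) by exact: is_derive_cst.
have i : is_derive x 1 (fun y : R => y) (1 : R) by exact: is_derive_id.
have p e := is_derive1_powR e x0; have q e := is_derive_powR1D e x1.
apply: (is_derive_eq (is_derive_add (is_derive_add
  (is_derive_mul (c _) (is_derive_add (is_derive_add (is_derive_add
     (is_derive_mul i (is_derive_mul (q a) (q b)))
     (is_derive_opp (is_derive_mul (p (b + 1)) (q a))))
     (is_derive_opp (is_derive_mul (p (a + 1)) (q b))))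
     (p (a + b + 1))))
  (is_derive_mul (c a) (is_derive_mul (q (a - 1))
     (is_derive_add (p (b + 1)) (is_derive_opp (q (b + 1)))))))
  (is_derive_mul (c b) (is_derive_mul (q (b - 1))
     (is_derive_add (p (a + 1)) (is_derive_opp (q (a + 1)))))))).
rewrite !addrK.
have -> : a - 2 = a - 1 - 1 by ring.
have -> : b - 2 = b - 1 - 1 by ring.
rewrite /pow_incr !powR_mulV// !powR_addn1// (@powRD _ x a b) ?(gt_eqF x0) ?implybT//.
move: (x `^ a) (x `^ b) ((1 + x) `^ a) ((1 + x) `^ b) => A B A' B'.
by field; rewrite !gt_eqF.
Qed.

Lemma pow_incr_primitive_cvg0 a b : `|a| < 1 / 2 -> `|b| < 1 / 2 ->
  pow_incr_primitive a b x @[x --> 0^'+] --> - (a + b).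
Proof.
rewrite !ltr_norml => ha hb.
have -> : - (a + b) = (1 - (a + b + 1)) * (0 * (1 * 1) - 0 * 1 - 0 * 1 + 0)
  + a * (1 * (0 - 1)) + b * (1 * (0 - 1)) by ring.
have q e : (1 + x) `^ e @[x --> 0^'+] --> (1 : R) by exact: cvg0_powR1D.
have p e : 0 < e -> x `^ e @[x --> 0^'+] --> (0 : R) by exact: powR_cvg0.
have i : x @[x --> 0^'+] --> (0 : R) by apply: cvg_at_right_filter.
have c k : k @[_ --> (0 : R)^'+] --> (k : R) by exact: cvg_cst.
have [pa pb pc] : [/\ 0 < a + 1, 0 < b + 1 & 0 < a + b + 1] by split; lra.
exact: (cvgD (cvgD
  (cvgM (c _) (cvgD (cvgB (cvgB
     (cvgM i (cvgM (q a) (q b)))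
     (cvgM (p _ pb) (q a)))
     (cvgM (p _ pa) (q b)))
     (p _ pc)))
  (cvgM (c a) (cvgM (q (a - 1)) (cvgB (p _ pb) (q (b + 1))))))
  (cvgM (c b) (cvgM (q (b - 1)) (cvgB (p _ pa) (q (a + 1)))))).
Qed.

Lemma pow_incr_primitive_cvgy a b : `|a| < 1 / 2 -> `|b| < 1 / 2 ->
  pow_incr_primitive a b x @[x --> +oo] --> (0 : R).
Proof.
move=> ha hb.
have -> : 0 = (1 - (a + b + 1)) * 0 - a * 0 - b * 0 :> R by ring.
have c (k : R) : (fun=> k) x @[x --> pinfty_nbhs R] --> k by exact: cvg_cst.
apply: cvg_trans (cvgB (cvgB (cvgM (c (1 - (a + b + 1))) (pow_incr_mul_cvgy0 ha hb))
  (cvgM (c a) (pow_incr_cross_cvgy0 ha hb))) (cvgM (c b) (pow_incr_cross_cvgy0 hb ha))).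
apply: near_eq_cvg; near=> x.
by rewrite /= pow_incr_primitiveE//; near: x; exact: nbhs_pinfty_gt.
Unshelve. all: by end_near. Qed.

End increments_limit.

Section sine_beta.
Context (R : realType).
Notation mu := (@lebesgue_measure R).
Notation Rp := (`]0%R, +oo[%classic : set R).
Notation Gam := (@euler_integral R).
Variables a b : R.

(** The Beta integral is Gamma(1 + b) Gamma(1 - a - b) / Gamma(2 - a). The reflection
formula turns a (1 - a) / Gamma(2 - a) = a / Gamma(1 - a) into
Gamma(1 + a) sin(pi a) / pi, which is why sines appear in the constant. *)
Lemma sin_beta_integral : `|a| < 1 / 2 -> `|b| < 1 / 2 ->
  mu.-integrable Rp (EFin \o (fun x => x `^ b * (1 + x) `^ (a - 2))) /\
  a * (1 - a) * \int[mu]_(x in `]0%R, +oo[) (x `^ b * (1 + x) `^ (a - 2)) =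
  Gam (1 - a - b) * Gam (1 + a) * Gam (1 + b) * sin (pi * a) / pi.
Proof.
move=> ha; have hs : `|a| < 1 by apply: lt_trans ha _; lra.
move: (ha); rewrite !ltr_norml => ha' hb'.
have [p0 q0] : 0 < 1 + b /\ 0 < 1 - a - b by split; lra.
have := beta_integral p0 q0.
have -> : 1 + b - 1 = b by ring.
have -> : - (1 + b + (1 - a - b)) = a - 2 by ring.
have -> : 1 + b + (1 - a - b) = (1 - a) + 1 by ring.
have a0 : 0 < 1 - a by lra.
move=> e; split.
  apply: (ge0_halfline_integrable _ _ e) => x x0; last by rewrite mulr_ge0 ?powR_ge0.
  apply: cvgM; first exact: continuous_powR.
  by apply: continuous_powR1D; lra.
rewrite /Rintegral e/= euler_integralS//.
have g0 := euler_integral_gt0 a0.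
have e2 : Gam (1 + a) * sin (pi * a) = pi * a / Gam (1 - a).
  by rewrite -[X in _ = X / _](euler_reflection_sin hs) [X in _ = X / _]mulrAC mulfK// gt_eqF.
move: (pi_gt0 R) g0 e2; move: (Gam (1 - a)) (Gam (1 - a - b)) (Gam (1 + b)) (Gam (1 + a)) (sin (pi * a)).
move: (pi : R) => p G1 G2 G3 G4 S p_gt0 g0 e2.
have -> : G2 * G4 * G3 * S / p = G2 * G3 * (G4 * S) / p by ring.
by rewrite e2; field; rewrite !gt_eqF.
Qed.

End sine_beta.

Section norming_integral.
Context (R : realType).
Notation mu := (@lebesgue_measure R).
Notation Rp := (`]0%R, +oo[%classic : set R).
Notation Gam := (@euler_integral R).
Variables a b : R.

Lemma continuous_pow_incr c x : 0 < x -> {for x, continuous (@pow_incr R c)}.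
Proof.
move=> x0; apply: cvgB; last exact: continuous_powR.
by apply: continuous_powR1D; lra.
Qed.

(** The added (a + b + 1)^-1 absorbs the boundary value -(a + b) of the primitive at 0.
The factor -(a + b) vanishes for a + b = 0, where the formula says nothing; see
critical_pow_incr_integral. *)
Lemma pow_incr_integral : `|a| < 1 / 2 -> `|b| < 1 / 2 ->
  mu.-integrable Rp (EFin \o (fun x => pow_incr a x * pow_incr b x)) ->
  (a + b + 1) * (- (a + b)) *
    (\int[mu]_(x in `]0%R, +oo[) (pow_incr a x * pow_incr b x) + (a + b + 1)^-1) =
  - (Gam (1 - a - b) * Gam (1 + a) * Gam (1 + b) * (sin (pi * a) + sin (pi * b)) / pi).
Proof.
move=> ha hb iPQ.
have s0 : a + b + 1 != 0.
  by move: ha hb; rewrite !ltr_norml => ? ?; rewrite gt_eqF//; lra.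
have [ia ea] := sin_beta_integral ha hb; have [ib eb] := sin_beta_integral hb ha.
have iPQ' := Rp_integrableZ ((a + b + 1) * (1 - (a + b + 1))) iPQ.
have ia' := Rp_integrableZ (a * (1 - a)) ia.
have ib' := Rp_integrableZ (b * (1 - b)) ib.
have iab := Rp_integrableD iPQ' ia'.
have := halfline_FTC (is_derive_pow_incr_primitive a b) _ (Rp_integrableD iab ib')
  (pow_incr_primitive_cvg0 ha hb) (pow_incr_primitive_cvgy ha hb).
rewrite RintegralD// RintegralD// !RintegralZl// ea eb => h; lapply h; last first.
  move=> x x0; have x1 : 0 < 1 + x by rewrite addr_gt0.
  have cP c : {for x, continuous (@pow_incr R c)} by exact: continuous_pow_incr.
  have cp c : {for x, continuous (fun y : R => y `^ c)} by exact: continuous_powR.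
  have cq c : {for x, continuous (fun y : R => (1 + y) `^ c)} by exact: continuous_powR1D.
  have cc (k : R) : {for x, continuous (fun _ : R => k)} by exact: cvg_cst.
  exact: (cvgD (cvgD (cvgM (cc _) (cvgM (cP a) (cP b)))
    (cvgM (cc _) (cvgM (cp b) (cq (a - 2))))) (cvgM (cc _) (cvgM (cp a) (cq (b - 2))))).
have -> : 1 - b - a = 1 - a - b by ring.
clear h ea eb; move: s0; move: (sin (pi * a)) (sin (pi * b)) => S S'.
move: (pi : R) (\int[mu]_(x in _) _) (Gam (1 - a - b)) (Gam (1 + b)) (Gam (1 + a)).
move=> p I G1 G2 G3 s0 h.
have -> : (a + b + 1) * - (a + b) * (I + (a + b + 1)^-1) =
  (a + b + 1) * - (a + b) * I - (a + b) by field.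
apply/eqP; rewrite -subr_eq0 -(subrr (- - (a + b))) -[X in X - - - _]add0r -h.
apply/eqP; ring.
Qed.

End norming_integral.

Section critical_integral.
Context (R : realType).
Notation mu := (@lebesgue_measure R).
Notation Rp := (`]0%R, +oo[%classic : set R).
Variable a : R.
Hypothesis a01 : 0 < a < 1.

Let psi (t : R) := (expR (- ((1 - a) * t)) - expR (- ((1 + a) * t))) / (1 - expR (- t)).

(** psi differs from the integrand of cot_int (1 - a) by exp(-a t). *)
Let psi_integral : mu.-integrable Rp (EFin \o psi) /\
  \int[mu]_(t in `]0%R, +oo[) psi t = a^-1 - cot_pi a.
Proof.
have [a0 a1] : 0 < a /\ 0 < 1 - a by case/andP: a01 => ? ?; rewrite subr_gt0.
have [i _] := psi_integrable0 a1 a0; have [ie ee] := exp_integrable a0.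
have E t : t \in Rp -> psi t =
    (expR (- ((1 - a) * t)) - expR (- (a * t))) / (1 - expR (- t)) + expR (- (a * t)).
  rewrite inE/= in_itv/= andbT => t0.
  have d0 : 0 < 1 - expR (- t) by rewrite subr_gt0 expR_lt1; lra.
  rewrite /psi.
  have -> : expR (- ((1 + a) * t)) = expR (- t) * expR (- (a * t)).
    by rewrite -expRD; congr expR; ring.
  by field; rewrite gt_eqF.
have iD := Rp_integrableD i ie.
split.
  apply: (@eq_integrable _ _ R mu _ (measurable_itv _) _ _ _ iD).
  by move=> t tI; rewrite /= (E t tI).
transitivity (cot_int (1 - a) + a^-1).
  transitivity (\int[mu]_(t in `]0%R, +oo[)
    ((expR (- ((1 - a) * t)) - expR (- (a * t))) / (1 - expR (- t)) + expR (- (a * t)))).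
    exact: eq_Rintegral.
  have -> : cot_int (1 - a) = \int[mu]_(t in `]0%R, +oo[)
      ((expR (- ((1 - a) * t)) - expR (- (a * t))) / (1 - expR (- t))).
    by rewrite /cot_int; have -> : 1 - (1 - a) = a by rewrite opprB addrCA subrr addr0.
  by rewrite (RintegralD _ i ie)// ee.
rewrite cot_intE; last by rewrite a1/= ltrBlDr ltrDl.
rewrite /cot_pi mulrBr mulr1 sinB cosB sinpi cospi !mul0r !mulN1r sub0r opprK addr0.
by rewrite addrC mulrN mulNr.
Qed.

Let G (y : R) := (expR (- (a * y)) - expR (a * y)) * (expR y / (1 - expR y)).
Let phi (x : R) : R := ln (x / (1 + x)).
Let phi' (x : R) : R := (x * (1 + x))^-1.
Let J : set R := `]-oo, 0[%classic.

Let ratio (x : R) : 0 < x -> 0 < x / (1 + x) < 1.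
Proof. by move=> x0; rewrite divr_gt0 ?ltr_pdivrMr ?mul1r ?ltrDr//; lra. Qed.

Let dphi (x : R) : 0 < x -> is_derive x 1 phi (phi' x).
Proof.
move=> x0; have /andP[r0 _] := ratio x0.
have x1 : 0 < 1 + x by lra.
have d1 : is_derive x 1 (fun y : R => 1 + y) (0 + 1).
  exact: (is_derive_add (is_derive_cst _ _ _) (is_derive_id x (1 : R))).
have d2 := is_derive_inv (lt0r_neq0 x1) d1.
apply: (is_derive_eq (is_derive_comp (is_derive_mul (is_derive_id x (1 : R)) d2)
  (is_derive1_ln r0))).
by rewrite /phi'; field; rewrite !gt_eqF.
Qed.

Let phi_incr (x y : R) : 0 < x -> x < y -> phi x < phi y.
Proof.
move=> x0 xy; have y0 := lt_trans x0 xy.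
rewrite /phi ltr_ln ?posrE; [|by case/andP: (ratio x0)|by case/andP: (ratio y0)].
rewrite ltr_pdivrMr ?addr_gt0// mulrAC ltr_pdivlMr ?addr_gt0//; nra.
Qed.

(** Substituting exp(-t) = x / (1 + x) gives the integral of psi. It is done in two steps,
because the substitution rule is stated for increasing functions. *)
Lemma log_ratio_integral :
  (\int[mu]_(x in `]0%R, +oo[)
     (((x / (1 + x)) `^ (- a) - (x / (1 + x)) `^ a) / (1 + x))%:E =
   (a^-1 - cot_pi a)%:E)%E.
Proof.
have cG (y : R) : y < 0 -> {for y, continuous G}.
  move=> y0; apply: cvgM.
    apply: cvgB; [exact: is_derive_continuous (is_derive_expRNM a y)
                 |exact: is_derive_continuous (is_derive_expRM a y)].
  apply: cvgM; first exact: continuous_expR.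
  apply: cvgV; first by rewrite gt_eqF// subr_gt0 expR_lt1.
  by apply: cvgB; [exact: cvg_cst|exact: continuous_expR].
have G0 (y : R) : y < 0 -> 0 <= G y.
  move=> y0; rewrite mulr_ge0 ?divr_ge0 ?expR_ge0 ?subr_ge0//.
    by case/andP: a01 => a0 _; rewrite ler_expR; nra.
  by rewrite ltW// expR_lt1.
have JE : J = \bigcup_n `[phi n.+1%:R^-1, phi n.+2%:R]%classic.
  apply/seteqP; split => y; rewrite /J /= ?in_itv/=.
    move=> y0; have e1 : 0 < 1 - expR y by rewrite subr_gt0 expR_lt1.
    have x0 : Rp (expR y / (1 - expR y)) by rewrite /= in_itv/= andbT divr_gt0 ?expR_gt0.
    have py : phi (expR y / (1 - expR y)) = y.
      rewrite /phi -[RHS]expRK; congr ln; field.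
      by rewrite subrK oner_neq0 gt_eqF.
    have := x0; rewrite halfline_bigcup => -[n _] /=; rewrite in_itv/= => /andP[h1 h2].
    exists n => //=; rewrite in_itv/= -py; apply/andP; split.
      move: h1; rewrite le_eqVlt => /predU1P[->//|h1]; apply/ltW/phi_incr => //.
    move: h2; rewrite le_eqVlt => /predU1P[->//|h2]; apply/ltW/phi_incr => //.
    by move: x0; rewrite /= in_itv/= andbT.
  move=> [n _]/=; rewrite in_itv/= => /andP[_ h]; apply: le_lt_trans h _.
  by rewrite ln_lt0// ratio ?ltr0n.
have := @ge0_improper_substitution R _ _ _ (@halfline_itv_lt R)
  (@halfline_itv_nondecreasing R) (@halfline_bigcup R) phi phi' G J JE.
have pos x : Rp x -> 0 < x by rewrite /= in_itv/= andbT.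
have neg y : J y -> y < 0 by rewrite /J /= in_itv.
move=> /(_ (fun x h => dphi (pos x h))) S.
have {}S := S _ _ (fun x y hx _ => @phi_incr x y (pos x hx)) (fun y h => cG y (neg y h))
  (fun y h => G0 y (neg y h)).
have sub : (\int[mu]_(y in J) (G y)%:E = \int[mu]_(x in Rp) (G (phi x) * phi' x)%:E)%E.
  apply: S => x /pos x0; last by rewrite /phi' invr_ge0 mulr_ge0//; lra.
  apply: cvgV; first by rewrite mulf_neq0 ?gt_eqF//; lra.
  by apply: cvgM; [exact: cvg_id|apply: cvgD; [exact: cvg_cst|exact: cvg_id]].
have [ip ep] := psi_integral.
have refl : (\int[mu]_(y in J) (G y)%:E = \int[mu]_(t in Rp) (psi t)%:E)%E.
  rewrite integral_mkcond ge0_integral_halflines; last 2 first.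
  - apply/(measurable_restrictT (EFin \o G)); first exact: measurable_itv.
    apply/measurable_EFinP.
    apply: open_continuous_measurable_fun => // y; rewrite inE => yJ.
    exact/cG/neg.
  - by move=> y; rewrite patchE; case: ifPn => // /set_mem/neg/G0; rewrite lee_fin.
  rewrite [X in (X + _)%E]integral0_eq ?add0e; last first.
    move=> y /pos y0; rewrite patchE; case: ifPn => // /set_mem/neg yn.
    by have := lt_trans y0 yn; rewrite ltxx.
  apply: eq_integral => t /set_mem/pos t0; rewrite patchE ifT; last first.
    by apply/mem_set; rewrite /J /= in_itv/= oppr_lt0.
  congr EFin; rewrite /G /psi mulrA mulrBl -!expRD.
  by congr ((expR _ - expR _) / _); ring.
rewrite -ep /Rintegral fineK; last exact: integrable_fin_num ip.
rewrite -refl sub.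
apply: eq_integral => x /set_mem/pos x0; congr EFin.
have /andP[r0 _] := ratio x0.
rewrite /G /phi' lnK ?posrE// -mulNr /phi.
have pE e : expR (e * ln (x / (1 + x))) = (x / (1 + x)) `^ e by rewrite /powR gt_eqF.
rewrite !pE; move: (_ `^ _) (_ `^ _) => A B.
have x1 : 0 < 1 + x by lra.
by field; rewrite addrK oner_neq0 !gt_eqF.
Qed.

End critical_integral.

Section critical_increments.
Context (R : realType).
Notation mu := (@lebesgue_measure R).
Notation Rp := (`]0%R, +oo[%classic : set R).
Notation Gam := (@euler_integral R).
Implicit Types (a b x : R).

Lemma pow_incr_mul_cvg0 a b : `|a| < 1 / 2 -> `|b| < 1 / 2 ->
  x * (pow_incr a x * pow_incr b x) @[x --> 0^'+] --> (0 : R).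
Proof.
rewrite !ltr_norml => ha hb.
have e0 : 0 * (1 * 1) - 0 * 1 - 0 * 1 + 0 = 0 :> R by ring.
rewrite -[X in _ --> X]e0.
have q e : (1 + x) `^ e @[x --> 0^'+] --> (1 : R) by exact: cvg0_powR1D.
have p e : 0 < e -> x `^ e @[x --> 0^'+] --> (0 : R) by exact: powR_cvg0.
have i : x @[x --> 0^'+] --> (0 : R) by apply: cvg_at_right_filter.
have [pa pb pc] : [/\ 0 < a + 1, 0 < b + 1 & 0 < a + b + 1] by split; lra.
apply: cvg_trans (cvgD (cvgB (cvgB (cvgM i (cvgM (q a) (q b)))
  (cvgM (p _ pb) (q a))) (cvgM (p _ pa) (q b))) (p _ pc)).
apply: near_eq_cvg; near=> x; have x0 : 0 < x by near: x; exact: nbhs_right_gt.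
transitivity (x * ((1 + x) `^ a * (1 + x) `^ b) - x `^ (b + 1) * (1 + x) `^ a
  - x `^ (a + 1) * (1 + x) `^ b + x `^ (a + b + 1)); first by [].
rewrite /pow_incr !powR_addn1// (@powRD _ x a b) ?(gt_eqF x0) ?implybT//.
ring.
Unshelve. all: by end_near. Qed.

(** For b = -a the derivative of x P Q is P Q plus a times the integrand of
log_ratio_integral, so the integral of P Q is a pi cot(pi a) - 1; the reflection
formula gives the right-hand side. The latter is even in a, which reduces to a >= 0. *)
Lemma critical_pow_incr_integral a : `|a| < 1 / 2 ->
  mu.-integrable Rp (EFin \o (fun x => pow_incr a x * pow_incr (- a) x)) ->
  \int[mu]_(x in `]0%R, +oo[) (pow_incr a x * pow_incr (- a) x) + 1 =
  Gam (1 + a) * Gam (1 - a) * cos (pi * a).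
Proof.
wlog a0 : a / 0 <= a => [hw ha i|].
  have [a0|a0] := leP 0 a; first exact: hw.
  have sw x : pow_incr a x * pow_incr (- a) x = pow_incr (- a) x * pow_incr (- - a) x.
    by rewrite opprK mulrC.
  under eq_Rintegral do rewrite sw.
  rewrite hw ?normrN ?oppr_ge0 ?(ltW a0)//.
    by rewrite mulrN cosN opprK [Gam (1 - a) * Gam (1 + a)]mulrC.
  by apply: eq_integrable i => // x _; rewrite /= sw.
move: a0; rewrite le_eqVlt => /predU1P[<- _ _|a0 ha i].
  rewrite mulr0 cos0 subr0 addr0 euler_integral1 !mulr1.
  have z x : pow_incr 0 x * pow_incr (- 0) x = 0.
    by rewrite oppr0 /pow_incr !powRr0 subrr mul0r.
  under eq_Rintegral do rewrite z.
  by rewrite /Rintegral integral0 add0r.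
have a1 : a < 1 / 2 by move: ha; rewrite ltr_norml => /andP[].
have a01 : 0 < a < 1 by lra.
have e := log_ratio_integral a01.
pose h x : R := ((x / (1 + x)) `^ (- a) - (x / (1 + x)) `^ a) / (1 + x).
have rE c (x : R) : 0 < x -> (x / (1 + x)) `^ c = x `^ c / (1 + x) `^ c.
  move=> x0; have x1 : 0 < 1 + x by lra.
  apply: (canRL (mulfK _)); first by rewrite gt_eqF ?powR_gt0.
  by rewrite -powRM ?divr_ge0 ?(ltW x0) ?(ltW x1)// divfK// gt_eqF.
have hE (x : R) : 0 < x -> h x =
    ((1 + x) `^ a / x `^ a - x `^ a / (1 + x) `^ a) / (1 + x).
  by move=> x0; rewrite /h !rE// !powRN invrK [(x `^ a)^-1 * _]mulrC.
have ch (x : R) : 0 < x -> {for x, continuous h}.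
  move=> x0; have x1 : 0 < 1 + x by lra.
  have cr : {for x, continuous (fun y : R => y / (1 + y))}.
    apply: cvgM; first exact: cvg_id.
    by apply: cvgV; [rewrite gt_eqF|apply: cvgD; [exact: cvg_cst|exact: cvg_id]].
  have cp c : {for x, continuous (fun y : R => (y / (1 + y)) `^ c)}.
    exact: (@continuous_comp _ _ _ (fun y : R => y / (1 + y)) (fun z : R => z `^ c) x cr
      (continuous_powR (divr_gt0 x0 x1))).
  apply: cvgM; first by apply: cvgB; exact: cp.
  by apply: cvgV; [rewrite gt_eqF|apply: cvgD; [exact: cvg_cst|exact: cvg_id]].
have ih : mu.-integrable Rp (EFin \o h).
  apply: (ge0_halfline_integrable ch _ e) => x x0.
  have x1 : 0 < 1 + x by lra.
  have X0 := powR_gt0 a x0; have X1 := powR_gt0 a x1.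
  have XY : x `^ a <= (1 + x) `^ a.
    by apply: ge0_ler_powR; rewrite ?nnegrE ?lerDr//; lra.
  rewrite hE// divr_ge0 ?(ltW x1)// subr_ge0 (@le_trans _ _ 1)//.
    by rewrite ler_pdivrMr// mul1r.
  by rewrite ler_pdivlMr// mul1r.
have iah := Rp_integrableZ a ih.
have d (x : R) : 0 < x -> is_derive x 1 (fun x => x * (pow_incr a x * pow_incr (- a) x))
    (pow_incr a x * pow_incr (- a) x + a * h x).
  move=> x0; have x1 : 0 < 1 + x by lra.
  have i1 : is_derive x 1 (fun y : R => y) (1 : R) by exact: is_derive_id.
  have p c := is_derive1_powR c x0; have q c := is_derive_powR1D c x1.
  apply: (is_derive_eq (is_derive_mul i1 (is_derive_mul
    (is_derive_add (q a) (is_derive_opp (p a)))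
    (is_derive_add (q (- a)) (is_derive_opp (p (- a))))))).
  rewrite hE// /pow_incr !powR_mulV// !powRN.
  have X0 := powR_gt0 a x0; have X1 := powR_gt0 a x1.
  move: (x `^ a) ((1 + x) `^ a) X0 X1 => X Y X0 X1.
  by field; rewrite !gt_eqF.
have eh : \int[mu]_(x in `]0%R, +oo[) h x = a^-1 - cot_pi a by rewrite /Rintegral e.
have ha' : `|- a| < 1 / 2 by rewrite normrN.
have := halfline_FTC d _ (Rp_integrableD i iah)
  (pow_incr_mul_cvg0 ha ha') (pow_incr_mul_cvgy0 ha ha').
rewrite RintegralD// RintegralZl// eh => E; lapply E; last first.
  move=> x x0; apply: cvgD; last by apply: cvgM; [exact: cvg_cst|exact: ch].
  by apply: cvgM; exact: continuous_pow_incr.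
clear E => E.
have s0 := sin_pi_gt0 a01.
have r : Gam (1 + a) * Gam (1 - a) * sin (pi * a) = pi * a.
  by apply: euler_reflection_sin; apply: lt_trans ha _; rewrite ltr_pdivrMr// mul1r ltr1n.
have -> : Gam (1 + a) * Gam (1 - a) * cos (pi * a) = a * cot_pi a.
  rewrite /cot_pi; move: r s0.
  move: (sin (pi * a)) (cos (pi * a)) (Gam (1 + a)) (Gam (1 - a)) => S C G1 G2.
  move: (pi : R) => p r s0.
  have -> : a * (p * C / S) = p * a * C / S by ring.
  by rewrite -r; field; rewrite gt_eqF.
move: E; rewrite mulrBr mulfV ?gt_eqF//; move: (\int[mu]_(x in _) _) (a * cot_pi a).
by move=> I c; lra.
Qed.

End critical_increments.

(** * The norming constant *)

Section norming_constant.
Context (R : realType).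
Notation mu := (@lebesgue_measure R).
Notation Rp := (`]0%R, +oo[%classic : set R).
Notation Gam := (@euler_integral R).
Implicit Types (H K s : R).

(** The product in the definition of Gamma has one factor on ]-1, 0[ and two on ]-2, -1[;
the functional equation brings the first case to the form of the second. *)
Lemma Gamma_opp s : 0 < s < 2 -> s != 1 ->
  Gamma (- s) = Gam (2 - s) / (- s * (1 - s)).
Proof.
move=> /andP[s0 s2] s1; rewrite /Gamma oppr_gt0 ltNge (ltW s0)/= opprK.
have [h|h] := ltP s 1.
  have -> : Num.truncn s = 0%N by apply/eqP; rewrite truncn_eq ?(ltW s0)//= ltW.
  rewrite big_ord1 addr0 addrC.
  have e : 2 - s = (1 - s) + 1 by ring.
  rewrite e euler_integralS ?subr_gt0//; move: (Gam (1 - s)) => G.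
  by field; rewrite !gt_eqF ?subr_gt0.
have -> : Num.truncn s = 1%N by apply/eqP; rewrite truncn_eq ?(ltW s0)//= h.
by rewrite big_ord_recl big_ord1 /= addr0 addrC [- s + 1]addrC.
Qed.

Let fac H := Num.sqrt (Gamma (2 * H + 1) * sin (pi * H)).

Let arg_gt0 H : 0 < H < 1 -> 0 < Gamma (2 * H + 1) * sin (pi * H).
Proof.
move=> h; have h' : 0 < 2 * H + 1 by lra.
by rewrite mulr_gt0 ?sin_pi_gt0// Gamma_euler// euler_integral_gt0.
Qed.

Let sqrt_split (A B S : R) : 0 <= A -> 0 <= B -> 0 <= S ->
  Num.sqrt (A * B) * S ^+ 2 = Num.sqrt (A * S) * Num.sqrt (B * S) * S.
Proof.
move=> A0 B0 S0; have e := sqr_sqrtr S0.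
rewrite !sqrtrM//; move: (Num.sqrt A) (Num.sqrt B) (Num.sqrt S) e => a b s e.
transitivity (a * b * s ^+ 2 * S); first by rewrite e; ring.
ring.
Qed.

Lemma cH_gt0 H : 0 < H < 1 -> 0 < cH H.
Proof.
move=> h; have h' : 0 < H + 2^-1 by lra.
by rewrite divr_gt0 ?sqrtr_gt0 ?arg_gt0// Gamma_euler// euler_integral_gt0.
Qed.

(** The left-hand side is D(1), see kernel_cov1. The sum of sines in pow_incr_integral
becomes the product of cosines by prosthaphaeresis. *)
Lemma norming_constant H K : 0 < H < 1 -> 0 < K < 1 ->
  mu.-integrable Rp (EFin \o (fun x => pow_incr (H - 2^-1) x * pow_incr (K - 2^-1) x)) ->
  \int[mu]_(x in `]0%R, +oo[) (pow_incr (H - 2^-1) x * pow_incr (K - 2^-1) x) + (H + K)^-1 =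
  cH H * cH K * aHH H K.
Proof.
move=> hH hK i.
have [ha hb] : `|H - 2^-1| < 1 / 2 /\ `|K - 2^-1| < 1 / 2.
  by rewrite !ltr_norml; split; lra.
have [g1 g2] : 0 < H + 2^-1 /\ 0 < K + 2^-1 by split; lra.
have f1 : fac H != 0 by rewrite gt_eqF// sqrtr_gt0 arg_gt0.
have f2 : fac K != 0 by rewrite gt_eqF// sqrtr_gt0 arg_gt0.
have EH c : 1 + (c - 2^-1) = c + 2^-1 :> R by field.
rewrite /aHH /cH; case: ifPn => [/eqP s1|s1].
  have eK : K = 1 - H by lra.
  have eK' : K - 2^-1 = - (H - 2^-1) by lra.
  move: i; rewrite s1 invr1 eK' => i; rewrite critical_pow_incr_integral//.
  have -> : 1 - (H - 2^-1) = K + 2^-1 by lra.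
  rewrite EH -/(fac H) -/(fac K) (Gamma_euler g1) (Gamma_euler g2).
  have -> : pi * (H - 2^-1) = pi * H - pi / 2 by rewrite mulrBr.
  rewrite cosBpihalf.
  have -> : Num.sqrt (Gamma (2 * H + 1) * Gamma (3 - 2 * H)) * sin (pi * H) ^+ 2 =
     fac H * fac K * sin (pi * H).
    have sK : sin (pi * K) = sin (pi * H).
      by rewrite eK mulrBr mulr1 sinB sinpi cospi mul0r mulN1r opprK add0r.
    have e3 : 2 * K + 1 = 3 - 2 * H by lra.
    have h3 : 0 <= sin (pi * H) by apply/ltW/sin_pi_gt0.
    rewrite /fac sK e3; apply: sqrt_split => //.
      by rewrite Gamma_euler ?ltW ?euler_integral_gt0//; lra.
    by rewrite Gamma_euler ?ltW ?euler_integral_gt0//; lra.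
  move: f1 f2; move: (fac H) (fac K) (sin _) (Gam _) (Gam _) => F1 F2 S G1 G2 f1 f2.
  by field; rewrite f1 f2.
have := pow_incr_integral ha hb i.
have es : H - 2^-1 + (K - 2^-1) + 1 = H + K by field.
have e1 : - (H - 2^-1 + (K - 2^-1)) = 1 - (H + K) by field.
have e2 : 1 - (H - 2^-1) - (K - 2^-1) = 2 - (H + K) by field.
rewrite es e1 e2 !EH -/(fac H) -/(fac K) (Gamma_euler g1) (Gamma_euler g2).
rewrite Gamma_opp//; last lra.
have -> : sin (pi * (H - 2^-1)) + sin (pi * (K - 2^-1)) =
    - (2 * (cos ((K - H) * (pi / 2)) * cos ((H + K) * (pi / 2)))).
  rewrite !mulrBr !sinBpihalf.
  have -> : pi * H = (H + K) * (pi / 2) - (K - H) * (pi / 2) by field.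
  have -> : pi * K = (H + K) * (pi / 2) + (K - H) * (pi / 2) by field.
  by rewrite cosB cosD; ring.
have s0 : 0 < H + K by lra.
have s1' : 1 - (H + K) != 0 by rewrite subr_eq0 eq_sym.
move: (cos _) (cos _) => C1 C2; move: f1 f2 s1' s0 (pi_gt0 R).
move: (\int[mu]_(x in _) _) (fac H) (fac K) (Gam (2 - (H + K))) (Gam (H + 2^-1)) (Gam (K + 2^-1)) (pi : R).
move=> I F1 F2 G0 G1 G2 p f1 f2; move: (H + K) => s s1' s0 p0 E.
apply: (@mulfI _ (s * (1 - s))); first by rewrite mulf_neq0// gt_eqF.
by rewrite E; field; rewrite f1 f2 s1' !gt_eqF.
Qed.

End norming_constant.

(** * Time reversal of stationary increments *)

Section stationary_increments.
Context (R : realType).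
Variable G : R -> R -> R.
Hypothesis stat : forall t s u, G (t - u) (s - u) = G t s - G t u - G u s + G u u.

Let G0l s : G 0 s = 0.
Proof. by have := stat 0 s 0; rewrite !subr0 => ->; ring. Qed.

Let G0r t : G t 0 = 0.
Proof. by have := stat t 0 0; rewrite !subr0 => ->; ring. Qed.

Lemma stationary_diag u : G (- u) (- u) = G u u.
Proof. by have := stat 0 0 u; rewrite !sub0r !G0l G0r !subr0 add0r. Qed.

Let A t s := G t s - G (- s) (- t).

Let Adiag u : A u u = 0. Proof. by rewrite /A stationary_diag subrr. Qed.

Let A0r t : A t 0 = 0. Proof. by rewrite /A G0r oppr0 G0l subrr. Qed.

Let A0l t : A 0 t = 0. Proof. by rewrite /A G0l oppr0 G0r subrr. Qed.

Let Ashift t s u : A (t - u) (s - u) = A t s - A t u - A u s.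
Proof.
rewrite /A stat !opprB.
have := stat (- s) (- t) (- u); rewrite !opprK [- s + u]addrC [- t + u]addrC => ->.
by rewrite stationary_diag; ring.
Qed.

Let Aanti t s : A s t = - A t s.
Proof.
have := Ashift t t s; rewrite !Adiag sub0r.
by move=> /esym/eqP; rewrite subr_eq0 => /eqP <-.
Qed.

Let Aneg t s : A (- t) (- s) = A t s.
Proof. by rewrite [RHS]Aanti /A !opprK opprB. Qed.

(** The evenness Aneg turns the shift rule with s = 0 into an antisymmetry under
t |-> u - t. *)
Let Aflip t u : A u (u - t) = - A u t.
Proof.
have := Ashift t 0 u; rewrite !A0r sub0r subr0 => h.
by rewrite Aanti -(Aneg (u - t)) (opprB u t) h sub0r opprK Aanti.
Qed.

(** In units of tau, the shift rule gives A (k + 1) k = A (k + 1) 1, while Aflip gives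
A (k + 1) k = - A (k + 1) 1. So both vanish, hence A (m + 1) (n + 1) = A m n, which
leads down to a zero argument. *)
Let Acommensurable tau (m n : nat) : A (m%:R * tau) (n%:R * tau) = 0.
Proof.
have S k : k.+1%:R * tau - tau = k%:R * tau by rewrite mulrS mulrDl mul1r addrAC subrr add0r.
have q k : A (k.+1%:R * tau) (k%:R * tau) = A (k.+1%:R * tau) tau.
  elim: k => [|k ih]; first by rewrite mul0r mul1r A0r Adiag.
  have := Ashift (k.+2%:R * tau) (k.+1%:R * tau) tau.
  rewrite !S ih (Aanti _ tau) opprK -[X in X = _]add0r => /(canRL (addrK _)).
  by rewrite -addrA subrr addr0 => /esym/eqP; rewrite subr_eq0 => /eqP.
have r k : A (k%:R * tau) tau = 0.
  case: k => [|k]; first by rewrite mul0r A0l.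
  have := Aflip tau (k.+1%:R * tau); rewrite S q => /eqP.
  by rewrite -addr_eq0 -mulr2n mulrn_eq0/= => /eqP.
elim: m n => [|m ih] [|n]; rewrite ?mul0r ?A0l ?A0r//.
have := Ashift (m.+1%:R * tau) (n.+1%:R * tau) tau.
by rewrite !S ih r (Aanti _ tau) r !oppr0 !addr0 => <-.
Qed.

Variables (H K : R) (C : R -> R).
Hypotheses (H0 : 0 < H) (K0 : 0 < K).
Hypothesis contl : forall t t' s, `|G t s - G t' s| <= C s * `|t - t'| `^ H.
Hypothesis contr : forall t s s', `|G t s - G t s'| <= C t * `|s - s'| `^ K.

Let cvg_div (s e c : R) : 0 < s -> 0 < e ->
  c * (s / n.+1%:R) `^ e @[n --> \oo] --> (0 : R).
Proof.
move=> s0 e0; rewrite -[X in _ --> X](mulr0 c); apply: cvgM; first exact: cvg_cst.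
rewrite (_ : (fun n => _) = (fun n : nat => s `^ e * n.+1%:R `^ (- e))); last first.
  apply/funext => n; rewrite powRN; apply: (canRL (mulfK _)).
    by rewrite gt_eqF// powR_gt0.
  by rewrite -powRM ?divr_ge0 ?(ltW s0)// divfK// pnatr_eq0.
rewrite -[X in _ --> X](mulr0 (s `^ e)); apply: cvgM; first exact: cvg_cst.
have n1y : (n.+1%:R : R) @[n --> \oo] --> +oo.
  rewrite (cvg_shiftS (fun n => n%:R : R)); exact: cvgr_idn.
by apply: (cvg_comp _ _ n1y (@powR_cvgy0 R (- e) _)); rewrite oppr_lt0.
Qed.

(** Approximate t by a multiple of s / (n + 1), of which s is a multiple too. *)
Let Apos t s : 0 <= t -> 0 <= s -> A t s = 0.
Proof.
move=> t0; rewrite le_eqVlt => /predU1P[<-|s0]; first exact: A0r.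
apply/eqP; rewrite -normr_le0.
have l : C s * (s / n.+1%:R) `^ H + C (- s) * (s / n.+1%:R) `^ K @[n --> \oo] --> (0 : R).
  by rewrite -[X in _ --> X](addr0 0); apply: cvgD; exact: cvg_div.
apply: (cvgr_to_ge l); apply: nearW => n.
pose tau := s / n.+1%:R; pose m := Num.truncn (t / tau).
have tau0 : 0 < tau by rewrite divr_gt0.
have := Acommensurable tau m n.+1.
have -> : n.+1%:R * tau = s by rewrite mulrC divfK// pnatr_eq0.
set t' := _ * tau => At'.
have tt' : `|t - t'| <= tau.
  have /andP[h1 h2] : m%:R <= t / tau < m.+1%:R by apply: truncn_itv; rewrite divr_ge0// ltW.
  rewrite ger0_norm; last by rewrite subr_ge0 -ler_pdivlMr.
  by move: (ltW h2); rewrite lerBlDr ler_pdivrMr// mulrS mulrDl mul1r.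
have C0 u : 0 <= C u.
  have := contl (t - 1) t u; have -> : t - 1 - t = -1 by ring.
  by rewrite normrN1 powR1 mulr1; exact: le_trans.
rewrite -[A t s]subr0 -At'.
have -> : A t s - A t' s = (G t s - G t' s) - (G (- s) (- t) - G (- s) (- t')).
  by rewrite /A; ring.
apply: le_trans (ler_normB _ _) _; apply: lerD.
  apply: le_trans (contl _ _ _) _; apply: ler_wpM2l => //.
  by apply: ge0_ler_powR; rewrite ?nnegrE// ltW.
apply: le_trans (contr _ _ _) _; apply: ler_wpM2l => //.
have -> : - t - - t' = - (t - t') by ring.
by rewrite normrN; apply: ge0_ler_powR; rewrite ?nnegrE// ltW.
Qed.

(** Only stationarity and some continuity are used. Continuity cannot be dropped:
stationarity alone allows for a nonzero alternating form that is bilinear over the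
rationals. *)
Lemma stationary_reversal t s : G (- s) (- t) = G t s.
Proof.
suff : A t s = 0 by rewrite /A => /eqP; rewrite subr_eq0 => /eqP.
have mixed u v : 0 <= u -> 0 <= v -> A u (- v) = 0.
  move=> u0 v0; have := Ashift (u + v) 0 v.
  rewrite addrK sub0r => ->; rewrite A0r (Aanti 0) A0l oppr0 subr0 sub0r Apos ?oppr0//.
  by rewrite addr_ge0.
have [t0|t0] := leP 0 t; have [s0|s0] := leP 0 s.
- exact: Apos.
- by rewrite -(opprK s) mixed// oppr_ge0 ltW.
- by rewrite Aanti -(opprK t) mixed ?oppr0// oppr_ge0 ltW.
- by rewrite -Aneg Apos// oppr_ge0 ltW.
Qed.

Lemma stationary_cov t s :
  G t s + G (- t) (- s) = G t t + G s s - G (t - s) (t - s).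
Proof.
rewrite [G (- t) _]stationary_reversal stat.
ring.
Qed.

End stationary_increments.

(** * Scalar products of the kernels *)

Section halflines.
Context (R : realType).
Notation mu := (@lebesgue_measure R).

Lemma Rintegral_halflines (f : R -> R) : mu.-integrable setT (EFin \o f) ->
  \int[mu]_x f x = \int[mu]_(x in `]0%R, +oo[) f x + \int[mu]_(x in `]0%R, +oo[) f (- x).
Proof.
move=> fi.
have E : [set: R] = `]-oo, 0]%classic `|` `]0, +oo[%classic.
  apply/seteqP; split => // x _ /=; rewrite !in_itv/= andbT.
  by apply/orP; rewrite leNgt orNb.
have fin : mu.-integrable (`]-oo, 0]%classic : set R) (EFin \o f).
  by apply: integrableS fi.
rewrite [in LHS]E Rintegral_setU//; last 2 first.
- by rewrite -E.
- apply/disj_setPS => x [] /=; rewrite !in_itv/= andbT => h1 h2.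
  by move: h1; rewrite leNgt h2.
rewrite addrC; congr (_ + _); rewrite Rintegral_mkcond.
have fi0 : mu.-integrable setT (EFin \o (f \_ (`]-oo, 0]%classic : set R))).
  rewrite -restrict_EFin.
  have := @integrable_mkcond _ _ _ mu (`]-oo, 0]%classic : set R) (EFin \o f).
  by move=> /(_ (measurable_itv _))[h _]; exact: h.
have N1 : (-1 : R) != 0 by rewrite oppr_eq0 oner_eq0.
rewrite (Rintegral_affine 0 N1 fi0) normrN1 mul1r.
have fN := integrable_affine 0 N1 fi.
have fN' : mu.-integrable setT (EFin \o (fun x => f (- x))).
  by apply: eq_integrable fN => // x _; rewrite /= mulN1r addr0.
rewrite Rintegral_itv_obnd_cbnd; last exact: integrableS fN'.
rewrite [RHS]Rintegral_mkcond; apply: eq_Rintegral => x _.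
rewrite !patchE addr0 mulN1r.
have -> // : (- x \in (`]-oo, 0]%classic : set R)) = (x \in (`[0, +oo[%classic : set R)).
by apply/idP/idP; rewrite !inE/= !in_itv/= andbT oppr_le0.
Qed.

Lemma power_integral01 (s : R) : 0 < s ->
  (\int[mu]_(x in `[0%R, 1%R[) ((1 - x) `^ (s - 1))%:E = (s^-1)%:E)%E.
Proof.
move=> s0.
have ab (n : nat) : 0 < 1 - n.+2%:R^-1 :> R by rewrite subr_gt0 invf_lt1 ?ltr0n// ltr1n.
have nd : nondecreasing_seq (fun n => `[0, 1 - n.+2%:R^-1]%classic : set R).
  move=> n m nm; rewrite subsetEset => x /=; rewrite !in_itv/= => /andP[-> h]/=.
  by rewrite (le_trans h)// lerB// lef_pV2 ?posrE ?ltr0n// ler_nat.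
have IE : `[0, 1[%classic = \bigcup_n `[0, 1 - n.+2%:R^-1]%classic :> set R.
  apply/seteqP; split => x /=; rewrite in_itv/=.
    move=> /andP[x0 x1]; exists (Num.truncn (1 - x)^-1) => //=.
    rewrite in_itv/= x0/= lerBrDr -lerBrDl -[leRHS]invrK lef_pV2 ?posrE ?invr_gt0 ?subr_gt0 ?ltr0n//.
    by apply/ltW/(lt_le_trans (truncnS_gt _)); rewrite ler_nat.
  move=> [n _]/=; rewrite in_itv/= => /andP[-> h]/=; apply: le_lt_trans h _.
  by rewrite gtrBl invr_gt0 ltr0n.
have -> : s^-1 = 0 - - s^-1 by rewrite sub0r opprK.
pose F (x : R) : R := - (s^-1 * (1 - x) `^ s).
apply: (@ge0_improper_FTC R _ _ _ ab nd IE F (fun x => (1 - x) `^ (s - 1))) => [x|x|x||].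
- rewrite /= in_itv/= => /andP[x0 x1].
  have d1 : is_derive x 1 (fun y : R => 1 - y) (- 1).
    have := is_derive_add (is_derive_cst (1 : R) x 1) (is_derive_opp (is_derive_id x (1 : R))).
    by rewrite add0r.
  have x1' : 0 < 1 - x by rewrite subr_gt0.
  have d2 := is_derive_comp d1 (is_derive1_powR s x1').
  apply: (is_derive_eq (is_derive_opp (is_derive_mul (is_derive_cst (s^-1 : R) x 1) d2))).
  by rewrite mul0r add0r mulrN1 mulrN opprK mulKf// gt_eqF.
- rewrite /= in_itv/= => /andP[x0 x1].
  have c1 : {for x, continuous (fun y : R => 1 - y)} by apply: cvgB; [exact: cvg_cst|exact: cvg_id].
  have x1' : 0 < 1 - x by rewrite subr_gt0.
  exact: (@continuous_comp _ _ _ (fun y : R => 1 - y) (fun z : R => z `^ (s - 1)) x c1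
    (continuous_powR x1')).
- by move=> _; exact: powR_ge0.
- rewrite /F subr0 powR1 mulr1; exact: cvg_cst.
- rewrite -oppr0 -(mulr0 s^-1); apply: cvgN; apply: cvgM; first exact: cvg_cst.
  rewrite (_ : (fun n => _) = (fun n : nat => n.+2%:R `^ (- s))); last first.
    apply/funext => n /=; rewrite opprB addrC subrK powRN.
    have y0 : n.+2%:R `^ s != 0 :> R by rewrite gt_eqF// powR_gt0.
    by apply: (mulIf y0); rewrite mulVf// -powRM// mulVf ?pnatr_eq0// powR1.
  have n2y : (n.+2%:R : R) @[n --> \oo] --> +oo.
    rewrite (cvg_shiftS (fun n => n.+1%:R : R)) (cvg_shiftS (fun n => n%:R : R)).
    exact: cvgr_idn.
  by apply: (cvg_comp _ _ n2y (@powR_cvgy0 R (- s) _)); rewrite oppr_lt0.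
Qed.

End halflines.

Section kernels.
Context (R : realType).

Notation mu := (@lebesgue_measure R).
Notation Rp := (`]0%R, +oo[%classic : set R).
Implicit Types (H K t s x : R).

Lemma fbm_kernel_shift H t u x :
  fbm_kernel H (t - u) (x - u) = fbm_kernel H t x - fbm_kernel H u x.
Proof.
rewrite /fbm_kernel; have -> : t - u - (x - u) = t - x by ring.
have -> : - (x - u) = u - x by ring.
ring.
Qed.

Lemma fbm_kernel0 H x : fbm_kernel H 0 x = 0.
Proof. by rewrite /fbm_kernel sub0r subrr. Qed.

Lemma pospow_scale (c x e : R) : 0 < c -> pospow (c * x) e = c `^ e * pospow x e.
Proof.
move=> c0; rewrite /pospow pmulr_rgt0//; case: ifPn => [x0|_]; last by rewrite mulr0.
by rewrite powRM// ltW.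
Qed.

Lemma fbm_kernel_scale H t x : 0 < t ->
  fbm_kernel H t (t * x) = t `^ (H - 2^-1) * fbm_kernel H 1 x.
Proof.
move=> t0; rewrite /fbm_kernel mulrBr -!pospow_scale//.
by congr (pospow _ _ - pospow _ _); ring.
Qed.

Lemma fbm_kernel1_neg H x : 0 < x -> fbm_kernel H 1 (- x) = pow_incr (H - 2^-1) x.
Proof.
by move=> x0; rewrite /fbm_kernel /pospow /pow_incr !opprK x0 ifT// addr_gt0.
Qed.

Variables H K : R.
Hypotheses (hH : 0 < H < 1) (hK : 0 < K < 1).
Hypothesis LH : forall t, fbm_kernel H t \in Lfun mu 2%:E.
Hypothesis LK : forall t, fbm_kernel K t \in Lfun mu 2%:E.

Definition kernel_cov t s := ip mu (fbm_kernel H t) (fbm_kernel K s).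

(** By fbm_kernel_shift and the invariance of Lebesgue measure under translations. *)
Lemma kernel_cov_stationary t s u :
  kernel_cov (t - u) (s - u) =
  kernel_cov t s - kernel_cov t u - kernel_cov u s + kernel_cov u u.
Proof.
transitivity (ip mu (fbm_kernel H t \- fbm_kernel H u) (fbm_kernel K s \- fbm_kernel K u)).
  rewrite /kernel_cov /ip (Rintegral_affine (- u) (oner_neq0 R)); last exact: L2_mul_integrable.
  rewrite normr1 mul1r.
  by apply: eq_Rintegral => x _; rewrite mul1r !fbm_kernel_shift.
exact: ipBB.
Qed.

Let kHK1 : mu.-integrable setT (EFin \o (fun x => fbm_kernel H 1 x * fbm_kernel K 1 x)).
Proof. exact: L2_mul_integrable. Qed.

Lemma kernel_cov_diag_gt0 t : 0 < t -> kernel_cov t t = t `^ (H + K) * kernel_cov 1 1.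
Proof.
move=> t0; rewrite /kernel_cov /ip.
rewrite (Rintegral_affine 0 (lt0r_neq0 t0)); last exact: L2_mul_integrable.
rewrite (gtr0_norm t0).
under eq_Rintegral do rewrite addr0 !fbm_kernel_scale// mulrACA -powRD ?(gt_eqF t0) ?implybT//.
rewrite RintegralZl// mulrA; congr (_ * _).
rewrite -[X in X * _](powRr1 (ltW t0)) -powRD ?(gt_eqF t0) ?implybT//.
by congr (_ `^ _); field.
Qed.

Lemma pow_incr_mul_integrable : mu.-integrable Rp
  (EFin \o (fun x => pow_incr (H - 2^-1) x * pow_incr (K - 2^-1) x)).
Proof.
have N1 : (-1 : R) != 0 by rewrite oppr_eq0 oner_eq0.
have h : mu.-integrable Rp
    (EFin \o (fun x => fbm_kernel H 1 (-1 * x + 0) * fbm_kernel K 1 (-1 * x + 0))).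
  by apply: integrableS (integrable_affine 0 N1 kHK1).
apply: eq_integrable h => // x; rewrite inE/= in_itv/= andbT => x0.
by rewrite mulN1r addr0 !fbm_kernel1_neg.
Qed.

(** Split the line at 0. On the left the kernels are increments of powers; on ]0, 1[ they
are powers of 1 - x, whose product integrates to 1 / (H + K), and beyond 1 they
vanish. *)
Lemma kernel_cov1 : kernel_cov 1 1 = cH H * cH K * aHH H K.
Proof.
rewrite -(norming_constant hH hK pow_incr_mul_integrable) addrC.
rewrite /kernel_cov /ip Rintegral_halflines//; congr (_ + _); last first.
  apply: eq_Rintegral => x; rewrite inE/= in_itv/= andbT => x0.
  by rewrite !fbm_kernel1_neg.
rewrite Rintegral_itv_obnd_cbnd; last exact: integrableS kHK1.
have s0 : 0 < H + K by case/andP: hH => ? _; case/andP: hK => ? _; rewrite addr_gt0.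
transitivity (\int[mu]_(x in `[0%R, 1%R[) ((1 - x) `^ (H + K - 1))).
  rewrite Rintegral_mkcond [RHS]Rintegral_mkcond; apply: eq_Rintegral => x _.
  rewrite !patchE !mem_setE !in_itv/= andbT.
  case: ifPn => //= x0; rewrite /fbm_kernel ![pospow (- x) _]/pospow oppr_gt0 ltNge x0/= !subr0.
  rewrite /pospow subr_gt0; case: ifPn => x1; last by rewrite mul0r.
  rewrite -powRD; last by rewrite subr_eq0 (gt_eqF x1) implybT.
  by congr (_ `^ _); field.
by rewrite /Rintegral power_integral01.
Qed.

Lemma kernel_cov_diag t : kernel_cov t t = `|t| `^ (H + K) * (cH H * cH K * aHH H K).
Proof.
rewrite -kernel_cov1; have [t0|t0|->] := ltgtP t 0.
- have t0' : 0 < - t by rewrite oppr_gt0.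
  rewrite (ltr0_norm t0) -(kernel_cov_diag_gt0 t0').
  exact/esym/(stationary_diag kernel_cov_stationary).
- by rewrite (gtr0_norm t0); exact: kernel_cov_diag_gt0.
have s0 : H + K != 0.
  by case/andP: hH => ? _; case/andP: hK => ? _; rewrite gt_eqF// addr_gt0.
rewrite normr0 powR0// mul0r /kernel_cov /ip.
by under eq_Rintegral do rewrite fbm_kernel0 mul0r; rewrite /Rintegral integral0.
Qed.

End kernels.

Section kernel_symmetry.
Context (R : realType).
Notation mu := (@lebesgue_measure R).
Variables H K : R.
Hypotheses (hH : 0 < H < 1) (hK : 0 < K < 1).
Hypothesis LH : forall t, fbm_kernel H t \in Lfun mu 2%:E.
Hypothesis LK : forall t, fbm_kernel K t \in Lfun mu 2%:E.
Local Notation G := (kernel_cov H K).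

Let norm_incr J t t' : 0 < J < 1 -> (forall t, fbm_kernel J t \in Lfun mu 2%:E) ->
  ip mu (fbm_kernel J t \- fbm_kernel J t') (fbm_kernel J t \- fbm_kernel J t') =
  (`|t - t'| `^ J) ^+ 2 * (cH J * cH J * aHH J J).
Proof.
move=> hJ LJ; have <- : `|t - t'| `^ (J + J) = (`|t - t'| `^ J) ^+ 2.
  by rewrite powRD ?expr2//; case/andP: hJ => ? _; rewrite gt_eqF ?addr_gt0.
rewrite -(kernel_cov_diag hJ hJ LJ LJ) (kernel_cov_stationary LJ LJ) /kernel_cov.
exact: ipBB.
Qed.

(** By scaling, the squared norm of k_J(t) - k_J(t') is |t - t'|^(2 J) up to a factor. The
factor is nonnegative, being the squared norm of k_J(1). *)
Let holder (f : R -> R) J t t' : 0 < J < 1 -> (forall t, fbm_kernel J t \in Lfun mu 2%:E) ->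
  f \in Lfun mu 2%:E ->
  `|ip mu (fbm_kernel J t) f - ip mu (fbm_kernel J t') f| <=
  Num.sqrt ((cH J * cH J * aHH J J) * ip mu f f) * `|t - t'| `^ J.
Proof.
move=> hJ LJ Lf; rewrite -ipBl//.
have LD := L2B (LJ t) (LJ t').
have := ip_sqr_le LD Lf; rewrite norm_incr// => h.
rewrite -sqrtr_sqr -[X in _ * X]ger0_norm ?powR_ge0// -sqrtr_sqr -sqrtrM.
  apply: ler_wsqrtr; apply: le_trans h _.
  by rewrite -mulrA mulrC.
rewrite -(kernel_cov1 hJ hJ LJ LJ).
by apply: mulr_ge0; apply: Rintegral_ge0 => x _; rewrite -expr2 sqr_ge0.
Qed.

Lemma kernel_cov_sym t s :
  G t s + G (- t) (- s) =
  (`|t| `^ (H + K) + `|s| `^ (H + K) - `|t - s| `^ (H + K)) * (cH H * cH K * aHH H K).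
Proof.
have [[H0 _] [K0 _]] := (andP hH, andP hK).
pose CL s := Num.sqrt (cH H * cH H * aHH H H * ip mu (fbm_kernel K s) (fbm_kernel K s)).
pose CR s := Num.sqrt (cH K * cH K * aHH K K * ip mu (fbm_kernel H s) (fbm_kernel H s)).
have cl t1 t2 u : `|G t1 u - G t2 u| <= (CL u + CR u) * `|t1 - t2| `^ H.
  apply: le_trans (holder t1 t2 hH LH (LK u)) _.
  by apply: ler_wpM2r; rewrite ?powR_ge0// lerDl sqrtr_ge0.
have cr u t1 t2 : `|G u t1 - G u t2| <= (CL u + CR u) * `|t1 - t2| `^ K.
  rewrite /kernel_cov !(ipC mu (fbm_kernel H u)).
  apply: le_trans (holder t1 t2 hK LK (LH u)) _.
  by apply: ler_wpM2r; rewrite ?powR_ge0// lerDr sqrtr_ge0.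
rewrite (stationary_cov (kernel_cov_stationary LH LK) H0 K0 cl cr).
by rewrite !kernel_cov_diag//; ring.
Qed.

End kernel_symmetry.

(** * The fields *)

Lemma ae_eq_L2 d (T : measurableType d) (R : realType) (mu : {measure set T -> \bar R})
    (f g : T -> R) : measurable_fun setT g -> f \in Lfun mu 2%:E ->
  {ae mu, forall x, g x = f x} -> g \in Lfun mu 2%:E.
Proof.
move=> mg Lf gf; apply: L2_sqr_integrable => //.
have fi := L2_mul_integrable Lf Lf; have mf := L2_measurable Lf.
move/integrableP: fi => [_ fi]; apply/integrableP; split.
  by apply/measurable_EFinP; exact: measurable_funX.
rewrite (ae_eq_integral (fun x => `|(f x * f x)%:E|)%E)//.
- by apply: measurableT_comp => //; apply/measurable_EFinP; exact: measurable_funX.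
- by apply: measurableT_comp => //; apply/measurable_EFinP; exact: measurable_funM.
- by apply: filterS gf => x /= gx _; rewrite gx expr2.
Qed.

Section fractional_field.
Context d (T : measurableType d) (R : realType) (P : probability T R).
Variables (B W : R -> {RV P >-> R}) (BH WH : R -> R -> {RV P >-> R}).
Hypotheses (hB : standard_brownian_motion B) (hW : standard_brownian_motion W).
Hypothesis hBW : independent_processes P B W.
Hypotheses (hBH : fractional_brownian_field B BH) (hWH : fractional_brownian_field W WH).
Notation mu := (@lebesgue_measure R).

Lemma fractional_field_L2 H t : 0 < H < 1 -> (BH H t : T -> R) \in Lfun P 2%:E.
Proof.
move=> hH; have [I wI e] := hBH t hH.
have [LI _ _] := wiener_isometry hB wI wI.
by apply: ae_eq_L2 (L2Z (cH H)^-1 LI) e.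
Qed.

Lemma kernel_L2 H t : 0 < H < 1 -> fbm_kernel H t \in Lfun mu 2%:E.
Proof. by move=> hH; have [I [] ] := hBH t hH. Qed.

Lemma fractional_field_cov H K t s : 0 < H < 1 -> 0 < K < 1 ->
  ip P (BH H t) (BH K s) = (cH H)^-1 * (cH K)^-1 * kernel_cov H K t s.
Proof.
move=> hH hK; have [I wI e] := hBH t hH; have [J wJ e'] := hBH s hK.
have [LI LJ eIJ] := wiener_isometry hB wI wJ.
rewrite (ae_eq_ip _ _ _ _ e e')//; last 2 first.
- exact: L2_measurable (L2Z _ LI).
- exact: L2_measurable (L2Z _ LJ).
rewrite ipZl ?L2Z// ipZr// eIJ mulrA; exact: erefl.
Qed.

Lemma fractional_field_cross H K t s : 0 < H < 1 -> 0 < K < 1 ->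
  ip P (BH H t) (WH K s) = 0.
Proof.
move=> hH hK; have [I wI e] := hBH t hH; have [J wJ e'] := hWH s hK.
have [LI _ _] := wiener_isometry hB wI wI; have [LJ _ _] := wiener_isometry hW wJ wJ.
rewrite (ae_eq_ip _ _ _ _ e e')//; last 2 first.
- exact: L2_measurable (L2Z _ LI).
- exact: L2_measurable (L2Z _ LJ).
by rewrite ipZl ?L2Z// ipZr// (wiener_cross hB hW hBW wI wJ) !mulr0.
Qed.

End fractional_field.

(** One formula for both signs of t, since even_part is even and odd_part is odd in t. *)
Lemma Z_fieldE (T : Type) (R : realType) (X Y : R -> R -> T -> R) H t :
  Z_field X Y H t = (fun w => 2^-1 *
    (((X H t \+ X H (- t)) \+ (Y H t \- Y H (- t))) w)).
Proof.
apply/funext => w; rewrite /Z_field /even_part /odd_part.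
by case: ifPn => _; rewrite ?opprK /=; field.
Qed.

Theorem theorem7 (R : realType) (d : measure_display) (T : measurableType d)
    (P : probability T R) (B W : R -> {RV P >-> R})
    (BH WH : R -> R -> {RV P >-> R})
    (hB : standard_brownian_motion B) (hW : standard_brownian_motion W)
    (hBW : independent_processes P B W)
    (hBH : fractional_brownian_field B BH)
    (hWH : fractional_brownian_field W WH)
    (H H' t s : R) (hH : 0 < H < 1) (hH' : 0 < H' < 1) :
  ('E_P[Z_field BH WH H t \* Z_field BH WH H' s])%E =
  (aHH H H' *
    ((`|t| `^ (H + H') + `|s| `^ (H + H') - `|t - s| `^ (H + H')) / 2))%:E.
Proof.
have LB J u : 0 < J < 1 -> (BH J u : T -> R) \in Lfun P 2%:E.
  exact: (fractional_field_L2 hB hBH).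
have LW J u : 0 < J < 1 -> (WH J u : T -> R) \in Lfun P 2%:E.
  exact: (fractional_field_L2 hW hWH).
pose E J u := (BH J u \+ BH J (- u) : T -> R).
pose O J u := (WH J u \- WH J (- u) : T -> R).
have LE J u : 0 < J < 1 -> E J u \in Lfun P 2%:E by move=> hJ; apply: L2D; exact: LB.
have LO J u : 0 < J < 1 -> O J u \in Lfun P 2%:E by move=> hJ; apply: L2B; exact: LW.
have LEO J u : 0 < J < 1 -> (E J u \+ O J u) \in Lfun P 2%:E.
  by move=> hJ; apply: L2D; [exact: LE|exact: LO].
have cB u v := fractional_field_cov hB hBH u v hH hH'.
have cW u v := fractional_field_cov hW hWH u v hH hH'.
have cross u v := fractional_field_cross hB hW hBW hBH hWH u v hH hH'.
have cross' u v := fractional_field_cross hB hW hBW hBH hWH u v hH' hH.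
have key c (k : R -> R -> R) :
    (forall u v, ip P (BH H u) (BH H' v) = c * k u v) ->
    (forall u v, ip P (WH H u) (WH H' v) = c * k u v) ->
    ip P (E H t \+ O H t) (E H' s \+ O H' s) = 2 * (c * (k t s + k (- t) (- s))).
  move=> kB kW.
  rewrite (ipDl (LE _ _ hH) (LO _ _ hH) (LEO _ _ hH')).
  rewrite (ipDr (LE _ _ hH') (LO _ _ hH') (LE _ _ hH)) (ipDr (LE _ _ hH') (LO _ _ hH') (LO _ _ hH)).
  have ipEE : ip P (E H t) (E H' s) = c * (k t s + k t (- s) + k (- t) s + k (- t) (- s)).
    rewrite /E (ipDl (LB _ _ hH) (LB _ _ hH) (LE _ _ hH')) !(ipDr (LB _ _ hH') (LB _ _ hH') (LB _ _ hH)).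
    by rewrite !kB; ring.
  have ipOO : ip P (O H t) (O H' s) = c * (k t s - k t (- s) - k (- t) s + k (- t) (- s)).
    by rewrite /O (ipBB (LW _ _ hH) (LW _ _ hH) (LW _ _ hH') (LW _ _ hH')) !kW; ring.
  have ipEO : ip P (E H t) (O H' s) = 0.
    rewrite /E (ipDl (LB _ _ hH) (LB _ _ hH) (LO _ _ hH')).
    by rewrite !(ipBr (LW _ _ hH') (LW _ _ hH') (LB _ _ hH)) !cross; ring.
  have ipOE : ip P (O H t) (E H' s) = 0.
    rewrite ipC /E (ipDl (LB _ _ hH') (LB _ _ hH') (LO _ _ hH)).
    by rewrite !(ipBr (LW _ _ hH) (LW _ _ hH) (LB _ _ hH')) !cross'; ring.
  rewrite ipEE ipOO ipEO ipOE; ring.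
have hc := gt_eqF (cH_gt0 hH); have hc' := gt_eqF (cH_gt0 hH').
have sym := kernel_cov_sym hH hH' (fun u => kernel_L2 hBH u hH) (fun u => kernel_L2 hBH u hH') t s.
rewrite unlock !Z_fieldE.
transitivity (ip P (fun w => 2^-1 * (E H t \+ O H t) w) (fun w => 2^-1 * (E H' s \+ O H' s) w))%:E.
  rewrite /ip /Rintegral fineK//.
  apply: integrable_fin_num => //.
  by apply: L2_mul_integrable; apply: L2Z; exact: LEO.
congr EFin; rewrite (ipZl _ (LEO _ _ hH) (L2Z _ (LEO _ _ hH'))) (ipZr _ (LEO _ _ hH) (LEO _ _ hH')).
rewrite (key _ _ cB cW) sym; move: (cH H) (cH H') hc hc' => c c' hc hc'.
by field; rewrite hc hc'.
Qed.
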